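(* Let $\Lambda\subseteq\{1,\ldots,n\}$, let $\{\varphi_\lambda(z_\lambda)\}_{\lambda\in\Lambda}$ be non-constant inner functions with $\varphi_\lambda$ depending only on the variable $z_\lambda$, and let $\mathcal{S}=\sum_{\lambda\in\Lambda}\varphi_\lambda(z_\lambda)H^2(\mathbb{D}^n)$ be the corresponding submodule of $H^2(\mathbb{D}^n)$. For any distinct $i,j\in\Lambda$, $$\big[(I_{\mathcal{S}}-R_{z_i}R_{z_i}^* ),\,(I_{\mathcal{S}}-R_{z_j}R_{z_j}^* )\big]=0$$ if and only if $\varphi_i(0)=0$ and $\varphi_j(0)=0$.
   Context: Throughout $n\ge 2$. $H^2(\mathbb{D}^n)$ is the Hardy space of analytic functions $f$ on the unit polydisc $\mathbb{D}^n$ with $\|f\|=\sup_{0\le r<1}\big(\int_{\mathbb{T}^n}|f(r\boldsymbol z)|^2\,d\mu\big)^{1/2}<\infty$, where $\mu$ is normalized Lebesgue measure on $\mathbb{T}^n$; $M_{z_j}$ is multiplication by the coordinate function $z_j$. A submodule is a closed subspace $\mathcal{S}\subseteq H^2(\mathbb{D}^n)$ with $M_{z_j}\mathcal{S}\subseteq\mathcal{S}$ for all $j\in\{1,\ldots,n\}$; $I_{\mathcal{S}}$ is the identity on $\mathcal{S}$. $R_{z_j}:=M_{z_j}|_{\mathcal{S}}:\mathcal{S}\to\mathcal{S}$, with adjoint taken on $\mathcal{S}$. $[A,B]:=AB-BA$. An inner function on $\mathbb{D}^n$ is a bounded analytic function on $\mathbb{D}^n$ whose boundary values have modulus $1$ almost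 everywhere on $\mathbb{T}^n$; $\varphi_\lambda$ is also regarded as a function of the single variable $z_\lambda\in\mathbb{D}$, and $\varphi_\lambda(0)$ is its value at $z_\lambda=0$. *)

(* Defs.v *)
From HB Require Import structures.
From mathcomp Require Import all_boot all_order all_algebra finmap.
From mathcomp Require Import complex.
From mathcomp Require Import all_classical all_reals all_analysis.
From mathcomp Require summability.

Set Implicit Arguments.
Unset Strict Implicit.
Unset Printing Implicit Defensive.

Import Order.TTheory GRing.Theory Num.Theory.
Import numFieldNormedType.Exports.

Local Open Scope classical_set_scope.
Local Open Scope ring_scope.
Local Open Scope complex_scope.

(* Points of C^n are row vectors.  Functions on the polydisc are represented by
   total functions on C^n; their values outside the polydisc are irrelevant, and
   equality of functions always means equality at every point of the polydisc. *)

Section torus_measure.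
Variable R : realType.

Definition angle_prob : probability (measurableTypeR R) R :=
  uniform_prob (mulr_gt0 (ltr0n R 2) (pi_gt0 R)).

Definition tuple_cons n (x : measurableTypeR R * n.-tuple (measurableTypeR R)) :
    n.+1.-tuple (measurableTypeR R) :=
  [the n.+1.-tuple (measurableTypeR R) of x.1 :: x.2].

Lemma measurable_tuple_cons n : measurable_fun setT (@tuple_cons n).
Proof. exact: measurable_cons measurable_fst measurable_snd. Qed.

HB.instance Definition _ n :=
  isMeasurableFun.Build _ _ _ _ (@tuple_cons n) (@measurable_tuple_cons n).

(* Normalized Lebesgue measure on T^n, read on the angles
   (t_1, ..., t_n) in [0, 2 pi]^n: the n-fold product of the uniform
   probability on [0, 2 pi]. *)
Fixpoint torus_prob (n : nat) :
    probability (n.-tuple (measurableTypeR R)) R :=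
  match n with
  | 0 => dirac [tuple of [::]]
  | m.+1 => distribution (angle_prob \x torus_prob m)%E (@tuple_cons m)
  end.

End torus_measure.

Section polydisc.
Variables (R : realType) (n : nat).
Local Notation C := (R[i]).
Implicit Types (f g : 'rV[C]_n -> C) (z w : 'rV[C]_n).

Definition polydisc : set 'rV[C]_n :=
  [set z | forall j, Normc.normc (z ord0 j) < 1].

Definition torus_pt (r : R) (t : n.-tuple (measurableTypeR R)) : 'rV[C]_n :=
  \row_(j < n) (r * cos (tnth t j) +i* (r * sin (tnth t j))).

(* Multi-indexed power series are summed unconditionally (along the net of
   finite sets of multi-indices). *)
Definition analytic_on_polydisc f :=
  forall w, polydisc w ->
  exists (e : R) (a : {ffun 'I_n -> nat} -> C), 0 < e /\
    forall z, (forall j, Normc.normc (z ord0 j - w ord0 j) < e) ->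
      (summability.partial_sum
         (fun k => a k * \prod_(j < n) (z ord0 j - w ord0 j) ^+ k j : C^o) A
       @[A --> summability.totally]) --> (f z : C^o).

Definition h2norm f : \bar R :=
  ereal_sup [set sqrte
    (\int[torus_prob R n]_t (Normc.normc (f (torus_pt r t)) ^+ 2)%:E)%E
    | r in `[0, 1[%classic].

Definition H2 : set ('rV[C]_n -> C) :=
  [set f | analytic_on_polydisc f /\ (h2norm f < +oo)%E].

(* The inner product of H^2, recovered from the norm by polarization; it is
   linear in the first argument. *)
Definition h2inner f g : C :=
  4%:R^-1 * \sum_(k < 4)
    'i ^+ k * (fine (h2norm (fun z => (f z + 'i ^+ k * g z)%R)) ^+ 2)%:C.

Definition mulz (j : 'I_n) f : 'rV[C]_n -> C := fun z => z ord0 j * f z.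

(* Boundary values are radial limits. *)
Definition inner_function f :=
  [/\ exists M : R, forall z, polydisc z -> Normc.normc (f z) <= M,
      analytic_on_polydisc f
    & {ae torus_prob R n, forall t, exists b : C, Normc.normc b = 1 /\
        f (torus_pt r t) @[r --> (1 : R)^'-] --> (b : C^o)}].

Definition depends_only_on (l : 'I_n) f :=
  forall z w, polydisc z -> polydisc w -> z ord0 l = w ord0 l -> f z = f w.

Definition nonconstant f :=
  exists z w, [/\ polydisc z, polydisc w & f z <> f w].

Definition sum_phiH2 (L : {set 'I_n}) (phi : 'I_n -> 'rV[C]_n -> C) :
    set ('rV[C]_n -> C) :=
  [set f | exists g : 'I_n -> 'rV[C]_n -> C,
     (forall l, l \in L -> H2 (g l)) /\
     forall z, polydisc z -> f z = \sum_(l in L) phi l z * g l z].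

(* An operator on a subspace S is given by its action on functions, of which
   only the restriction to S matters.  [adjoint S T] is the adjoint of T|_S
   taken on S (it is determined on the polydisc whenever it exists). *)
Definition adjoint (S : set ('rV[C]_n -> C))
    (T : ('rV[C]_n -> C) -> 'rV[C]_n -> C) g : 'rV[C]_n -> C :=
  xget (fun=> 0) [set h | S h /\ forall f, S f -> h2inner (T f) g = h2inner f h].

(* I_S - R_{z_j} R_{z_j}^*, where R_{z_j} is the restriction of M_{z_j} to S. *)
Definition defect (S : set ('rV[C]_n -> C)) (j : 'I_n) f : 'rV[C]_n -> C :=
  f \- mulz j (adjoint S (mulz j) f).

Definition commutator (A B : ('rV[C]_n -> C) -> 'rV[C]_n -> C) f :
    'rV[C]_n -> C :=
  A (B f) \- B (A f).

End polydisc.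

(* Main.v *)
(**
Passing to Taylor coefficients identifies H^2 with l^2 over the multi-indices,
Parseval's formula being obtained by integrating over tori of radius r < 1.
That an analytic function is the sum of one power series on the whole polydisc
is also reduced to Parseval: if the series at 0 represents f exactly up to the
radius s < 1, then by compactness the series of f at the points of a torus of
radius slightly below s have uniformly bounded coefficients; each of these is
itself a power series in the centre, so Cauchy's estimate (a consequence of
Parseval) bounds the numbers C(k,p) |a_k|, and summing these bounds over p
makes the series at 0 converge beyond s.

Let A_l be multiplication by phi_l, M_l multiplication by z_l, B_l and N_l their
adjoints, E_l = 1 - M_l N_l, Q_l = 1 - A_l B_l.  These operators commute for
distinct indices, so the orthogonal complement of S is the range of the product
of all Q_l.  Let W be the product of the Q_l with l <> i, j.  As A_i commutes
with M_i, on S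
  I - R_i R_i^* = E_i + (A_i E_i B_i - E_i) Q_j W.
If phi_i(0) = phi_j(0) = 0 then E_i A_i = 0 and E_j A_j = 0, and the two operators
commute.  Conversely, with a = phi_i(0) and b = phi_j(0), applying the commutator
to phi_i phi_j gives
  (b (phi_i - a) (1 - conj b phi_j) - a (phi_j - b) (1 - conj a phi_i)) W1;
at z_i = 0 its vanishing forces a (1 - |a|^2) (phi_j - b) = 0, hence a = 0.
*)
From HB Require Import structures.
Require Import Defs.
From mathcomp Require Import all_boot all_order all_algebra finmap.
From mathcomp Require Import complex.
From mathcomp Require Import all_classical all_reals all_analysis.
From mathcomp Require Import measurable_realfun.
From mathcomp Require summability.
From mathcomp Require Import ring lra.

Set Implicit Arguments.
Unset Strict Implicit.
Unset Printing Implicit Defensive.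

Import Order.TTheory GRing.Theory Num.Theory.
Import numFieldNormedType.Exports.

Local Open Scope classical_set_scope.
Local Open Scope ring_scope.
Local Open Scope complex_scope.

(** * Unconditional sums *)

Section sums.
Variables (K : numFieldType).
Implicit Types (I J : choiceType).

(** The formula for the defect operator comes from R_i^* = P N_i, where P = 1 - Q_i Q_j W is the
    projection onto S. As N_i commutes with Q_j W, this gives I - R_i R_i^* = E_i + M_i Q_i N_i Q_j
    W on S, and M_i Q_i N_i simplifies on the kernel of Q_i, which contains Q_j W u for every u in
    S. The test vector phi_i phi_j lies in the ranges of both A_i and A_j. The inner defect operator
    therefore reduces to E_j or E_i, and the commutator can be computed from the constant function 1
    alone. Inner functions enter through one property: A_l is isometric. Radial limits give it on
    polynomials, and a density argument extends it to B_l A_l = 1 on all of l^2. Sums over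
    multi-indices are taken along finite sets, so reindexing and exchange of sums need no
    enumeration; sequences of finite sets appear only where dominated convergence is applied. Since
    functions matter on the polydisc only, statements about [defect] are carried to coefficients by
    [ev], which is injective there. *)

Definition hasum I (u : I -> K) (s : K) :=
  forall e : K, 0 < e -> exists A0 : {fset I}, forall A : {fset I},
    (A0 `<=` A)%fset -> `|\sum_(i <- A) u i - s| < e.

Lemma eq_hasum I (u v : I -> K) s : u =1 v -> hasum u s -> hasum v s.
Proof.
move=> uv us e e0; have [A0 hA] := us e e0; exists A0 => A /hA.
by under eq_bigr do rewrite uv.
Qed.

Lemma hasum_unique I (u : I -> K) s t : hasum u s -> hasum u t -> s = t.
Proof.
move=> us ut; apply/eqP; rewrite -subr_eq0 -normr_le0.
apply/ler_addgt0Pl => e e0; rewrite addr0.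
have e2 : 0 < e / 2 by rewrite divr_gt0.
have [A hA] := us _ e2; have [B hB] := ut _ e2.
have {}hA := hA _ (fsubsetUl A B); have {}hB := hB _ (fsubsetUr A B).
rewrite -[s - t]addr0 -(subrr (\sum_(i <- (A `|` B)%fset) u i)).
set x := (\sum_(i <- _) _) in hA hB *.
have -> : s - t + (x - x) = (x - t) - (x - s) by ring.
apply: le_trans (ler_normB _ _) _.
by rewrite [leRHS](splitr e) lerD ?ltW.
Qed.

Lemma hasumD I (u v : I -> K) s t :
  hasum u s -> hasum v t -> hasum (fun i => u i + v i) (s + t).
Proof.
move=> us vt e e0; have e2 : 0 < e / 2 by rewrite divr_gt0.
have [A hA] := us _ e2; have [B hB] := vt _ e2.
exists (A `|` B)%fset => D; rewrite fsubUset => /andP[/hA h1 /hB h2].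
rewrite big_split /= opprD addrACA (splitr e).
by apply: le_lt_trans (ler_normD _ _) _; rewrite ltrD.
Qed.

Lemma hasumZ I c (u : I -> K) s : hasum u s -> hasum (fun i => c * u i) (c * s).
Proof.
move=> us e e0.
have e1 : 0 < e / (`|c| + 1) by rewrite divr_gt0 // ltr_wpDl.
have [A hA] := us _ e1; exists A => D /hA; rewrite ltr_pdivlMr ?ltr_wpDl //.
rewrite -mulr_sumr -mulrBr normrM; apply: le_lt_trans.
by rewrite mulrC ler_wpM2l // lerDl.
Qed.

Lemma hasum_zero I : hasum (fun _ : I => 0) 0.
Proof. by move=> e e0; exists fset0 => A _; rewrite big1 // subr0 normr0. Qed.

Lemma hasum_sum I (T : Type) (r : seq T) (P : pred T) (u : T -> I -> K) s :
  (forall t, P t -> hasum (u t) (s t)) ->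
  hasum (fun i => \sum_(t <- r | P t) u t i) (\sum_(t <- r | P t) s t).
Proof.
move=> us; elim: r => [|t r IH].
  by rewrite big_nil; apply: eq_hasum (@hasum_zero I) => i; rewrite big_nil.
rewrite big_cons; case: ifP => Pt.
  by apply: eq_hasum (hasumD (us t Pt) IH) => i; rewrite big_cons Pt.
by apply: eq_hasum IH => i; rewrite big_cons Pt.
Qed.

Lemma hasum1 I (i0 : I) x : hasum (fun i => if i == i0 then x else 0) x.
Proof.
move=> e e0; exists [fset i0]%fset => A; rewrite fsub1set => iA.
rewrite (big_fsetD1 i0) //= eqxx big1_fset ?addr0 ?subrr ?normr0 //.
by move=> i; rewrite !inE => /andP[/negPf ->].
Qed.

Lemma hasum_finite I (T : finType) (P : pred T) (g : T -> I) (u : I -> K) :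
  {in P &, injective g} -> (forall i, (forall t, P t -> g t != i) -> u i = 0) ->
  hasum u (\sum_(t | P t) u (g t)).
Proof.
move=> gI u0.
apply: eq_hasum (hasum_sum (index_enum T)
  (fun t _ => hasum1 (g t) (u (g t)))) => i /=.
have [[t /andP[Pt /eqP git]]|nex] := pselect (exists t, P t && (g t == i)).
  rewrite (bigD1 t) //= -git eqxx big1 ?addr0 // => t' /andP[Pt' t't].
  by case: ifP => // /eqP /(gI _ _ Pt Pt') ett; rewrite ett eqxx in t't.
have ng t : P t -> g t != i by move=> Pt; apply/negP => gt; apply: nex; exists t; rewrite Pt.
by rewrite u0 // big1 // => t Pt; rewrite eq_sym (negPf (ng t Pt)).
Qed.

(* No absolute convergence is needed: a finite sum of fibre sums is
   approximated by a finite partial sum containing any prescribed finite set. *)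
Lemma hasum_fiber I J (h : J -> I) (u : J -> K) (v : I -> K) s :
  (forall i, hasum (fun j => if h j == i then u j else 0) (v i)) ->
  hasum u s -> hasum v s.
Proof.
move=> uv us e e0; have e2 : 0 < e / 2 by rewrite divr_gt0.
have [A0 hA0] := us _ e2; exists [fset h j | j in A0]%fset => B hB.
have /(_ _ e2)[A1 hA1] := hasum_sum (P := xpredT) (enum_fset B) (fun i _ => uv i).
have {hA1} := hA1 _ (fsubsetUr A0 A1); set A := (A0 `|` A1)%fset => hA1.
have e1 : \sum_(j <- A) \sum_(i <- B) (if h j == i then u j else 0) =
    \sum_(j <- [fset j in A | h j \in B]%fset) u j.
  rewrite big_fset /= [RHS]big_mkcond; apply: eq_bigr => j _.
  case: ifP => hjB; last first.
    apply: big1_seq => i /andP[_ iB]; case: eqP => // hji.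
    by rewrite hji iB in hjB.
  rewrite (big_fsetD1 (h j)) //= eqxx big1_fset ?addr0 // => i.
  by rewrite !inE => /andP[/negPf]; rewrite eq_sym => ->.
rewrite e1 in hA1.
have sA0 : (A0 `<=` [fset j in A | h j \in B])%fset.
  apply/fsubsetP => j jA0; rewrite !inE /= jA0 /=.
  by apply: (fsubsetP hB); apply/imfsetP; exists j.
have := hA0 _ sA0; set x := (\sum_(j <- _) _) in hA1 * => hA.
have -> : \sum_(i <- B) v i - s = (x - s) - (x - \sum_(i <- B) v i) by ring.
rewrite (splitr e); apply: le_lt_trans (ler_normB _ _) _.
by rewrite ltrD.
Qed.

Lemma hasum_inj I J (g : J -> I) (u : I -> K) s :
  injective g -> (forall i, (forall j, g j != i) -> u i = 0) ->
  hasum (u \o g) s -> hasum u s.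
Proof.
move=> gI u0; apply: (hasum_fiber (h := g)) => i.
have [[j gj]|nex] := pselect (exists j, g j = i).
  apply: eq_hasum (hasum1 j (u i)) => j' /=.
  have [->|jj] := eqVneq j' j; first by rewrite gj eqxx.
  by case: eqP => // gj'; case/eqP: jj; apply: gI; rewrite gj gj'.
have ng j : g j != i by apply/eqP => gj; apply: nex; exists j.
rewrite u0 //; apply: eq_hasum (@hasum_zero J) => j.
by rewrite (negPf (ng j)).
Qed.

(** Dominated convergence is about sequences; this trades the net of finite sets for a sequence that
    eventually absorbs each of them. *)
Lemma hasum_subseq I (u : I -> K) s (A : nat -> {fset I}) :
  hasum u s -> (forall B, \forall N \near \oo, (B `<=` A N)%fset) ->
  forall e, 0 < e -> \forall N \near \oo, `|\sum_(i <- A N) u i - s| < e.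
Proof.
move=> us hA e e0; have [B hB] := us e e0.
by near=> N; apply: hB; near: N; apply: hA.
Unshelve. all: by end_near. Qed.

End sums.

Lemma le_sum_fset (R : realType) (I : choiceType) (u : I -> R) (A B : {fset I}) :
  (forall i, 0 <= u i) -> (A `<=` B)%fset ->
  \sum_(i <- A) u i <= \sum_(i <- B) u i.
Proof.
move=> u0 AB; rewrite [leRHS](big_fsetID _ (mem A)) /=.
have -> : [fset x in B | x \in A]%fset = A.
  by apply/fsetP => i; rewrite !inE /= andb_idl // => /(fsubsetP AB).
by rewrite lerDl sumr_ge0.
Qed.

Lemma hasum_ge (R : realType) (I : choiceType) (u : I -> R) s :
  (forall i, 0 <= u i) -> hasum u s ->
  forall A : {fset I}, \sum_(i <- A) u i <= s.
Proof.
move=> u0 us A; apply/ler_addgt0Pl => e e0; have [B hB] := us e e0.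
have := hB _ (fsubsetUr A B); rewrite ltr_distl => /andP[_ h].
by rewrite addrC; exact: le_trans (le_sum_fset u0 (fsubsetUl A B)) (ltW h).
Qed.

Lemma hasum_le (R : realType) (I : choiceType) (u : I -> R) s M :
  hasum u s -> (forall A : {fset I}, \sum_(i <- A) u i <= M) -> s <= M.
Proof.
move=> us uM; apply/ler_addgt0Pl => e e0; have [B hB] := us e e0.
have := hB _ (fsubset_refl B); rewrite ltr_distl => /andP[h _].
by have := uM B; lra.
Qed.

Lemma hasum_bounded (R : realType) (I : choiceType) (u : I -> R) M :
  (forall i, 0 <= u i) -> (forall A : {fset I}, \sum_(i <- A) u i <= M) ->
  exists s, hasum u s.
Proof.
move=> u0 uM; pose X := [set x | exists A : {fset I}, x = \sum_(i <- A) u i].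
have hX : has_sup X.
  split; first by exists (\sum_(i <- fset0) u i), fset0.
  by exists M => _ [A ->].
exists (sup X) => e e0.
have [_ [A ->] hA] := sup_adherent e0 hX; exists A => B AB.
have h1 : \sum_(i <- B) u i <= sup X by apply: sup_upper_bound => //; exists B.
have h2 := le_sum_fset u0 AB.
by rewrite ltr_norml; apply/andP; split; lra.
Qed.

(** * Absolutely summable complex families *)

Section complex_sums.
Variable R : realType.
Local Notation C := R[i].
Local Notation normc := Normc.normc.
Implicit Types (I J : choiceType).

Lemma normC_normc (x : C) : `|x| = (normc x)%:C.
Proof. by []. Qed.

Lemma normc_ge0 (x : C) : 0 <= normc x.
Proof. by case: x => a b; exact: sqrtr_ge0. Qed.

(** In the order of [R[i]] only real numbers are positive, so the tolerance in a complex [hasum] is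
    a real one. *)
Lemma posc_real (e : C) : 0 < e -> exists2 r : R, 0 < r & e = r%:C.
Proof.
case: e => a b; rewrite ltcE /= => /andP[/eqP h a0]; exists a => //.
by rewrite h.
Qed.

Lemma hasum_normcP I (u : I -> C) s : hasum u s <->
  forall e : R, 0 < e -> exists A0 : {fset I}, forall A : {fset I},
    (A0 `<=` A)%fset -> normc (\sum_(i <- A) u i - s) < e.
Proof.
split=> [us e e0|us _ /posc_real[e e0 ->]].
  have /us[A hA] : 0 < e%:C by rewrite ltcR.
  by exists A => B /hA; rewrite normC_normc ltcR.
by have [A hA] := us e e0; exists A => B /hA; rewrite normC_normc ltcR.
Qed.

Lemma normc_sum (T : Type) (r : seq T) (P : pred T) (u : T -> C) :
  normc (\sum_(t <- r | P t) u t) <= \sum_(t <- r | P t) normc (u t).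
Proof.
elim/big_rec2: _ => [|t x y _ h]; first by rewrite Normc.normc0.
exact: le_trans (le_normcD _ _) (lerD _ h).
Qed.

Lemma hasum_real I (u : I -> R) s : hasum u s -> hasum (fun i => (u i)%:C) s%:C.
Proof.
move=> us; apply/hasum_normcP => e e0; have [A hA] := us e e0; exists A => B /hA.
rewrite -(rmorph_sum (real_complex R)) -rmorphB /=.
by rewrite /= expr0n /= addr0 sqrtr_sqr.
Qed.

(** Absolute summability with its bound kept explicit, because coefficient estimates are obtained by
    passing this bound on to the sum ([hasum_normc_le]). *)
Definition bsum I (u : I -> C) (M : R) :=
  forall A : {fset I}, \sum_(i <- A) normc (u i) <= M.

Lemma hasum_bsum_real I (u : I -> R) M :
  (forall A : {fset I}, \sum_(i <- A) `|u i| <= M) -> exists s, hasum u s.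
Proof.
move=> uM.
have [s hs] := hasum_bounded (fun i => normr_ge0 (u i)) uM.
(* Both [u + |u|] and [|u|] are nonnegative with bounded partial sums, and [u] is their
   difference. *)
have [||t ht] := @hasum_bounded _ _ (fun i => u i + `|u i|) (M + M).
- by move=> i; have := ler_norm (- u i); rewrite normrN; lra.
- move=> A; rewrite big_split /= lerD //; apply: le_trans (uM A).
  by apply: ler_sum => i _; exact: ler_norm.
exists (t + - 1 * s); apply: eq_hasum (hasumD ht (hasumZ (-1) hs)) => i /=.
by ring.
Qed.

Lemma Re_le_normc (x : C) : `|complex.Re x| <= normc x.
Proof. by case: x => a b /=; rewrite -sqrtr_sqr ler_wsqrtr // lerDl sqr_ge0. Qed.

Lemma Im_le_normc (x : C) : `|complex.Im x| <= normc x.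
Proof. by case: x => a b /=; rewrite -sqrtr_sqr ler_wsqrtr // lerDr sqr_ge0. Qed.

Lemma hasum_normc_le I (u : I -> C) M s : bsum u M -> hasum u s -> normc s <= M.
Proof.
move=> uM /hasum_normcP us; apply/ler_addgt0Pl => e e0; have [A hA] := us e e0.
have := hA _ (fsubset_refl A); set x := \sum_(i <- A) _ => h.
have -> : s = x - (x - s) by ring.
apply: le_trans (le_normcD _ _) _; rewrite normcN addrC lerD ?(ltW h) //.
exact: le_trans (normc_sum _ _ _) (uM A).
Qed.

Lemma bsum_hasum I (u : I -> C) M : bsum u M -> exists s, hasum u s.
Proof.
move=> uM.
have [|s hs] := @hasum_bsum_real I (fun i => complex.Re (u i)) M.
- by move=> A; apply: le_trans (uM A); apply: ler_sum => i _; exact: Re_le_normc.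
have [|t ht] := @hasum_bsum_real I (fun i => complex.Im (u i)) M.
- by move=> A; apply: le_trans (uM A); apply: ler_sum => i _; exact: Im_le_normc.
exists (s%:C + 'i * t%:C).
apply: eq_hasum (hasumD (hasum_real hs) (hasumZ 'i (hasum_real ht))) => i /=.
by rewrite -complexE.
Qed.

(** Tonelli's inequality: a finite set of pairs is split along its first coordinates, and each slice
    embeds in a finite part of one row. *)
Lemma bsum_pair I J (u : I * J -> C) (V : I -> R) M :
  (forall i, bsum (fun j => u (i, j)) (V i)) ->
  (forall A : {fset I}, \sum_(i <- A) V i <= M) -> bsum u M.
Proof.
move=> uV VM A.
apply: le_trans (VM [fset p.1 | p in A]%fset).
rewrite (partition_big_imfset _ (fun p => p.1)) /=.
apply: ler_sum => i _; apply: le_trans (uV i [fset p.2 | p in A]%fset).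
rewrite big_fset_condE; set B := [fset p in A | p.1 == i]%fset.
have Bi p : p \in B -> p = (i, p.2).
  by rewrite !inE /= => /andP[_ /eqP <-]; case: p.
have -> : \sum_(p <- B) normc (u p) = \sum_(j <- [fset p.2 | p in B]%fset) normc (u (i, j)).
  rewrite [RHS]big_imfset /=; last first.
    by move=> p q pB qB pq; rewrite (Bi p pB) (Bi q qB) pq.
  by apply: eq_big_seq => p /Bi {1}->.
apply: le_sum_fset => [j|]; first exact: normc_ge0.
apply/fsubsetP => _ /imfsetP[p /= pB ->]; apply/imfsetP; exists p => //.
by move: pB; rewrite !inE => /andP[].
Qed.

(** The bound makes the sum over all pairs exist; both iterated sums equal it, by grouping along the
    fibres of [fst] and of [snd]. *)
Lemma hasum_pair I J (u : I * J -> C) M (v : I -> C) (w : J -> C) s :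
  bsum u M ->
  (forall i, hasum (fun j => u (i, j)) (v i)) ->
  (forall j, hasum (fun i => u (i, j)) (w j)) ->
  hasum v s -> hasum w s.
Proof.
move=> uM uv uw vs; have [t ut] := bsum_hasum uM.
suff vt : hasum v t.
  rewrite (hasum_unique vs vt); apply: (hasum_fiber (h := snd)) ut => j.
  apply: (hasum_inj (g := fun i => (i, j))) => [i i' []//|[i j'] ij|].
    by case: eqP => //= jj; have := ij i; rewrite jj eqxx.
  by apply: eq_hasum (uw j) => i /=; rewrite eqxx.
apply: (hasum_fiber (h := fst)) ut => i.
apply: (hasum_inj (g := fun j => (i, j))) => [j j' []//|[i' j] ij|].
  by case: eqP => //= ii; have := ij j; rewrite ii eqxx.
by apply: eq_hasum (uv i) => j /=; rewrite eqxx.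
Qed.

(** The value is 0 for a family without a sum; [locked] keeps conversion from unfolding the
    choice. *)
Definition tsum I (u : I -> C) : C := locked (xget 0 [set s | hasum u s]).

Lemma tsumP I (u : I -> C) M : bsum u M -> hasum u (tsum u).
Proof.
move=> /bsum_hasum[s hs]; rewrite /tsum -lock.
exact: (xgetPex 0 (ex_intro _ s hs)).
Qed.

Lemma hasum_tsum I (u : I -> C) s : hasum u s -> tsum u = s.
Proof.
move=> us; apply: hasum_unique (us); rewrite /tsum -lock.
exact: (xgetPex 0 (ex_intro _ s us)).
Qed.

Lemma le_bsum I (u v : I -> C) M :
  (forall i, normc (u i) <= normc (v i)) -> bsum v M -> bsum u M.
Proof. by move=> uv vM A; apply: le_trans (vM A); apply: ler_sum. Qed.

Lemma hasum_partial_sum I (u : I -> C) s : hasum u s <->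
  (summability.partial_sum (u : I -> C^o) A @[A --> summability.totally])
    --> (s : C^o).
Proof.
have FF : ProperFilter (@summability.totally I).
  exact: summability.totally_filter.
split=> [us|/cvgrPdist_lt us].
  apply/cvgrPdist_lt => e e0; have [A hA] := us e e0.
  exists A => // B /= /hA; rewrite distrC.
  by rewrite /summability.partial_sum (big_seq_fsetE _ _ xpredT u).
move=> e e0; have [A _ hA] := us e e0; exists A => B AB; rewrite distrC.
have := hA B AB.
by rewrite /summability.partial_sum /= (big_seq_fsetE _ _ xpredT u).
Qed.

End complex_sums.

(** * Integrals over the torus *)

Section bounded_mean.
Context (R : realType) d (T : measurableType d) (P : probability T R).
Local Notation C := R[i].
Implicit Types (f g : T -> R) (F G : T -> C).

(** On a probability space boundedness yields integrability and, unlike integrability, it is stable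
    under products. *)
Definition bmeas f := measurable_fun setT f /\ exists M, forall x, `|f x| <= M.

Definition mean f : R := Rintegral P setT f.

Lemma bmeas_integrable f : bmeas f -> P.-integrable setT (EFin \o f).
Proof.
move=> [mf [M fM]]; apply: measurable_bounded_integrable => //.
  by apply: le_lt_trans (probability_le1 P measurableT) _; rewrite ltry.
exists M; split; first by rewrite num_real.
by move=> x Mx y _; exact: le_trans (fM y) (ltW Mx).
Qed.

Lemma meanE f : bmeas f -> (\int[P]_x (f x)%:E = (mean f)%:E)%E.
Proof.
move=> /bmeas_integrable fi; rewrite /mean /Rintegral fineK //.
exact: integrable_fin_num.
Qed.

Lemma bmeas_cst c : bmeas (fun=> c).
Proof. by split=> //; exists `|c|. Qed.

Lemma bmeasD f g : bmeas f -> bmeas g -> bmeas (fun x => f x + g x).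
Proof.
move=> [mf [M fM]] [mg [N gN]]; split; first exact: measurable_funD.
by exists (M + N) => x; apply: le_trans (ler_normD _ _) _; rewrite lerD.
Qed.

Lemma bmeasM f g : bmeas f -> bmeas g -> bmeas (fun x => f x * g x).
Proof.
move=> [mf [M fM]] [mg [N gN]]; split; first exact: measurable_funM.
by exists (M * N) => x; rewrite normrM ler_pM.
Qed.

Lemma bmeasZ c f : bmeas f -> bmeas (fun x => c * f x).
Proof. exact/bmeasM/bmeas_cst. Qed.

Lemma bmeasN f : bmeas f -> bmeas (fun x => - f x).
Proof.
move=> mf; have := bmeasZ (-1) mf.
by under [X in bmeas X -> _]eq_fun do rewrite mulN1r.
Qed.

Lemma meanD f g : bmeas f -> bmeas g ->
  mean (fun x => f x + g x) = mean f + mean g.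
Proof. by move=> /bmeas_integrable fi /bmeas_integrable gi; exact: RintegralD. Qed.

Lemma meanZ c f : bmeas f -> mean (fun x => c * f x) = c * mean f.
Proof. by move=> /bmeas_integrable fi; exact: RintegralZl. Qed.

Lemma meanN f : bmeas f -> mean (fun x => - f x) = - mean f.
Proof.
move=> mf; rewrite -mulN1r -meanZ //; congr mean.
by apply/funext => x; rewrite mulN1r.
Qed.

Lemma mean_cst c : mean (fun=> c) = c.
Proof. by rewrite /mean Rintegral_cst // [fine _](_ : _ = 1) ?mulr1 //= -[RHS]/(fine 1%E) -(probability_setT P). Qed.

Definition cbmeas F := bmeas (fun x => complex.Re (F x)) /\ bmeas (fun x => complex.Im (F x)).

Definition cmean F : C :=
  mean (fun x => complex.Re (F x)) +i* mean (fun x => complex.Im (F x)).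

Lemma cbmeas_cst c : cbmeas (fun=> c).
Proof. by split; exact: bmeas_cst. Qed.

Lemma ReD (x y : C) : complex.Re (x + y) = complex.Re x + complex.Re y.
Proof. by case: x y => ? ? []. Qed.
Lemma ImD (x y : C) : complex.Im (x + y) = complex.Im x + complex.Im y.
Proof. by case: x y => ? ? []. Qed.
Lemma ReM (x y : C) : complex.Re (x * y) =
  complex.Re x * complex.Re y - complex.Im x * complex.Im y.
Proof. by case: x y => ? ? []. Qed.
Lemma ImM (x y : C) : complex.Im (x * y) =
  complex.Re x * complex.Im y + complex.Im x * complex.Re y.
Proof. by case: x y => ? ? [] ? ? //=; rewrite addrC [in RHS]addrC. Qed.

Lemma cbmeasD F G : cbmeas F -> cbmeas G -> cbmeas (fun x => F x + G x).
Proof.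
move=> [rF iF] [rG iG]; split.
  by under eq_fun do rewrite ReD; exact: bmeasD.
by under eq_fun do rewrite ImD; exact: bmeasD.
Qed.

Lemma cbmeasM F G : cbmeas F -> cbmeas G -> cbmeas (fun x => F x * G x).
Proof.
move=> [rF iF] [rG iG]; split.
  by under eq_fun do rewrite ReM; apply: bmeasD; [|apply: bmeasN]; exact: bmeasM.
by under eq_fun do rewrite ImM; apply: bmeasD; exact: bmeasM.
Qed.

Lemma cbmeas_conj F : cbmeas F -> cbmeas (fun x => conjc (F x)).
Proof.
move=> [rF iF]; split.
  rewrite (_ : (fun x => _) = (fun x => complex.Re (F x))) //.
  by apply/funext => x; case: (F x).
rewrite (_ : (fun x => _) = (fun x => - complex.Im (F x))); first exact: bmeasN.
by apply/funext => x; case: (F x).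
Qed.

Lemma cbmeasX F k : cbmeas F -> cbmeas (fun x => F x ^+ k).
Proof.
move=> mF; elim: k => [|k IH]; first exact: cbmeas_cst.
by under eq_fun do rewrite exprS; exact: cbmeasM.
Qed.

Lemma cbmeas_sum (J : Type) (r : seq J) (F : J -> T -> C) :
  (forall j, cbmeas (F j)) -> cbmeas (fun x => \sum_(j <- r) F j x).
Proof.
move=> mF; elim: r => [|j r IH].
  by under eq_fun do rewrite big_nil; exact: cbmeas_cst.
by under eq_fun do rewrite big_cons; exact: cbmeasD.
Qed.

Lemma cbmeas_prod (J : Type) (r : seq J) (F : J -> T -> C) :
  (forall j, cbmeas (F j)) -> cbmeas (fun x => \prod_(j <- r) F j x).
Proof.
move=> mF; elim: r => [|j r IH].
  by under eq_fun do rewrite big_nil; exact: cbmeas_cst.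
by under eq_fun do rewrite big_cons; exact: cbmeasM.
Qed.

Lemma cmeanD F G : cbmeas F -> cbmeas G ->
  cmean (fun x => F x + G x) = cmean F + cmean G.
Proof.
move=> [rF iF] [rG iG]; rewrite /cmean.
under [X in mean X +i* _]eq_fun do rewrite ReD.
under [X in _ +i* mean X]eq_fun do rewrite ImD.
by rewrite !meanD.
Qed.

Lemma cmeanZ c F : cbmeas F -> cmean (fun x => c * F x) = c * cmean F.
Proof.
move=> [rF iF]; rewrite /cmean.
under [X in mean X +i* _]eq_fun do rewrite ReM.
under [X in _ +i* mean X]eq_fun do rewrite ImM.
rewrite !meanD ?meanN ?meanZ //; try exact: bmeasZ; try exact/bmeasN/bmeasZ.
by apply/eqP; rewrite eq_complex ReM ImM /= !eqxx.
Qed.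

Lemma cmean_cst c : cmean (fun=> c) = c.
Proof. by rewrite /cmean !mean_cst; case: c. Qed.

Lemma cmean_sum (J : Type) (r : seq J) (F : J -> T -> C) :
  (forall j, cbmeas (F j)) ->
  cmean (fun x => \sum_(j <- r) F j x) = \sum_(j <- r) cmean (F j).
Proof.
move=> mF; elim: r => [|j r IH].
  by under eq_fun do rewrite big_nil; rewrite big_nil cmean_cst.
under eq_fun do rewrite big_cons.
by rewrite big_cons cmeanD ?IH //; exact: cbmeas_sum.
Qed.

End bounded_mean.

Lemma bmeas_comp (R : realType) d1 d2 (T1 : measurableType d1)
    (T2 : measurableType d2) (g : T1 -> T2) (f : T2 -> R) :
  measurable_fun setT g -> bmeas f -> bmeas (fun x => f (g x)).
Proof.
move=> mg [mf [M fM]]; split; last by exists M => x.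
exact: (measurableT_comp mf mg).
Qed.

Lemma cbmeas_comp (R : realType) d1 d2 (T1 : measurableType d1)
    (T2 : measurableType d2) (g : T1 -> T2) (F : T2 -> R[i]) :
  measurable_fun setT g -> cbmeas F -> cbmeas (fun x => F (g x)).
Proof.
move=> mg [rF iF]; split.
  exact: (bmeas_comp (f := fun x => complex.Re (F x))).
exact: (bmeas_comp (f := fun x => complex.Im (F x))).
Qed.

Lemma mean_product (R : realType) d1 d2 (T1 : measurableType d1)
    (T2 : measurableType d2) (P1 : probability T1 R) (P2 : probability T2 R)
    (f : T1 -> R) (g : T2 -> R) : bmeas f -> bmeas g ->
  mean (P1 \x P2)%E (fun p => f p.1 * g p.2) = mean P1 f * mean P2 g.
Proof.
move=> mf mg.
have mfg : bmeas (fun p : T1 * T2 => f p.1 * g p.2).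
  by apply: bmeasM; apply: bmeas_comp.
apply: EFin_inj; rewrite -(meanE (P1 \x P2)%E mfg) -integral12_prod_meas1.
  rewrite (eq_integral (fun x => (mean P2 g * f x)%:E)) => [|x _].
    by rewrite meanE; [rewrite meanZ // mulrC | exact: bmeasZ].
  by rewrite /fubini_F /= (meanE P2 (bmeasZ _ mg)) meanZ // mulrC.
exact: bmeas_integrable mfg.
Qed.

Lemma cmean_product (R : realType) d1 d2 (T1 : measurableType d1)
    (T2 : measurableType d2) (P1 : probability T1 R) (P2 : probability T2 R)
    (F : T1 -> R[i]) (G : T2 -> R[i]) : cbmeas F -> cbmeas G ->
  cmean (P1 \x P2)%E (fun p => F p.1 * G p.2) = cmean P1 F * cmean P2 G.
Proof.
move=> [rF iF] [rG iG]; rewrite /cmean.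
have b (f : T1 -> R) (g : T2 -> R) : bmeas f -> bmeas g ->
    bmeas (fun p : T1 * T2 => f p.1 * g p.2).
  by move=> mf mg; apply: bmeasM; apply: bmeas_comp.
under [X in mean _ X +i* _]eq_fun do rewrite ReM.
under [X in _ +i* mean _ X]eq_fun do rewrite ImM.
have h1 := b _ _ rF rG; have h2 := b _ _ iF iG.
have h3 := b _ _ rF iG; have h4 := b _ _ iF rG.
rewrite (meanD _ h1 (bmeasN h2)) (meanD _ h3 h4) meanN //.
by rewrite (mean_product _ _ rF rG) (mean_product _ _ iF iG) (mean_product _ _ rF iG) (mean_product _ _ iF rG).
Qed.

(** * Orthogonality of characters and means of products over the torus *)

Section torus_mean.
Variable R : realType.
Local Notation C := R[i].

Definition cis (t : R) : C := cos t +i* sin t.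

Lemma cis_bmeas : cbmeas (fun t : measurableTypeR R => cis t).
Proof.
split; split.
- exact: continuous_measurable_fun (@continuous_cos R).
- by exists 1 => x; exact: cos_max.
- exact: continuous_measurable_fun (@continuous_sin R).
- by exists 1 => x; rewrite ler_norml sin_geN1 sin_le1.
Qed.

Lemma cisX (t : R) k : cis t ^+ k = cis (k%:R * t).
Proof.
elim: k => [|k IH]; first by rewrite mul0r /cis cos0 sin0.
rewrite exprS IH /cis -natr1 mulrDl mul1r addrC cosD sinD.
by apply/eqP; rewrite eq_complex ReM ImM /= addrC eqxx /=; apply/eqP; ring.
Qed.

Lemma cis_conj k m (t : R) : cis t ^+ k * conjc (cis t) ^+ m =
  cis ((k%:R - m%:R) * t).
Proof.
rewrite -rmorphXn /= !cisX mulrBl /cis cosB sinB.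
by apply/eqP; rewrite eq_complex ReM ImM /=; apply/andP; split; apply/eqP; ring.
Qed.

Lemma mean_angle_trig (a b c : R) : c != 0 ->
  cis (c * (2 * pi)) = 1 ->
  mean (angle_prob R) (fun t => a * cos (c * t) + b * sin (c * t)) = 0.
Proof.
move=> c0 [cos1 sin0].
pose f t : R := a * cos (c * t) + b * sin (c * t).
(* [integral_uniform] asks for a nonnegative integrand, so the constant [|a| + |b|] is added to [f]
   and its contribution is removed from the mean at the end. *)
pose F t : R := (a * sin (c * t) - b * cos (c * t)) / c + (`|a| + `|b|) * t.
have dF t : is_derive t (1 : R) F (f t + (`|a| + `|b|)).
  rewrite /F /f; apply: is_derive_eq => /=.
  by rewrite scaler0 add0r /GRing.scale /=; field.
have cf : continuous f.
  move=> t; apply: cvgD; apply: cvgM; try exact: cvg_cst.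
    apply: (@continuous_comp _ _ _ ( *%R c) cos); last exact: continuous_cos.
    exact: mulrl_continuous.
  apply: (@continuous_comp _ _ _ ( *%R c) sin); last exact: continuous_sin.
  exact: mulrl_continuous.
have pi2 : 0 < 2 * pi :> R by rewrite mulr_gt0 // pi_gt0.
have fM t : `|f t| <= `|a| + `|b|.
  apply: le_trans (ler_normD _ _) _.
  rewrite !normrM lerD // ler_piMr //; first exact: cos_max.
  by rewrite ler_norml sin_geN1 sin_le1.
have bf : bmeas (f : measurableTypeR R -> R).
  split; first exact: continuous_measurable_fun.
  by exists (`|a| + `|b|).
have bf' : bmeas (fun t : measurableTypeR R => f t + (`|a| + `|b|)).
  by apply: bmeasD => //; exact: bmeas_cst.
have := meanE (angle_prob R) bf'.
rewrite /angle_prob integral_uniform; last 2 first.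
- by apply/measurable_EFinP; case: bf'.
- by move=> t; rewrite lee_fin; have := fM t; rewrite ler_norml => /andP[]; lra.
rewrite (@continuous_FTC2 _ (fun t => f t + (`|a| + `|b|)) F) //.
- have -> : F (2 * pi) = F 0 + (`|a| + `|b|) * (2 * pi).
    by rewrite /F cos1 sin0 !mulr0 trigo.sin0 cos0; ring.
  rewrite -EFinB -EFinM => -[]; rewrite (meanD _ bf (bmeas_cst _ _)) mean_cst.
  set m := mean _ _ => /esym e.
  rewrite subr0 addrAC subrr add0r [RHS]mulrC mulfK ?gt_eqF // in e.
  by rewrite -[LHS](addrK (`|a| + `|b|)) e subrr.
- apply: continuous_subspaceT => t; apply: cvgD; [exact: cf|exact: cvg_cst].
- have cF t : F x @[x --> t] --> F t.
    by apply: differentiable_continuous; apply/derivable1_diffP; exact: ex_derive.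
  split; first by move=> t _; exact: ex_derive.
    exact/cvg_at_right_filter/cF.
  exact/cvg_at_left_filter/cF.
- by move=> t _; rewrite derive1E; exact: derive_val.
Qed.

Lemma cmean_angle k m : cmean (angle_prob R)
  (fun t => cis t ^+ k * conjc (cis t) ^+ m) = (k == m)%:R.
Proof.
under eq_fun do rewrite cis_conj.
have [->|km] := eqVneq k m.
  under eq_fun do rewrite subrr mul0r.
  by rewrite cmean_cst /cis cos0 sin0.
have d0 : k%:R - m%:R != 0 :> R by rewrite subr_eq0 eqr_nat.
have d1 : cis ((k%:R - m%:R) * (2 * pi)) = 1.
  rewrite -cis_conj /cis [2 * pi]mulrC mulr_natr cos2pi sin2pi -/(1 : C).
  by rewrite rmorph1 !expr1n mulr1.
rewrite /cmean /cis /=.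
have /= := mean_angle_trig 1 0 d0 d1.
under eq_fun do rewrite mul1r mul0r addr0.
move=> ->.
have /= := mean_angle_trig 0 1 d0 d1.
by under eq_fun do rewrite mul1r mul0r add0r; move=> ->.
Qed.

Lemma cmean_torus n (F : 'I_n -> measurableTypeR R -> C) :
  (forall j, cbmeas (F j)) ->
  cmean (torus_prob R n) (fun t => \prod_(j < n) F j (tnth t j)) =
  \prod_(j < n) cmean (angle_prob R) (F j).
Proof.
elim: n F => [|n IH] F mF.
  under eq_fun do rewrite big_ord0.
  by rewrite big_ord0 cmean_cst.
rewrite big_ord_recl -IH => [|j]; last exact: mF.
have mtail : cbmeas (fun t : n.-tuple (measurableTypeR R) =>
    \prod_(j < n) F (lift ord0 j) (tnth t j)).
  apply: cbmeas_prod => j.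
  by apply: (cbmeas_comp (F := F (lift ord0 j))) => //; exact: measurable_tnth.
rewrite -cmean_product //.
have mall : cbmeas (fun t : n.+1.-tuple (measurableTypeR R) =>
    \prod_(j < n.+1) F j (tnth t j)).
  apply: cbmeas_prod => j.
  by apply: (cbmeas_comp (F := F j)) => //; exact: measurable_tnth.
rewrite /=.
(* The measure on the torus is a push-forward along [tuple_cons], so its means are means over the
   product measure. *)
have E f : bmeas f ->
    mean (distribution (angle_prob R \x torus_prob R n)%E (@tuple_cons R n)) f =
    mean (angle_prob R \x torus_prob R n)%E (f \o @tuple_cons R n).
  move=> mf; have mf' : bmeas (f \o @tuple_cons R n).
    by apply: (bmeas_comp (f := f)) => //; exact: measurable_tuple_cons.
  apply: EFin_inj; rewrite -!meanE //.
  rewrite integral_distribution //; last exact: bmeas_integrable mf'.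
  by apply/measurable_EFinP; case: mf.
case: mall => mr mi; rewrite /cmean (E _ mr) (E _ mi).
have e (p : measurableTypeR R * n.-tuple (measurableTypeR R)) :
    \prod_(j < n.+1) F j (tnth (tuple_cons p) j) =
    F ord0 p.1 * \prod_(j < n) F (lift ord0 j) (tnth p.2 j).
  rewrite big_ord_recl /= tnth0; congr (_ * _).
  by apply: eq_bigr => j _; rewrite tnthS.
apply/eqP; rewrite eq_complex /=; apply/andP.
by split; apply/eqP; congr mean; apply/funext => p; rewrite /= e.
Qed.
End torus_mean.

(** * Parseval's formula on the torus *)

Section exhaustion.
Variable I : countType.

(** A sequence of finite sets that eventually contains any given one, so that a sum along the net
    becomes the limit of a sequence. *)
Definition exhaust (N : nat) : {fset I} :=
  [fset x in pmap choice.unpickle (iota 0 N)]%fset.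

Lemma exhaustP (B : {fset I}) : \forall N \near \oo, (B `<=` exhaust N)%fset.
Proof.
exists (\max_(x <- B) choice.pickle x).+1 => // N /= hN; apply/fsubsetP => x xB.
rewrite !inE /= mem_pmap; apply/mapP; exists (choice.pickle x); last by rewrite choice.pickleK.
rewrite mem_iota /= add0n; apply: leq_trans hN; rewrite ltnS.
exact: leq_bigmax_seq.
Qed.

End exhaustion.

Section dominated_mean.
Context (R : realType) d (T : measurableType d) (P : probability T R).

Lemma le_mean (f g : T -> R) : bmeas f -> bmeas g -> (forall x, f x <= g x) ->
  mean P f <= mean P g.
Proof.
move=> /(bmeas_integrable P) fi /(bmeas_integrable P) gi fg.
exact: (le_Rintegral measurableT fi gi (fun x _ => fg x)).
Qed.

Lemma mean_dominated (f_ : nat -> T -> R) (f : T -> R) M :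
  (forall N, measurable_fun setT (f_ N)) -> measurable_fun setT f ->
  (forall N x, `|f_ N x| <= M) -> (forall x, `|f x| <= M) ->
  {ae P, forall x, f_ N x @[N --> \oo] --> f x} ->
  mean P (f_ N) @[N --> \oo] --> mean P f.
Proof.
move=> mf_ mf fM_ fM cf.
have bf_ N : bmeas (f_ N) by split => //; exists M.
have bf : bmeas f by split => //; exists M.
have := @dominated_convergence _ _ _ P setT measurableT
  (fun N x => (f_ N x)%:E) (fun x => (f x)%:E) (fun=> M%:E).
case.
- by move=> N; apply/measurable_EFinP.
- exact/measurable_EFinP.
- by apply: filterS cf => x cx _; apply: cvg_EFin => //; exact: nearW.
- exact: bmeas_integrable (bmeas_cst _ M).
- by apply: aeW => x N _; rewrite lee_fin.
move=> _ _; rewrite (meanE P bf).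
under eq_fun do rewrite meanE //.
by move/fine_cvgP => [_].
Qed.

End dominated_mean.

Section torus_monomials.
Variables (R : realType) (n : nat).
Local Notation C := R[i].
Local Notation normc := Normc.normc.
Local Notation K := {ffun 'I_n -> nat}.
Implicit Types (k : K) (z : 'rV[C]_n).

Definition mono k z : C := \prod_(j < n) z ord0 j ^+ k j.
(** For r >= 0, the modulus of [mono k] on the torus of radius r, that is r to the total degree of
    k; a product, to match [mono] factor by factor. *)
Definition rmono k (r : R) : R := \prod_(j < n) r ^+ k j.

Lemma rmono_ge0 k (r : R) : 0 <= r -> 0 <= rmono k r.
Proof. by move=> r0; apply: prodr_ge0 => j _; exact: exprn_ge0. Qed.

Lemma rmono_gt0 k (r : R) : 0 < r -> 0 < rmono k r.
Proof. by move=> r0; apply: prodr_gt0 => j _; exact: exprn_gt0. Qed.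

Lemma normcX (x : C) m : normc (x ^+ m) = normc x ^+ m.
Proof.
elim: m => [|m IH]; first by rewrite !expr0 Normc.normc1.
by rewrite !exprS Normc.normcM IH.
Qed.

Lemma normc_prod (J : Type) (r : seq J) (F : J -> C) :
  normc (\prod_(j <- r) F j) = \prod_(j <- r) normc (F j).
Proof.
elim: r => [|j r IH]; first by rewrite !big_nil Normc.normc1.
by rewrite !big_cons Normc.normcM IH.
Qed.

Lemma normc_mono k z : normc (mono k z) = \prod_(j < n) normc (z ord0 j) ^+ k j.
Proof. by rewrite normc_prod; under eq_bigr do rewrite normcX. Qed.

Lemma torus_ptE r (t : n.-tuple (measurableTypeR R)) j :
  torus_pt r t ord0 j = r%:C * cis (tnth t j) :> C.
Proof.
rewrite mxE; apply/eqP; rewrite eq_complex /= !mul0r subr0 addr0.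
by rewrite !eqxx.
Qed.

Lemma normc_cis (t : R) : normc (cis t) = 1.
Proof. by rewrite /= cos2Dsin2 sqrtr1. Qed.

Lemma normc_real (r : R) : normc r%:C = `|r|.
Proof. by rewrite /= expr0n addr0 sqrtr_sqr. Qed.

Lemma normc_torus_pt (r : R) (t : n.-tuple (measurableTypeR R)) j :
  0 <= r -> normc (torus_pt r t ord0 j) = r.
Proof.
by move=> r0; rewrite torus_ptE Normc.normcM normc_cis mulr1 normc_real ger0_norm.
Qed.

Lemma mono_torus_pt k r (t : n.-tuple (measurableTypeR R)) :
  mono k (torus_pt r t) = (rmono k r)%:C * \prod_(j < n) cis (tnth t j) ^+ k j.
Proof.
rewrite /mono /rmono (rmorph_prod (real_complex R)) -big_split /=.
by apply: eq_bigr => j _; rewrite torus_ptE exprMn -rmorphXn.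
Qed.

Lemma cbmeas_mono k r : cbmeas (fun t : n.-tuple (measurableTypeR R) => mono k (torus_pt r t)).
Proof.
rewrite (_ : (fun t => _) = (fun t : n.-tuple (measurableTypeR R) => (rmono k r)%:C * \prod_(j < n) cis (tnth t j) ^+ k j)).
  apply: cbmeasM; first exact: cbmeas_cst.
  apply: cbmeas_prod => j; apply: cbmeasX.
  apply: (cbmeas_comp (F := fun x : measurableTypeR R => cis x)).
    exact: measurable_tnth.
  exact: cis_bmeas.
by apply/funext => t; rewrite mono_torus_pt.
Qed.

Lemma conjc_realE (x : R) : conjc x%:C = x%:C.
Proof. by apply/eqP; rewrite eq_complex /= oppr0 !eqxx. Qed.

Lemma cmean_mono k m r : cmean (torus_prob R n)
    (fun t => mono k (torus_pt r t) * conjc (mono m (torus_pt r t))) =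
  if k == m then (rmono k r ^+ 2)%:C else 0.
Proof.
pose F j (x : measurableTypeR R) := cis x ^+ k j * conjc (cis x) ^+ m j.
have mF j : cbmeas (F j).
  apply: cbmeasM; apply: cbmeasX; first exact: cis_bmeas.
  by apply: cbmeas_conj; exact: cis_bmeas.
have -> : (fun t => mono k (torus_pt r t) * conjc (mono m (torus_pt r t))) =
    (fun t => (rmono k r * rmono m r)%:C * \prod_(j < n) F j (tnth t j)).
  apply/funext => t; rewrite !mono_torus_pt.
  have -> (x : R) (y : C) : conjc (x%:C * y) = x%:C * conjc y.
    by rewrite rmorphM; congr (_ * _); exact: conjc_realE.
  rewrite (rmorph_prod (@conjc R)) mulrACA -big_split /=.
  rewrite [(_ * rmono m r)%:C]rmorphM; congr (_ * _).
  by apply: eq_bigr => j _; rewrite /F rmorphXn.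
rewrite cmeanZ; last first.
  by apply: cbmeas_prod => j; apply: (cbmeas_comp (F := F j)) => //; exact: measurable_tnth.
rewrite cmean_torus //; under eq_bigr do rewrite cmean_angle.
case: eqVneq => [<-|km].
  by rewrite big1 ?mulr1 // => j _; rewrite eqxx.
have /existsP[j kmj] : [exists j, k j != m j].
  rewrite -negb_forall; apply: contra km => /forallP h.
  by apply/eqP/ffunP => j; apply/eqP.
by rewrite (bigD1 j) //= (negPf kmj) mul0r mulr0.
Qed.

Lemma normc_sqr (x : C) : (normc x ^+ 2)%:C = x * conjc x.
Proof.
case: x => a b; apply/eqP; rewrite eq_complex /= sqr_sqrtr ?addr_ge0 ?sqr_ge0 //.
by apply/andP; split; apply/eqP; ring.
Qed.

Lemma Re_sum (J : Type) (r : seq J) (F : J -> C) :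
  complex.Re (\sum_(j <- r) F j) = \sum_(j <- r) complex.Re (F j).
Proof.
elim: r => [|j r IH]; first by rewrite !big_nil.
by rewrite !big_cons ReD IH.
Qed.

Lemma cbmeas_poly (A : {fset K}) (a : K -> C) r :
  cbmeas (fun t => \sum_(k <- A) a k * mono k (torus_pt r t)).
Proof.
apply: cbmeas_sum => k; apply: cbmeasM; first exact: cbmeas_cst.
exact: cbmeas_mono.
Qed.

Lemma bmeas_normc_sqr d (T : measurableType d) (F : T -> C) :
  cbmeas F -> bmeas (fun x => normc (F x) ^+ 2).
Proof.
move=> mF; have [h _] := cbmeasM mF (cbmeas_conj mF).
have -> // : (fun x => normc (F x) ^+ 2) =
  (fun x => complex.Re (F x * conjc (F x))).
by apply/funext => x; rewrite -normc_sqr.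
Qed.

Lemma mean_poly (A : {fset K}) (a : K -> C) r :
  mean (torus_prob R n)
    (fun t => normc (\sum_(k <- A) a k * mono k (torus_pt r t)) ^+ 2) =
  \sum_(k <- A) normc (a k) ^+ 2 * rmono k r ^+ 2.
Proof.
pose p t := \sum_(k <- A) a k * mono k (torus_pt r t).
have mp : cbmeas p by exact: cbmeas_poly.
transitivity (complex.Re (cmean (torus_prob R n) (fun t => p t * conjc (p t)))).
  by rewrite /cmean /=; congr mean; apply/funext => t; rewrite -normc_sqr.
have mkm k m : cbmeas (fun t => mono k (torus_pt r t) * conjc (mono m (torus_pt r t))).
  by apply: cbmeasM; [|apply: cbmeas_conj]; exact: cbmeas_mono.
have -> : (fun t => p t * conjc (p t)) = (fun t => \sum_(k <- A) \sum_(m <- A)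
    (a k * conjc (a m)) * (mono k (torus_pt r t) * conjc (mono m (torus_pt r t)))).
  apply/funext => t; rewrite /p mulr_suml; apply: eq_bigr => k _.
  rewrite rmorph_sum mulr_sumr; apply: eq_bigr => m _.
  by rewrite rmorphM mulrACA.
have mZ k m := cbmeasM (cbmeas_cst _ (a k * conjc (a m))) (mkm k m).
rewrite cmean_sum => [|k]; last by apply: cbmeas_sum => m; exact: mZ.
rewrite Re_sum; apply: eq_big_seq => k kA.
rewrite cmean_sum // (big_fsetD1 k) //= big1_fset ?addr0 => [|m].
  rewrite cmeanZ // cmean_mono eqxx -normc_sqr.
  by rewrite -rmorphM.
rewrite !inE => /andP[mk _] _; rewrite cmeanZ // cmean_mono.
by rewrite eq_sym (negPf mk) mulr0.
Qed.

Lemma sum_sqr_le (J : Type) (s : seq J) (u : J -> R) : (forall j, 0 <= u j) ->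
  \sum_(j <- s) u j ^+ 2 <= (\sum_(j <- s) u j) ^+ 2.
Proof.
move=> u0; elim: s => [|j s IH]; first by rewrite !big_nil expr0n.
rewrite !big_cons sqrrD; apply: lerD IH; rewrite lerDl.
by rewrite mulrn_wge0 // mulr_ge0 // sumr_ge0.
Qed.

Lemma normc_dist (x y : C) : `|normc x - normc y| <= normc (x - y).
Proof.
rewrite ler_norml; apply/andP; split.
  rewrite lerNl opprB lerBlDr addrC -[leRHS]addrC -[normc (x - y)]normcN.
  by apply: le_trans (le_normcD _ _); rewrite opprB subrK.
rewrite lerBlDr; apply: le_trans (le_normcD _ _).
by rewrite subrK.
Qed.

(** On the torus the partial sums are bounded by [M] and converge pointwise, so dominated
    convergence carries [mean_poly] to the limit. Measurability of [f] on the torus is also a result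
    of the pointwise limit, hence its place in the conclusion. *)
Theorem parseval_torus (a : K -> C) (f : 'rV[C]_n -> C) r M :
  0 <= r -> bsum (fun k => a k * (rmono k r)%:C) M ->
  (forall t, hasum (fun k => a k * mono k (torus_pt r t)) (f (torus_pt r t))) ->
  bmeas (fun t => normc (f (torus_pt r t)) ^+ 2) /\
  hasum (fun k => normc (a k) ^+ 2 * rmono k r ^+ 2)
    (mean (torus_prob R n) (fun t => normc (f (torus_pt r t)) ^+ 2)).
Proof.
move=> r0 aM af.
have nm k t : normc (mono k (torus_pt r t)) = rmono k r.
  by rewrite normc_mono; apply: eq_bigr => j _; rewrite normc_torus_pt.
have {}aM : forall A : {fset K}, \sum_(k <- A) normc (a k) * rmono k r <= M.
  move=> A; apply: le_trans (aM A); apply: ler_sum => k _.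
  by rewrite Normc.normcM normc_real ger0_norm ?rmono_ge0.
have M0 : 0 <= M by have := aM fset0; rewrite big_seq_fset0.
have sM t (A : {fset K}) : normc (\sum_(k <- A) a k * mono k (torus_pt r t)) <= M.
  apply: le_trans (normc_sum _ _ _) _; apply: le_trans (aM A).
  by apply: ler_sum => k _; rewrite Normc.normcM nm.
have fM t : normc (f (torus_pt r t)) <= M.
  apply: hasum_normc_le (af t) => A; apply: le_trans (aM A).
  by apply: ler_sum => k _; rewrite Normc.normcM nm.
pose p N t := normc (\sum_(k <- exhaust K N) a k * mono k (torus_pt r t)) ^+ 2.
have pf t : p N t @[N --> \oo] --> normc (f (torus_pt r t)) ^+ 2.
  have h : normc (\sum_(k <- exhaust K N) a k * mono k (torus_pt r t)) @[N --> \oo]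
      --> normc (f (torus_pt r t)).
    apply/cvgrPdist_lt => e e0.
    have e0' : (0 : C) < e%:C by rewrite ltcR.
    have := hasum_subseq (af t) (exhaustP (I := K)) e0'.
    apply: filterS => N; rewrite normC_normc ltcR; apply: le_lt_trans.
    by rewrite distrC; exact: normc_dist.
  by apply: cvgM.
have mp N : measurable_fun setT (p N).
  by have [] := bmeas_normc_sqr (cbmeas_poly (exhaust K N) a r).
have mf : measurable_fun setT (fun t => normc (f (torus_pt r t)) ^+ 2).
  by apply: (measurable_fun_cvg (h := p)) => // t _; exact: pf.
have sq x : 0 <= x <= M -> `|x ^+ 2| <= M ^+ 2.
  by move=> /andP[x0 xM]; rewrite ger0_norm ?sqr_ge0 // lerXn2r.
have bf t : `|normc (f (torus_pt r t)) ^+ 2| <= M ^+ 2.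
  by apply: sq; rewrite normc_ge0 fM.
split; first by split=> //; exists (M ^+ 2).
have cm := mean_dominated (P := torus_prob R n) mp mf
  (fun N t => sq _ (introT andP (conj (normc_ge0 _) (sM t _)))) bf
  (aeW _ pf).
have u0 k : 0 <= normc (a k) ^+ 2 * rmono k r ^+ 2.
  by rewrite mulr_ge0 ?sqr_ge0.
have [s hs] : exists s, hasum (fun k => normc (a k) ^+ 2 * rmono k r ^+ 2) s.
  apply: (hasum_bounded (M := M ^+ 2)) => // A.
  have h0 k : 0 <= normc (a k) * rmono k r by rewrite mulr_ge0 ?normc_ge0 ?rmono_ge0.
  under eq_bigr do rewrite -exprMn.
  apply: le_trans (sum_sqr_le _ h0) _.
  by rewrite lerXn2r // nnegrE sumr_ge0.
suff -> : mean (torus_prob R n) (fun t => normc (f (torus_pt r t)) ^+ 2) = s by [].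
rewrite -(cvg_lim (@Rhausdorff R) cm); apply/cvg_lim => //.
apply/cvgrPdist_lt => e e0.
have := hasum_subseq hs (exhaustP (I := K)) e0.
by apply: filterS => N; rewrite distrC /p mean_poly.
Qed.

End torus_monomials.

(** * Multivariate power series *)

Section power_series.
Variables (R : realType) (n : nat).
Local Notation C := R[i].
Local Notation normc := Normc.normc.
Local Notation K := {ffun 'I_n -> nat}.
Implicit Types (k p : K) (x z w h : 'rV[C]_n) (a b c : K -> C).
Implicit Types f : 'rV[C]_n -> C.

Definition power_series a w (e : R) f :=
  forall z, (forall j, normc (z ord0 j - w ord0 j) < e) ->
    hasum (fun k => a k * mono k (z - w)) (f z).

Definition coef_bound a (r M : R) := forall k, normc (a k) * rmono k r <= M.

(** Adjoining to [A] one index outside it moves the sum by less than 2; the indices in [A] are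
    covered by the sum of their moduli. *)
Lemma hasum_terms_bounded (I : choiceType) (u : I -> C) s :
  hasum u s -> exists M, forall i, normc (u i) <= M.
Proof.
move=> /hasum_normcP /(_ 1 ltr01)[A hA].
exists (2 + \sum_(i <- A) normc (u i)) => i.
have [iA|iA] := boolP (i \in A).
  rewrite (big_fsetD1 i) //= addrCA lerDl addr_ge0 // sumr_ge0 // => ? _.
  exact: normc_ge0.
have h1 := hA _ (fsubset_refl A); have := hA _ (fsubsetUr [fset i]%fset A).
rewrite big_fsetU1 //=; set S := \sum_(j <- A) _ in h1 * => h2.
have -> : u i = (u i + S - s) - (S - s) by ring.
apply: le_trans (le_normcD _ _) _; rewrite normcN.
have : 0 <= \sum_(j <- A) normc (u j) by apply: sumr_ge0 => ? _; exact: normc_ge0.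
by lra.
Qed.

(** At the point w + (r, ..., r) every monomial has modulus exactly [rmono k r], and the terms of a
    convergent family are bounded. *)
Lemma power_series_bound a w e f r : power_series a w e f -> 0 <= r < e ->
  exists M, coef_bound a r M.
Proof.
move=> af /andP[r0 re].
have /hasum_terms_bounded[M hM] : hasum (fun k => a k * mono k ((w + const_mx r%:C) - w)) (f (w + const_mx r%:C)).
  by apply: af => j; rewrite !mxE addrAC subrr add0r normc_real ger0_norm.
exists M => k; apply: le_trans (hM k); rewrite Normc.normcM normc_mono.
rewrite le_eqVlt; apply/orP; left; apply/eqP; congr (_ * _).
by apply: eq_bigr => j _; rewrite !mxE addrAC subrr add0r normc_real ger0_norm.
Qed.

Lemma le_rmono k (r s : R) : 0 <= r -> r <= s -> rmono k r <= rmono k s.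
Proof.
move=> r0 rs; apply: ler_prod => j _; rewrite exprn_ge0 //=.
by apply: lerXn2r => //; rewrite nnegrE // (le_trans r0).
Qed.

Lemma rmonoM k (r s : R) : rmono k (r * s) = rmono k r * rmono k s.
Proof. by rewrite /rmono -big_split; apply: eq_bigr => j _; rewrite exprMn. Qed.

Lemma le_normc_mono k z (r : R) : (forall j, normc (z ord0 j) <= r) ->
  normc (mono k z) <= rmono k r.
Proof.
move=> zr; rewrite normc_mono; apply: ler_prod => j _.
rewrite exprn_ge0 ?normc_ge0 //= lerXn2r ?nnegrE ?normc_ge0 //.
exact: le_trans (normc_ge0 _) (zr j).
Qed.

Lemma le_sum_image (I : choiceType) (T : finType) (g : T -> I) (F : I -> R)
    (A : {fset I}) : injective g -> (forall i, 0 <= F i) ->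
  (forall i, i \in A -> exists t, g t = i) ->
  \sum_(i <- A) F i <= \sum_t F (g t).
Proof.
move=> gI F0 hA.
apply: le_trans (le_sum_fset (B := [fset g t | t in T]%fset) F0 _) _.
  by apply/fsubsetP => i /hA[t <-]; apply/imfsetP; exists t.
rewrite big_imfset /=; last by move=> ? ? _ _; exact: gI.
by rewrite big_enum.
Qed.

(** Multi-indices below [N] in every coordinate as a finite type, on which a sum of products
    factorizes ([sum_box]). *)
Definition box_index N (t : {ffun 'I_n -> 'I_N}) : K := [ffun j => nat_of_ord (t j)].

Lemma box_index_inj N : injective (@box_index N).
Proof.
move=> s t /ffunP st; apply/ffunP => j; apply: val_inj.
by have := st j; rewrite !ffunE.
Qed.

Lemma box_indexP N k : (forall j, (k j < N)%N) -> exists t, @box_index N t = k.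
Proof.
move=> kN; exists [ffun j => Ordinal (kN j)].
by apply/ffunP => j; rewrite !ffunE.
Qed.

Lemma sum_box (S : comPzSemiRingType) N (F : 'I_n -> nat -> S) :
  \sum_(t : {ffun 'I_n -> 'I_N}) \prod_j F j (box_index t j) =
  \prod_j \sum_(i < N) F j i.
Proof.
rewrite bigA_distr_bigA /=; apply: eq_bigr => t _.
by apply: eq_bigr => j _; rewrite ffunE.
Qed.

Lemma fset_box (A : {fset K}) k0 :
  exists N, (forall k, k \in A -> forall j, (k j < N)%N) /\ forall j, (k0 j < N)%N.
Proof.
exists (\max_(k <- (k0 |` A)%fset) \max_(j < n) k j).+1; split=> [k kA|] j.
  rewrite ltnS; apply: (leq_trans (leq_bigmax j)).
  apply: (leq_bigmax_seq (F := fun k : K => \max_(j < n) k j)) => //.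
  by rewrite !inE kA orbT.
rewrite ltnS; apply: (leq_trans (leq_bigmax j)).
apply: (leq_bigmax_seq (F := fun k : K => \max_(j < n) k j)) => //.
by rewrite !inE eqxx.
Qed.

Lemma sum_rmono (A : {fset K}) (q : R) : 0 <= q < 1 ->
  \sum_(k <- A) rmono k q <= ((1 - q)^-1) ^+ n.
Proof.
move=> /andP[q0 q1]; have [N [hN _]] := fset_box A [ffun=> 0%N].
apply: le_trans (le_sum_image (@box_index_inj N) _ _) _.
- by move=> k; exact: rmono_ge0.
- by move=> k /hN; exact: box_indexP.
rewrite (sum_box N (fun j i => q ^+ i)) prodr_const card_ord.
have h : \sum_(i < N) q ^+ i <= (1 - q)^-1.
  rewrite -[leRHS]mul1r ler_pdivlMr ?subr_gt0 // mulrC.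
  by rewrite -opprB mulNr -subrX1 opprB lerBlDr lerDl exprn_ge0.
rewrite lerXn2r // nnegrE; first by apply: sumr_ge0 => i _; exact: exprn_ge0.
by rewrite invr_ge0 subr_ge0 ltW.
Qed.

(** The sum of [rmono k q] over all multi-indices, for 0 <= q < 1. *)
Definition geo (q : R) : R := ((1 - q)^-1) ^+ n.

(** Abel's lemma: the terms at radius [t] are dominated by a geometric family of ratio [t / r]. *)
Lemma coef_bound_bsum a r M t : coef_bound a r M -> 0 < r -> 0 <= t < r ->
  bsum (fun k => a k * (rmono k t)%:C) (M * geo (t / r)).
Proof.
move=> aM r0 /andP[t0 tr] A.
have M0 : 0 <= M.
  by apply: le_trans (aM [ffun=> 0%N]); rewrite mulr_ge0 ?normc_ge0 ?rmono_ge0 ?(ltW r0).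
have tq : 0 <= t / r < 1 by rewrite divr_ge0 ?(ltW r0) //= ltr_pdivrMr // mul1r.
apply: (@le_trans _ _ (\sum_(k <- A) M * rmono k (t / r))).
  apply: ler_sum => k _; rewrite Normc.normcM normc_real ger0_norm ?rmono_ge0 //.
  rewrite -[in leLHS](divfK (lt0r_neq0 r0) t) rmonoM [_ * rmono k r]mulrC mulrA.
  by rewrite ler_wpM2r // rmono_ge0 //; case/andP: tq.
by rewrite -mulr_sumr ler_wpM2l // sum_rmono.
Qed.

Lemma coef_bound_bsum_mono a r M t z : coef_bound a r M -> 0 < r -> 0 <= t < r ->
  (forall j, normc (z ord0 j) <= t) ->
  bsum (fun k => a k * mono k z) (M * geo (t / r)).
Proof.
move=> aM r0 tr zt; apply: le_bsum (coef_bound_bsum aM r0 tr) => k.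
have t0 : 0 <= t by case/andP: tr.
rewrite !Normc.normcM ler_wpM2l ?normc_ge0 // normc_real ger0_norm ?rmono_ge0 //.
exact: le_normc_mono.
Qed.

(** The coefficient of h^p in (x + h)^k. Truncated subtraction is harmless, since the binomial
    coefficient vanishes when p j > k j for some j. *)
Definition binomial_term k p x : C :=
  \prod_(j < n) (x ord0 j ^+ (k j - p j) *+ 'C(k j, p j)).

(** The binomial formula over a range that may exceed [m]: [sum_box] needs one common range for all
    coordinates. *)
Lemma exprD_ord_widen (S : comPzRingType) (x y : S) m N : (m < N)%N ->
  \sum_(i < N) (x ^+ (m - i) *+ 'C(m, i)) * y ^+ i = (x + y) ^+ m.
Proof.
move=> mN; rewrite exprDn (big_ord_widen _ (fun i => (x ^+ (m - i) * y ^+ i) *+ 'C(m, i)) mN).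
rewrite [RHS]big_mkcond; apply: eq_bigr => i _; rewrite mulrnAl.
case: ifP => //; rewrite ltnS => /negbT; rewrite -ltnNge => mi.
by rewrite bin_small.
Qed.

Lemma hasum_binomial_term k x h :
  hasum (fun p => binomial_term k p x * mono p h) (mono k (x + h)).
Proof.
have [N [_ kN]] := fset_box fset0 k.
have -> : mono k (x + h) = \sum_(t : {ffun 'I_n -> 'I_N})
   binomial_term k (box_index t) x * mono (box_index t) h.
  under eq_bigr do rewrite -big_split /=.
  rewrite (sum_box N (fun j i => (x ord0 j ^+ (k j - i) *+ 'C(k j, i)) * h ord0 j ^+ i)).
  by apply: eq_bigr => j _; rewrite mxE exprD_ord_widen.
apply: hasum_finite => [|p hp]; first by move=> ? ? _ _; exact: box_index_inj.
have [j pj] : exists j, (N <= p j)%N.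
  apply: contrapT => /forallNP h'.
  have /box_indexP[t tp] : forall j, (p j < N)%N.
    by move=> j; rewrite ltnNge; apply/negP.
  by have := hp t isT; rewrite tp eqxx.
rewrite /binomial_term (bigD1 j) //= bin_small ?mulr0n ?mul0r //.
exact: leq_trans (kN j) pj.
Qed.

Lemma bsum_binomial_term k x (d t : R) : 0 <= t -> (forall j, normc (x ord0 j) <= d) ->
  bsum (fun p => binomial_term k p x * (rmono p t)%:C) (rmono k (d + t)).
Proof.
move=> t0 xd A; have [N [hA kN]] := fset_box A k.
apply: le_trans (le_sum_image (@box_index_inj N) _ _) _.
- by move=> p; exact: normc_ge0.
- by move=> p /hA; exact: box_indexP.
have e (s : {ffun 'I_n -> 'I_N}) : normc (binomial_term k (box_index s) x * (rmono (box_index s) t)%:C) =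
    \prod_j ((normc (x ord0 j) ^+ (k j - box_index s j) *+ 'C(k j, box_index s j)) * t ^+ box_index s j).
  rewrite Normc.normcM normc_real ger0_norm ?rmono_ge0 // normc_prod.
  rewrite -big_split; apply: eq_bigr => j _ /=; congr (_ * _).
  by rewrite normcMn normcX.
under eq_bigr do rewrite e.
rewrite (sum_box N (fun j i => (normc (x ord0 j) ^+ (k j - i) *+ 'C(k j, i)) * t ^+ i)).
apply: ler_prod => j _; rewrite exprD_ord_widen // exprn_ge0 ?addr_ge0 ?normc_ge0 //=.
have d0 : 0 <= d by exact: le_trans (normc_ge0 _) (xd j).
by rewrite lerXn2r ?nnegrE ?addr_ge0 ?normc_ge0 // lerD2r.
Qed.

(* The coefficient at [p] of the expansion, in powers of [h], of the series
   with coefficients [a] at the point [x + h]. *)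
Definition reexpand a x p : C := tsum (fun k => a k * binomial_term k p x).

Section reexpand.
Variables (a : K -> C) (r M d : R) (x : 'rV[C]_n).
Hypotheses (aM : coef_bound a r M) (d0 : 0 <= d) (dr : d < r)
  (xd : forall j, normc (x ord0 j) <= d).

Let r0 : 0 < r. Proof. exact: le_lt_trans dr. Qed.

(** Summing over [p] first rebuilds [rmono k (d + t)] by the binomial formula; the sum over [k] then
    converges because d + t < r. *)
Lemma bsum_reexpand_pair (t : R) : 0 <= t -> d + t < r ->
  bsum (fun q : K * K => a q.1 * binomial_term q.1 q.2 x * (rmono q.2 t)%:C)
    (M * geo ((d + t) / r)).
Proof.
move=> t0 dtr; apply: (bsum_pair (V := fun k => normc (a k) * rmono k (d + t))).
  move=> k A; apply: (@le_trans _ _ (\sum_(p <- A) normc (a k) * normc (binomial_term k p x * (rmono p t)%:C))).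
    by apply: ler_sum => p _; rewrite -mulrA Normc.normcM.
  by rewrite -mulr_sumr ler_wpM2l ?normc_ge0 // bsum_binomial_term.
have dt : 0 <= d + t < r by rewrite addr_ge0.
move=> A; apply: le_trans (coef_bound_bsum aM r0 dt A).
apply: ler_sum => k _; rewrite Normc.normcM normc_real ger0_norm //.
by case/andP: dt => ? _; exact: rmono_ge0.
Qed.

Lemma bsum_reexpand p (t : R) : 0 < t -> d + t < r ->
  bsum (fun k => a k * binomial_term k p x) (M * geo ((d + t) / r) / rmono p t).
Proof.
move=> t0 dtr A; rewrite ler_pdivlMr ?rmono_gt0 //.
have := bsum_reexpand_pair (ltW t0) dtr [fset (k, p) | k in A]%fset.
rewrite big_imfset /=; last by move=> ? ? _ _ [].
rewrite mulr_suml; apply: le_trans; apply: ler_sum => k _.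
by rewrite [leRHS]Normc.normcM normc_real ger0_norm // ltW // rmono_gt0.
Qed.

Lemma hasum_reexpand p : hasum (fun k => a k * binomial_term k p x) (reexpand a x p).
Proof.
have t0 : 0 < (r - d) / 2 by rewrite divr_gt0 // subr_gt0.
by apply: tsumP (bsum_reexpand p t0 _); lra.
Qed.

Lemma coef_bound_reexpand (t : R) : 0 < t -> d + t < r ->
  coef_bound (reexpand a x) t (M * geo ((d + t) / r)).
Proof.
move=> t0 dtr p; rewrite -ler_pdivlMr ?rmono_gt0 //.
exact: hasum_normc_le (bsum_reexpand p t0 dtr) (hasum_reexpand p).
Qed.

Lemma hasum_reexpand_shift h s : (forall j, normc (h ord0 j) < r - d) ->
  hasum (fun k => a k * mono k (x + h)) s ->
  hasum (fun p => reexpand a x p * mono p h) s.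
Proof.
(* The largest of finitely many coordinates is still below [r - d], which leaves a single radius [t]
   with [d + t < r]. *)
move=> hr; pose t := \big[Num.max/0]_(j < n) normc (h ord0 j).
have t0 : 0 <= t by exact: bigmax_ge_id.
have ht j : normc (h ord0 j) <= t by exact: le_bigmax.
have tr : d + t < r.
  rewrite addrC -ltrBrDr; apply: bigmax_lt => // .
  by rewrite subr_gt0.
apply: (hasum_pair (u := fun q : K * K => a q.1 * binomial_term q.1 q.2 x * mono q.2 h)).
- apply: le_bsum (bsum_reexpand_pair t0 tr) => q.
  rewrite !Normc.normcM ler_wpM2l ?mulr_ge0 ?normc_ge0 //.
  by rewrite normc_real ger0_norm ?rmono_ge0 // le_normc_mono.
- move=> k /=; apply: eq_hasum (hasumZ (a k) (hasum_binomial_term k x h)) => p.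
  by rewrite mulrA.
- move=> p /=; rewrite mulrC; apply: eq_hasum (hasumZ (mono p h) (hasum_reexpand p)) => k.
  by rewrite mulrC.
Qed.

End reexpand.

Lemma power_series_reexpand a w (r M d : R) f x : coef_bound a r M ->
  power_series a w r f -> 0 <= d < r ->
  (forall j, normc (x ord0 j - w ord0 j) <= d) ->
  power_series (reexpand a (x - w)) x (r - d) f.
Proof.
move=> aM af /andP[d0 dr] xd z zx.
have xd' j : normc ((x - w) ord0 j) <= d by rewrite !mxE.
apply: (hasum_reexpand_shift aM d0 dr xd') => [j|]; first by rewrite !mxE.
have -> : x - w + (z - x) = z - w by rewrite addrC addrA subrK.
apply: af => j; have -> : z ord0 j - w ord0 j = (z ord0 j - x ord0 j) + (x ord0 j - w ord0 j).
  by rewrite addrA subrK.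
apply: le_lt_trans (le_normcD _ _) _.
by have := zx j; have := xd j; lra.
Qed.

Lemma power_series_le a w (r s : R) f : s <= r ->
  power_series a w r f -> power_series a w s f.
Proof. by move=> sr af z zs; apply: af => j; exact: lt_le_trans (zs j) sr. Qed.

Lemma coef_bound_le a (r s M : R) : 0 <= s <= r -> coef_bound a r M -> coef_bound a s M.
Proof.
move=> /andP[s0 sr] aM k; apply: le_trans (aM k).
by rewrite ler_wpM2l ?normc_ge0 // le_rmono.
Qed.

(** A single term of Parseval's sum is at most the mean of |f|^2, hence at most B^2. *)
Lemma cauchy_estimate a (r M B : R) f : 0 <= r -> 0 <= B ->
  bsum (fun k => a k * (rmono k r)%:C) M ->
  (forall t, hasum (fun k => a k * mono k (torus_pt r t)) (f (torus_pt r t))) ->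
  (forall t, normc (f (torus_pt r t)) <= B) ->
  coef_bound a r B.
Proof.
move=> r0 B0 aM af fB k.
have [[mf _] hs] := parseval_torus r0 aM af.
have u0 m : 0 <= normc (a m) ^+ 2 * rmono m r ^+ 2 by rewrite mulr_ge0 ?sqr_ge0.
have := hasum_ge u0 hs [fset k]%fset; rewrite big_seq_fset1 -exprMn => h.
have c0 : 0 <= normc (a k) * rmono k r by rewrite mulr_ge0 ?normc_ge0 ?rmono_ge0.
rewrite -(@ler_pXn2r _ 2) ?nnegrE //; apply: (le_trans h).
rewrite -[leRHS](mean_cst (torus_prob R n)); apply: le_mean.
- split=> //; exists (B ^+ 2) => t.
  by rewrite ger0_norm ?sqr_ge0 // lerXn2r ?nnegrE ?normc_ge0.
- exact: bmeas_cst.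
- by move=> t; rewrite lerXn2r ?nnegrE ?normc_ge0.
Qed.

(** The difference of the two series represents 0 on a small torus around [w], where Cauchy's
    estimate with bound 0 kills every coefficient. *)
Lemma power_series_unique a b w (e e' : R) f g : 0 < e -> 0 < e' ->
  (forall z, (forall j, normc (z ord0 j - w ord0 j) < e) ->
             (forall j, normc (z ord0 j - w ord0 j) < e') -> f z = g z) ->
  power_series a w e f -> power_series b w e' g -> a = b.
Proof.
move=> e0 e0' fg af bg; pose m := Num.min e e'.
have m0 : 0 < m by rewrite lt_min e0.
have me : m <= e by rewrite ge_min lexx.
have me' : m <= e' by rewrite ge_min lexx orbT.
(* Convergence below [m] bounds the coefficients at radius [m / 2]; this gives absolute convergence
   at [m / 4], where Cauchy's estimate is applied. *)
have m2 : 0 <= m / 2 < m by rewrite divr_ge0 ?(ltW m0) //= ltr_pdivrMr // mulr_natr mulr2n ltrDl.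
have [M aM] := power_series_bound (power_series_le me af) m2.
have [N bN] := power_series_bound (power_series_le me' bg) m2.
have cM : coef_bound (fun k => a k + - 1 * b k) (m / 2) (M + N).
  move=> k; apply: le_trans (_ : _ <= (normc (a k) + normc (b k)) * rmono k (m / 2)) _.
    rewrite ler_wpM2r ?rmono_ge0 //; first by case/andP: m2.
    by rewrite mulN1r -[normc (b k)]normcN le_normcD.
  by rewrite mulrDl lerD.
have m4 : 0 <= m / 4 < m / 2 by apply/andP; split; lra.
have m20 : 0 < m / 2 by rewrite divr_gt0.
have cS := coef_bound_bsum cM m20 m4.
have m40 : 0 <= m / 4 by case/andP: m4.
have cb : coef_bound (fun k => a k + - 1 * b k) (m / 4) 0.
  apply: (@cauchy_estimate _ _ _ _ (fun=> 0)) cS _ _ => // t; last by rewrite Normc.normc0.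
  pose z := w + torus_pt (m / 4) t.
  have zw : z - w = torus_pt (m / 4) t by rewrite /z addrAC subrr add0r.
  have zj j : normc (z ord0 j - w ord0 j) < m.
    have -> : z ord0 j - w ord0 j = torus_pt (m / 4) t ord0 j by rewrite -zw !mxE.
    by rewrite normc_torus_pt //; lra.
  have h1 := af z (fun j => lt_le_trans (zj j) me).
  have h2 := bg z (fun j => lt_le_trans (zj j) me').
  have -> : 0 = f z + - 1 * g z.
    rewrite -(fg z) ?mulN1r ?subrr // => j; exact: lt_le_trans (zj j) _.
  rewrite zw in h1 h2.
  apply: eq_hasum (hasumD h1 (hasumZ (-1) h2)) => k /=.
  by rewrite mulrDl mulrA.
have m41 : 0 < m / 4 by lra.
apply/funext => k; have := cb k; rewrite pmulr_lle0 ?rmono_gt0 //.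
move=> h; have : normc (a k + -1 * b k) = 0 by apply/eqP; rewrite eq_le h normc_ge0.
by move/Normc.eq0_normc/eqP; rewrite mulN1r subr_eq0 => /eqP.
Qed.

End power_series.

(** * Taylor expansion on the whole polydisc *)

Section taylor_expansion.
Variables (R : realType) (n : nat).
Local Notation C := R[i].
Local Notation normc := Normc.normc.
Local Notation K := {ffun 'I_n -> nat}.
Implicit Types (k p m : K) (x z w h : 'rV[C]_n) (a b c : K -> C).
Implicit Types f : 'rV[C]_n -> C.

Lemma bsum_inj (I J : choiceType) (g : J -> I) (u : I -> C) M :
  injective g -> bsum u M -> bsum (u \o g) M.
Proof.
move=> gI uM A; apply: le_trans (uM [fset g j | j in A]%fset).
by rewrite big_imfset //= => ? ? _ _; exact: gI.
Qed.

Definition addk m p : K := [ffun j => (m j + p j)%N].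
Definition subk k p : K := [ffun j => (k j - p j)%N].

Lemma addkK p : cancel (addk^~ p) (subk^~ p).
Proof. by move=> m; apply/ffunP => j; rewrite !ffunE addnK. Qed.

Lemma subkK k p : (forall j, p j <= k j)%N -> addk (subk k p) p = k.
Proof. by move=> pk; apply/ffunP => j; rewrite !ffunE subnK. Qed.

Definition multibinom k p : nat := \prod_(j < n) 'C(k j, p j).

Lemma multibinom_small k p : ~ (forall j, p j <= k j)%N -> multibinom k p = 0%N.
Proof.
move=> /existsNP[j /negP]; rewrite -ltnNge => kp.
by rewrite /multibinom (bigD1 j) //= bin_small ?mul0n.
Qed.

Lemma binomial_termE k p x :
  binomial_term k p x = (multibinom k p)%:R * mono (subk k p) x.
Proof.
rewrite /multibinom natr_prod /mono -big_split; apply: eq_bigr => j _ /=.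
by rewrite ffunE mulr_natl.
Qed.

Lemma hasum_shift (u : K -> C) p s :
  (forall k, ~ (forall j, p j <= k j)%N -> u k = 0) ->
  hasum u s -> hasum (fun m => u (addk m p)) s.
Proof.
move=> u0; apply: (hasum_fiber (h := subk^~ p)) => m.
apply: eq_hasum (hasum1 (addk m p) (u (addk m p))) => k.
case: eqVneq => [->|kmp]; first by rewrite addkK eqxx.
case: eqVneq => // kpm; rewrite u0 // => pk.
by case/eqP: kmp; rewrite -kpm subkK.
Qed.

Lemma rmonoD k (r s : R) N : (forall j, k j < N)%N ->
  rmono k (r + s) = \sum_(t : {ffun 'I_n -> 'I_N})
    (multibinom k (box_index t))%:R * rmono (subk k (box_index t)) r * rmono (box_index t) s.
Proof.
move=> kN.
transitivity (\prod_(j < n) \sum_(i < N) ((r ^+ (k j - i) *+ 'C(k j, i)) * s ^+ i)).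
  by apply: eq_bigr => j _; rewrite exprD_ord_widen.
rewrite -(sum_box N (fun j i => (r ^+ (k j - i) *+ 'C(k j, i)) * s ^+ i)).
apply: eq_bigr => t _; rewrite /multibinom natr_prod /rmono -!big_split.
by apply: eq_bigr => j _ /=; rewrite [subk _ _ _]ffunE -mulr_natl.
Qed.

Lemma normc_nat (N : nat) : normc (N%:R : C) = N%:R.
Proof. by rewrite normcMn Normc.normc1. Qed.

Lemma rv0E j : (0 : 'rV[C]_n) ord0 j = 0.
Proof. by rewrite mxE. Qed.

Lemma cauchy_estimate_reexpand a (r M rho B : R) p : coef_bound a r M ->
  0 < rho -> rho < r -> 0 <= B ->
  (forall t : n.-tuple (measurableTypeR R), normc (reexpand a (torus_pt rho t) p) <= B) ->
  coef_bound (fun m => a (addk m p) * (multibinom (addk m p) p)%:R) rho B.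
Proof.
move=> aM rho0 rr B0 hB.
have d t : forall j, normc (torus_pt rho (t : n.-tuple (measurableTypeR R)) ord0 j) <= rho.
  by move=> j; rewrite normc_torus_pt // ltW.
have e0 : 0 < (r - rho) / 2 by rewrite divr_gt0 // subr_gt0.
have e1 : rho + (r - rho) / 2 < r by lra.
(* At this point with positive real coordinates each monomial has the modulus it has on the whole
   torus of radius [rho], so absolute convergence here gives it there. *)
pose x0 : 'rV[C]_n := const_mx rho%:C.
have x0d j : normc (x0 ord0 j) <= rho by rewrite mxE normc_real gtr0_norm.
have bs := bsum_reexpand aM (ltW rho0) rr x0d p e0 e1.
have gI : injective (addk^~ p) := can_inj (addkK p).
apply: (cauchy_estimate (f := fun x => reexpand a x p) (ltW rho0) B0 _ _ hB).
  apply: le_bsum (bsum_inj gI bs) => m /=.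
  rewrite binomial_termE addkK mulrA ![in leRHS]Normc.normcM ![in leLHS]Normc.normcM.
  rewrite normc_mono normc_real ger0_norm ?rmono_ge0 ?(ltW rho0) //.
  rewrite le_eqVlt; apply/orP; left; apply/eqP; congr (_ * _).
  by apply: eq_bigr => j _; rewrite mxE normc_real ger0_norm ?ltW.
move=> t; have h := hasum_reexpand aM (ltW rho0) rr (d t) p.
apply: eq_hasum (hasum_shift (p := p) _ h) => [m|k pk].
  by rewrite binomial_termE addkK mulrA.
by rewrite binomial_termE multibinom_small // mul0r mulr0.
Qed.

(** The binomial expansion of [rmono k (rho + eta)] splits the term at [k] into pieces indexed by
    [p], each bounded by hypothesis; they form a geometric family of ratio [eta / delta]. *)
Lemma coef_bound_grow a (rho eta delta B : R) : 0 < rho -> 0 <= B ->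
  0 <= eta < delta ->
  (forall p, coef_bound (fun m => a (addk m p) * (multibinom (addk m p) p)%:R)
               rho (B / rmono p delta)) ->
  coef_bound a (rho + eta) (B * geo n (eta / delta)).
Proof.
move=> rho0 B0 /andP[eta0 ed] h k.
have del0 : 0 < delta by exact: le_lt_trans ed.
have [N [_ kN]] := fset_box fset0 k.
rewrite (rmonoD _ _ kN) mulr_sumr.
apply: (@le_trans _ _ (\sum_(t : {ffun 'I_n -> 'I_N}) B * rmono (box_index t) (eta / delta))).
  apply: ler_sum => t _; set p := box_index t.
  have [pk|pk] := pselect (forall j, p j <= k j)%N; last first.
    rewrite multibinom_small // !mul0r mulr0 mulr_ge0 ?rmono_ge0 //.
    by rewrite divr_ge0 // ltW.
  have := h p (subk k p); rewrite subkK // Normc.normcM normc_nat => hk.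
  rewrite !mulrA; have -> : rmono p (eta / delta) = rmono p eta / rmono p delta.
    rewrite /rmono -prodf_div; apply: eq_bigr => j _.
    by rewrite expr_div_n.
  by rewrite [leRHS]mulrCA [leRHS]mulrC ler_wpM2r ?rmono_ge0.
rewrite -mulr_sumr ler_wpM2l //.
have -> : \sum_(t : {ffun 'I_n -> 'I_N}) rmono (box_index t) (eta / delta) =
   \sum_(p <- [fset box_index t | t in {: {ffun 'I_n -> 'I_N}}]%fset) rmono p (eta / delta).
  rewrite big_imfset /=; last by move=> ? ? _ _; exact: box_index_inj.
  by rewrite big_enum.
by apply: sum_rmono; rewrite divr_ge0 ?(ltW del0) //= ltr_pdivrMr // mul1r.
Qed.

Definition maxnorm z : R := \big[Num.max/0]_(j < n) normc (z ord0 j).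

Lemma maxnorm_ge0 z : 0 <= maxnorm z.
Proof. exact: bigmax_ge_id. Qed.

Lemma le_maxnorm z j : normc (z ord0 j) <= maxnorm z.
Proof. exact: le_bigmax. Qed.

Lemma maxnorm_lt z (r : R) : 0 < r -> (forall j, normc (z ord0 j) < r) -> maxnorm z < r.
Proof. by move=> r0 zr; apply: bigmax_lt. Qed.

(* The radius [s + delta / 4] is [rho + delta / 2], where [rho] is the radius of
   the torus carrying the new centres and [delta / 2] is less than the radius at
   which their coefficients are bounded. *)
Lemma power_series_grow a f (s delta B : R) : 0 < delta -> delta < s -> 0 <= B ->
  power_series a 0 s f ->
  (forall x, (forall j, normc (x ord0 j) <= s) ->
     exists c, power_series c x delta f /\ coef_bound c delta B) ->
  power_series a 0 (s + delta / 4) f.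
Proof.
move=> del0 dels B0 af hc.
(* The series at 0 is known only below [s]; its coefficients are bounded at [r], which leaves room
   around the torus of radius [rho]. *)
pose rho := s - delta / 4; pose r := s - delta / 8; pose s' := s + delta / 4.
have rho0 : 0 < rho by rewrite /rho; lra.
have rr : rho < r by rewrite /rho /r; lra.
have r0 : 0 < r by exact: lt_trans rr.
have rs : r < s by rewrite /r; lra.
have [M aM] : exists M, coef_bound a r M.
  by apply: power_series_bound af _; rewrite rs ltW.
have afr := power_series_le (ltW rs) af.
have stepA p (t : n.-tuple (measurableTypeR R)) : normc (reexpand a (torus_pt rho t) p) <= B / rmono p delta.
  set x := torus_pt rho t.
  have xn j : normc (x ord0 j) = rho by rewrite normc_torus_pt // ltW.
  have [c [cf cB]] : exists c, power_series c x delta f /\ coef_bound c delta B.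
    by apply: hc => j; rewrite xn /rho; lra.
  have /(power_series_reexpand aM afr) : 0 <= rho < r by rewrite ltW.
  move=> /(_ x) af'; have {}af' : power_series (reexpand a (x - 0)) x (r - rho) f.
    by apply: af' => j; rewrite rv0E subr0 xn.
  rewrite subr0 in af'.
  have -> : reexpand a x = c.
    by apply: (power_series_unique _ _ _ af' cf) => //; rewrite subr_gt0.
  by rewrite ler_pdivlMr ?rmono_gt0.
have stepB : coef_bound a s' (B * geo n ((delta / 2) / delta)).
  have -> : s' = rho + delta / 2 by rewrite /s' /rho; lra.
  apply: coef_bound_grow => //; first by apply/andP; split; lra.
  move=> p; apply: (cauchy_estimate_reexpand aM) => //.
  by rewrite divr_ge0 // rmono_ge0 // ltW.
set B' := B * _ in stepB.
have s'0 : 0 < s' by rewrite /s'; lra.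
pose G z := tsum (fun k => a k * mono k (z - 0)).
have aG : power_series a 0 s' G.
  move=> z zs; have zs' j : normc (z ord0 j) < s' by have := zs j; rewrite rv0E subr0.
  apply: tsumP; rewrite subr0.
  apply: (coef_bound_bsum_mono stepB s'0 (t := maxnorm z)).
    by rewrite maxnorm_ge0 maxnorm_lt.
  exact: le_maxnorm.
move=> z zs; suff <- : G z = f z by exact: aG.
(* The point [z] is pulled back radially into radius [rho], at distance less than
   [s' - rho = delta / 2], so that both the local series of [f] at [x] and the reexpansion of [G] at
   [x] reach [z]. *)
pose x := (rho / s')%:C *: z.
have q0 : 0 < rho / s' by rewrite divr_gt0.
have q1 : rho / s' < 1 by rewrite ltr_pdivrMr // mul1r /s' /rho; lra.
have zs' j : normc (z ord0 j) < s' by have := zs j; rewrite rv0E subr0.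
have xr j : normc (x ord0 j) <= rho.
  rewrite mxE Normc.normcM normc_real gtr0_norm // mulrAC ler_pdivrMr //.
  by rewrite ler_pM2l // ltW.
have zx j : normc (z ord0 j - x ord0 j) < delta / 2.
  rewrite mxE -{1}[z ord0 j]mul1r -mulrBl -rmorphB Normc.normcM normc_real.
  rewrite gtr0_norm ?subr_gt0 //.
  have -> : delta / 2 = (1 - rho / s') * s' by rewrite mulrBl divfK ?gt_eqF // mul1r /s' /rho; lra.
  by rewrite ltr_pM2l ?subr_gt0.
have [c [cf cB]] : exists c, power_series c x delta f /\ coef_bound c delta B.
  by apply: hc => j; apply: le_trans (xr j) _; rewrite /rho; lra.
have rs' : 0 <= rho < s' by rewrite ltW //= /s' /rho; lra.
have aGx : power_series (reexpand a (x - 0)) x (s' - rho) G.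
  by apply: (power_series_reexpand stepB aG rs') => j; rewrite rv0E subr0.
rewrite subr0 in aGx.
(* Within [delta / 4] of [x] one stays below radius [s], where [f] and [G] are sums of the same
   series at 0. *)
have ec : reexpand a x = c.
  have d4 : 0 < delta / 4 by lra.
  have l1 : delta / 4 <= s' - rho by rewrite /s' /rho; lra.
  have l2 : delta / 4 <= delta by lra.
  apply: (power_series_unique d4 d4 _ (power_series_le l1 aGx) (power_series_le l2 cf)).
  move=> y yx _.
  have ys j : normc (y ord0 j) < s.
    have -> : y ord0 j = (y ord0 j - x ord0 j) + x ord0 j by rewrite subrK.
    apply: le_lt_trans (le_normcD _ _) _.
    by have := yx j; have := xr j; rewrite /rho; lra.
  apply: (@hasum_unique _ _ (fun k => a k * mono k (y - 0))).
    by apply: aG => j; rewrite rv0E subr0; apply: lt_trans (ys j) _; rewrite /s'; lra.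
  by apply: af => j; rewrite rv0E subr0.
apply: (@hasum_unique _ _ (fun k => c k * mono k (z - x))).
  by rewrite -ec; apply: aGx => j; apply: lt_le_trans (zx j) _; rewrite /s' /rho; lra.
by apply: cf => j; apply: lt_trans (zx j) _; lra.
Qed.

Lemma analytic_power_series_at f w : analytic_on_polydisc f -> polydisc w ->
  exists e a, 0 < e /\ power_series a w e f.
Proof.
move=> af /af[e [a [e0 h]]]; exists e, a; split=> // z /h /hasum_partial_sum.
apply: eq_hasum => k; congr (_ * _); rewrite /mono.
by apply: eq_bigr => j _; rewrite !mxE.
Qed.

Lemma power_series_analytic f :
  (forall w, polydisc w -> exists e a, 0 < e /\ power_series a w e f) ->
  analytic_on_polydisc f.
Proof.
move=> h w /h[e [a [e0 af]]]; exists e, a; split=> // z /af us.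
apply/hasum_partial_sum; apply: eq_hasum us => k; congr (_ * _); rewrite /mono.
by apply: eq_bigr => j _; rewrite !mxE.
Qed.

(** One parameter serves as radius and as inverse of the coefficient bound, so that compactness can
    be used as a covering statement for the single filter at 0 from the right. *)
Lemma uniform_power_series f (s : R) : analytic_on_polydisc f -> s < 1 ->
  \forall delta \near (0 : R)^'+, forall x, (forall j, normc (x ord0 j) <= s) ->
    exists c, power_series c x delta f /\ coef_bound c delta delta^-1.
Proof.
move=> af s1.
(* Points are coded by their real and imaginary parts, and compactness is used for the real cube [I]
   times itself, whose image contains the closed polydisc of radius [s]. *)
pose pt (v : 'rV[R]_n * 'rV[R]_n) : 'rV[C]_n := \row_j (v.1 ord0 j +i* v.2 ord0 j).
pose I := [set v : 'rV[R]_n | forall j, `[- s, s]%classic (v ord0 j)].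
have cI : compact I by apply: (@rV_compact _ n (fun=> `[- s, s]%classic)) => j; exact: segment_compact.
have cII := compact_setX cI cI.
pose Q (delta : R) v := (forall j, normc (pt v ord0 j) <= s) ->
  exists c, power_series c (pt v) delta f /\ coef_bound c delta delta^-1.
have /compact_near_coveringP /(_ R (0 : R)^'+ Q) h := cII.
have {}h : \forall delta \near (0 : R)^'+, I `*` I `<=` Q delta.
  apply: h => v _.
  have ptB (eps : R) v' j : ball v eps v' -> normc (pt v' ord0 j - pt v ord0 j) < eps + eps.
    move=> [[_ b1] [_ b2]]; have {}b1 : `|v.1 ord0 j - v'.1 ord0 j| < eps := b1 ord0 j.
    have {}b2 : `|v.2 ord0 j - v'.2 ord0 j| < eps := b2 ord0 j.
    have -> : pt v' ord0 j - pt v ord0 j = (v'.1 ord0 j - v.1 ord0 j)%:C + 'i * (v'.2 ord0 j - v.2 ord0 j)%:C.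
      by rewrite [RHS]addrC !mxE; apply/eqP; rewrite eq_complex /=; apply/andP; split; apply/eqP; ring.
    apply: le_lt_trans (le_normcD _ _) _; rewrite Normc.normcM !normc_real.
    have -> : normc ('i : C) = 1 by rewrite /= expr0n add0r expr1n sqrtr1.
    by rewrite mul1r distrC [X in _ + X]distrC ltrD.
  have [vin|vout] := pselect (polydisc (pt v)); last first.
    (* The cube also reaches outside the unit polydisc. Around such a point [Q] is vacuous: a ball
       of radius [(1 - s) / 2] moves a coordinate by less than [1 - s], by [ptB], so its modulus
       stays above [s]. *)
    move/existsNP: vout => [j /negP]; rewrite -leNgt => vj.
    have e0 : 0 < (1 - s) / 2 by lra.
    exists (ball v ((1 - s) / 2), setT); first by split; [exact: nbhsx_ballx|exact: filterT].
    move=> [v' d] /= [bv _] /(_ j) sv; exfalso; have {}bv := ptB _ _ j bv.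
    have : normc (pt v ord0 j) <= normc (pt v' ord0 j) + normc (pt v' ord0 j - pt v ord0 j).
      rewrite -[X in _ + X]normcN; apply: le_trans (le_normcD _ _).
      by rewrite opprB addrC subrK.
    by lra.
  have [e [a [e0 ae]]] := analytic_power_series_at af vin.
  pose r := e / 2; have r0 : 0 < r by rewrite divr_gt0.
  have [M aM] : exists M, coef_bound a r M.
    by apply: power_series_bound ae _; rewrite (ltW r0) /r; lra.
  have ar : power_series a (pt v) r f by apply: power_series_le ae; rewrite /r; lra.
  pose M' := M * geo n ((r / 2 + r / 4) / r).
  (* The bound [(|M'| + 1)^-1] on [d] makes [d^-1] at least [M']; the ball of radius [r / 4] keeps
     the new centre within [r / 2]. *)
  exists (ball v (r / 4), [set d | 0 < d /\ (d <= r / 4 /\ d <= (`|M'| + 1)^-1)]).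
    split; first by apply: nbhsx_ballx; lra.
    near=> d; split; first by near: d; exact: nbhs_right_gt.
    split; near: d; apply: nbhs_right_le; first by lra.
    by rewrite invr_gt0 ltr_wpDl.
  move=> [v' d] /= [bv [d0 [dr dM]]] _; have {}bv j := ptB _ _ j bv.
  have r2 : 0 <= r / 2 < r by apply/andP; split; lra.
  have bv' j : normc (pt v' ord0 j - pt v ord0 j) <= r / 2 by have := bv j; lra.
  exists (reexpand a (pt v' - pt v)); split.
    by apply: power_series_le (power_series_reexpand aM ar r2 bv'); lra.
  have xd j : normc ((pt v' - pt v) ord0 j) <= r / 2 by rewrite !mxE; have := bv' j; rewrite !mxE.
  have r20 : 0 <= r / 2 by lra.
  have r2r : r / 2 < r by lra.
  have r40 : 0 < r / 4 by lra.
  have r24 : r / 2 + r / 4 < r by lra.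
  have cb := coef_bound_reexpand aM r20 r2r xd r40 r24.
  have dr' : 0 <= d <= r / 4 by rewrite ltW.
  move=> k; apply: le_trans (coef_bound_le dr' cb k) _; rewrite -/M'.
  have M1 : 0 < `|M'| + 1 by rewrite ltr_wpDl.
  apply: (@le_trans _ _ (`|M'| + 1)); first by have := ler_norm M'; lra.
  by rewrite -[leLHS]invrK lef_pV2 ?posrE ?invr_gt0.
apply: filterS h => delta h x xs.
pose v := (\row_j complex.Re (x ord0 j), \row_j complex.Im (x ord0 j)) : 'rV[R]_n * 'rV[R]_n.
have xv : pt v = x by apply/rowP => j; rewrite !mxE /=; case: (x ord0 j).
rewrite -xv; apply: (h v); last by rewrite xv.
split=> j /=; rewrite mxE in_itv /= -ler_norml.
  exact: le_trans (Re_le_normc _) (xs j).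
exact: le_trans (Im_le_normc _) (xs j).
Unshelve. all: by end_near. Qed.

Lemma polydisc0 : polydisc (0 : 'rV[C]_n).
Proof. by move=> j; rewrite mxE Normc.normc0. Qed.

Theorem analytic_power_series f : analytic_on_polydisc f ->
  exists a, power_series a 0 1 f.
Proof.
move=> af; have [e [a [e0 ae]]] := analytic_power_series_at af polydisc0.
exists a; pose T := [set s : R | 0 < s <= 1 /\ power_series a 0 s f].
pose m := Num.min e 1.
have m0 : 0 < m by rewrite lt_min e0 ltr01.
have Tm : T m.
  split; first by rewrite m0 ge_min lexx orbT.
  by apply: power_series_le ae; rewrite ge_min lexx.
have hT : has_sup T by split; [exists m|exists 1 => s [/andP[]]].
pose s := sup T.
have ms : m <= s by apply: sup_upper_bound.
have s0 : 0 < s by exact: lt_le_trans ms.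
have s1 : s <= 1 by apply: sup_le_ub; [exists m|move=> t [/andP[]]].
(* The supremum is attained: a point of radius below [s] is already below some radius in [T]. *)
have as_ : power_series a 0 s f.
  move=> z zs; have zs' j : normc (z ord0 j) < s by have := zs j; rewrite rv0E subr0.
  have zm := maxnorm_lt s0 zs'.
  have e1 : 0 < s - maxnorm z by rewrite subr_gt0.
  have [t [_ at_] zt] := sup_adherent e1 hT.
  apply: at_ => j; rewrite rv0E subr0; apply: le_lt_trans (le_maxnorm z j) _.
  by move: zt; rewrite -/s; lra.
move: s1; rewrite le_eqVlt => /orP[/eqP <- //|s1].
have : \forall delta \near (0 : R)^'+, False; last first.
  by move=> /(@filter_ex _ _ _) [].
near=> delta.
have d0 : 0 < delta by near: delta; exact: nbhs_right_gt.
have ds : delta < s by near: delta; exact: nbhs_right_lt.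
have d1 : delta < 1 - s by near: delta; apply: nbhs_right_lt; rewrite subr_gt0.
have hd : forall x, (forall j, normc (x ord0 j) <= s) ->
    exists c, power_series c x delta f /\ coef_bound c delta delta^-1.
  by near: delta; exact: uniform_power_series.
have d10 : 0 <= delta^-1 by rewrite invr_ge0 ltW.
have gr := power_series_grow d0 ds d10 as_ hd.
have : s + delta / 4 <= s.
  apply: sup_upper_bound => //; split=> //.
  by apply/andP; split; lra.
by lra.
Unshelve. all: by end_near. Qed.

End taylor_expansion.

(** * Coefficients of Hardy space functions *)

Section taylor.
Variables (R : realType) (n : nat).
Local Notation C := R[i].
Local Notation normc := Normc.normc.
Local Notation K := {ffun 'I_n -> nat}.
Implicit Types (k p m : K) (x z w h : 'rV[C]_n) (a b c u v : K -> C).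
Implicit Types f g : 'rV[C]_n -> C.

Definition taylor a f :=
  forall z, polydisc z -> hasum (fun k => a k * mono k z) (f z).

Lemma taylor_power_series a f : taylor a f <-> power_series a 0 1 f.
Proof.
split=> [af z zs|af z zs].
  by rewrite subr0; apply: af => j; have := zs j; rewrite rv0E subr0.
by have := af z; rewrite subr0; apply=> j; rewrite rv0E subr0.
Qed.

Lemma analytic_taylor f : analytic_on_polydisc f -> exists a, taylor a f.
Proof. by move=> /analytic_power_series[a af]; exists a; apply/taylor_power_series. Qed.

Lemma taylor_bound a f r : taylor a f -> 0 <= r < 1 -> exists M, coef_bound a r M.
Proof. by move=> /taylor_power_series af; exact: power_series_bound af. Qed.

Lemma taylor_analytic a f : taylor a f -> analytic_on_polydisc f.
Proof.
move=> af; apply: power_series_analytic => w win.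
pose t := maxnorm w; have t1 : t < 1 by exact: maxnorm_lt.
have t0 : 0 <= t by exact: maxnorm_ge0.
pose r := (1 + t) / 2.
have [M aM] : exists M, coef_bound a r M.
  by apply: taylor_bound af _; rewrite /r; apply/andP; split; lra.
have afr : power_series a 0 r f.
  by apply: power_series_le ((taylor_power_series _ _).1 af); rewrite /r; lra.
exists (r - t), (reexpand a (w - 0)); split; first by rewrite /r; lra.
apply: (power_series_reexpand aM afr) => [|j].
  by rewrite t0 /= /r; lra.
by rewrite rv0E subr0 le_maxnorm.
Qed.

Lemma taylor_unique a b f g : (forall z, polydisc z -> f z = g z) ->
  taylor a f -> taylor b g -> a = b.
Proof.
move=> fg /taylor_power_series af /taylor_power_series bg.
apply: (power_series_unique ltr01 ltr01 _ af bg) => z zs _; apply: fg => j.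
by have := zs j; rewrite rv0E subr0.
Qed.

Lemma polydisc_torus_pt (r : R) (t : n.-tuple (measurableTypeR R)) :
  0 <= r < 1 -> polydisc (torus_pt r t).
Proof. by move=> /andP[r0 r1] j; rewrite normc_torus_pt. Qed.

Lemma taylor_parseval a f r : taylor a f -> 0 <= r < 1 ->
  bmeas (fun t => normc (f (torus_pt r t)) ^+ 2) /\
  hasum (fun k => normc (a k) ^+ 2 * rmono k r ^+ 2)
    (mean (torus_prob R n) (fun t => normc (f (torus_pt r t)) ^+ 2)).
Proof.
move=> af /andP[r0 r1].
have [M aM] : exists M, coef_bound a ((1 + r) / 2) M.
  by apply: taylor_bound af _; apply/andP; split; lra.
have r2 : 0 < (1 + r) / 2 by lra.
have r3 : 0 <= r < (1 + r) / 2 by apply/andP; split; lra.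
apply: (parseval_torus r0 (coef_bound_bsum aM r2 r3)) => t.
by apply: af; apply: polydisc_torus_pt; rewrite r0.
Qed.

Definition sqsum u := exists M, forall A : {fset K}, \sum_(k <- A) normc (u k) ^+ 2 <= M.

Lemma rmonoE k (r : R) : rmono k r = r ^+ \sum_(j < n) k j.
Proof. by rewrite /rmono expr_sum. Qed.

Lemma rmono_le1 k (r : R) : 0 <= r <= 1 -> rmono k r <= 1.
Proof. by move=> /andP[r0 r1]; rewrite rmonoE exprn_ile1. Qed.

(** A finite sum is continuous in r, so a bound uniform in r < 1 persists at r = 1, where each
    [rmono] is 1. *)
Lemma sum_rmono_lim (c : K -> R) (A : {fset K}) B :
  (forall r, 0 <= r < 1 -> \sum_(k <- A) c k * rmono k r ^+ 2 <= B) ->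
  \sum_(k <- A) c k <= B.
Proof.
move=> h; pose F (r : R) : R := \sum_(k <- A) c k * rmono k r ^+ 2.
have cF : F r @[r --> (1 : R)^'-] --> F 1.
  apply: cvg_at_left_filter; rewrite /F.
  elim: (enum_fset A) => [|k s IH].
    by under eq_fun do rewrite big_nil; rewrite big_nil; exact: cvg_cst.
  under eq_fun do rewrite big_cons; rewrite big_cons; apply: cvgD IH.
  apply: cvgM; first exact: cvg_cst.
  under eq_fun do rewrite rmonoE -exprM.
  rewrite rmonoE -exprM; exact: exprn_continuous.
have -> : \sum_(k <- A) c k = F 1.
  by apply: eq_bigr => k _; rewrite rmonoE !expr1n mulr1.
rewrite -(cvg_lim (@Rhausdorff R) cF); apply: limr_le; first exact: cvgP cF.
near=> r; apply: h.
apply/andP; split; first by apply: ltW; near: r; exact: nbhs_left_gt.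
by near: r; exact: nbhs_left_lt.
Unshelve. all: by end_near. Qed.

Lemma H2_sqsum a f : taylor a f -> (h2norm f < +oo)%E -> sqsum a.
Proof.
move=> af fH; have h0 : (0 <= h2norm f)%E.
  apply: le_trans (_ : sqrte _ <= _)%E; first exact: sqrte_ge0.
  apply: ereal_sup_ubound; exists 0 => //.
  by rewrite /= in_itv /= lexx ltr01.
have hE : h2norm f = (fine (h2norm f))%:E by rewrite fineK // ge0_fin_numE.
exists (fine (h2norm f) ^+ 2) => A; apply: sum_rmono_lim => r r1.
have [mf hs] := taylor_parseval af r1.
have u0 k : 0 <= normc (a k) ^+ 2 * rmono k r ^+ 2 by rewrite mulr_ge0 ?sqr_ge0.
apply: le_trans (hasum_ge u0 hs A) _.
have := hE; set N := fine _ => {}hE.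
have N0 : 0 <= N by rewrite -lee_fin -hE.
set mm := mean _ _.
have mm0 : 0 <= mm by apply: le_trans (hasum_ge u0 hs fset0); rewrite big_seq_fset0.
have : (sqrte mm%:E <= N%:E)%E.
  rewrite -hE; apply: ereal_sup_ubound; exists r; first by rewrite /= in_itv.
  by rewrite meanE.
rewrite /= lee_fin => h; rewrite -(sqr_sqrtr mm0) lerXn2r // nnegrE.
exact: sqrtr_ge0.
Qed.

Lemma taylor_h2norm a f s : taylor a f -> hasum (fun k => normc (a k) ^+ 2) s ->
  h2norm f = (Num.sqrt s)%:E.
Proof.
move=> af hs; have u0 k : 0 <= normc (a k) ^+ 2 by exact: sqr_ge0.
have s0 : 0 <= s by apply: le_trans (hasum_ge u0 hs fset0); rewrite big_seq_fset0.
have up : (h2norm f <= (Num.sqrt s)%:E)%E.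
  apply: ub_ereal_sup => _ [r /= r1 <-]; rewrite in_itv /= in r1.
  have [mf hr] := taylor_parseval af r1.
  rewrite meanE //= lee_fin ler_wsqrtr //.
  apply: hasum_le hr _ => A; apply: le_trans (hasum_ge u0 hs A).
  apply: ler_sum => k _; rewrite ler_piMr // expr_le1 ?rmono_le1 //.
    by case/andP: r1 => -> /ltW ->.
  by apply: rmono_ge0; case/andP: r1.
apply/eqP; rewrite eq_le up /=.
have [B hB] : exists B, h2norm f = B%:E.
  have : (h2norm f \is a fin_num).
    rewrite ge0_fin_numE; first exact: le_lt_trans up (ltry _).
    apply: le_trans (_ : sqrte _ <= _)%E; first exact: sqrte_ge0.
    apply: ereal_sup_ubound; exists 0 => //.
    by rewrite /= in_itv /= lexx ltr01.
  by move=> /fineK <-; exists (fine (h2norm f)).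
rewrite hB lee_fin.
have B0 : 0 <= B.
  rewrite -lee_fin -hB; apply: le_trans (_ : sqrte _ <= _)%E; first exact: sqrte_ge0.
  apply: ereal_sup_ubound; exists 0 => //.
  by rewrite /= in_itv /= lexx ltr01.
rewrite -(ger0_norm B0) -sqrtr_sqr ler_wsqrtr //.
apply: hasum_le hs _ => A; apply: sum_rmono_lim => r r1.
have [mf hr] := taylor_parseval af r1.
have v0 k : 0 <= normc (a k) ^+ 2 * rmono k r ^+ 2 by rewrite mulr_ge0 ?sqr_ge0.
apply: le_trans (hasum_ge v0 hr A) _; set mm := mean _ _.
have mm0 : 0 <= mm by apply: le_trans (hasum_ge v0 hr fset0); rewrite big_seq_fset0.
have : (sqrte mm%:E <= B%:E)%E.
  rewrite -hB; apply: ereal_sup_ubound; exists r; first by rewrite /= in_itv.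
  by rewrite meanE.
by rewrite /= lee_fin => h; rewrite -(sqr_sqrtr mm0) lerXn2r // nnegrE sqrtr_ge0.
Qed.

Lemma sqsum_hasum u : sqsum u -> exists s, hasum (fun k => normc (u k) ^+ 2) s.
Proof. by move=> [M uM]; apply: hasum_bounded uM => k; exact: sqr_ge0. Qed.

Lemma taylor_H2 a f : taylor a f -> sqsum a -> H2 f.
Proof.
move=> af /sqsum_hasum[s hs]; split; first exact: taylor_analytic af.
by rewrite (taylor_h2norm af hs) ltry.
Qed.

(** Square summable coefficients are bounded, by x <= 1 + x^2, and bounded coefficients give
    absolute convergence at smaller radii. *)
Lemma sqsum_bsum_mono u z : sqsum u -> polydisc z ->
  exists M, bsum (fun k => u k * mono k z) M.
Proof.
move=> [M uM] zin; pose r := (1 + maxnorm z) / 2.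
have t1 : maxnorm z < 1 by exact: maxnorm_lt.
have t0 := maxnorm_ge0 z.
have r01 : 0 <= r <= 1 by rewrite /r; apply/andP; split; lra.
have r0 : 0 < r by rewrite /r; lra.
have uB : coef_bound u r (1 + M).
  move=> k; have := uM [fset k]%fset; rewrite big_seq_fset1 => h.
  have := normc_ge0 (u k) => h0.
  apply: le_trans (ler_piMr _ (rmono_le1 k r01)) _ => //.
  apply: le_trans (_ : normc (u k) <= 1 + normc (u k) ^+ 2) _; last by rewrite lerD2l.
  by have := sqr_ge0 (normc (u k) - 1); rewrite sqrrB1; have := h0; lra.
have tr : 0 <= maxnorm z < r by rewrite t0 /= /r; lra.
exists ((1 + M) * geo n (maxnorm z / r)).
exact: (coef_bound_bsum_mono uB r0 tr (le_maxnorm z)).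
Qed.

Lemma taylorD a b f g : taylor a f -> taylor b g ->
  taylor (fun k => a k + b k) (fun z => f z + g z).
Proof.
move=> af bg z zin; apply: eq_hasum (hasumD (af z zin) (bg z zin)) => k.
by rewrite mulrDl.
Qed.

Lemma taylorZ t a f : taylor a f -> taylor (fun k => t * a k) (fun z => t * f z).
Proof. by move=> af z zin; apply: eq_hasum (hasumZ t (af z zin)) => k; rewrite mulrA. Qed.

Lemma normc_sqrD_le (x y : C) :
  normc (x + y) ^+ 2 <= 2 * normc x ^+ 2 + 2 * normc y ^+ 2.
Proof.
apply: le_trans (_ : (normc x + normc y) ^+ 2 <= _).
  by rewrite lerXn2r ?nnegrE ?addr_ge0 ?normc_ge0 // le_normcD.
by have := sqr_ge0 (normc x - normc y); rewrite sqrrB sqrrD; lra.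
Qed.

Lemma sqsumD u v : sqsum u -> sqsum v -> sqsum (fun k => u k + v k).
Proof.
move=> [M uM] [N vN]; exists (2 * M + 2 * N) => A.
apply: le_trans (_ : \sum_(k <- A) (2 * normc (u k) ^+ 2 + 2 * normc (v k) ^+ 2) <= _).
  by apply: ler_sum => k _; exact: normc_sqrD_le.
by rewrite big_split -!mulr_sumr lerD // ler_wpM2l.
Qed.

Lemma sqsumZ t u : sqsum u -> sqsum (fun k => t * u k).
Proof.
move=> [M uM]; exists (normc t ^+ 2 * M) => A.
under eq_bigr do rewrite Normc.normcM exprMn.
by rewrite -mulr_sumr ler_wpM2l // sqr_ge0.
Qed.

(** The root [I] is abstract, known through its square and its conjugate only, so that [ring]
    handles it as an opaque symbol. *)
Lemma polarization_root (I x y : C) : I * I = -1 -> conjc I = - I ->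
  4%:R^-1 * \sum_(k < 4) I ^+ k * (normc (x + I ^+ k * y) ^+ 2)%:C = x * conjc y.
Proof.
move=> i2 ci.
have cX (k : nat) : conjc (x + I ^+ k * y) = conjc x + (- I) ^+ k * conjc y.
  rewrite rmorphD rmorphM rmorphXn; congr (_ + _ ^+ _ * _); exact: ci.
under eq_bigr do rewrite normc_sqr cX.
rewrite !big_ord_recl big_ord0 /= /bump /= !addn0 !add1n !exprS !expr0 !mulr1.
set X := conjc x; set Y := conjc y.
have -> : I * (I * I) = - I by rewrite i2 mulrN1.
have -> : - I * (- I * - I) = I by rewrite mulrNN i2; ring.
rewrite mulrNN i2.
have : (4%:R : C) != 0 by rewrite pnatr_eq0.
move=> n4; apply: (mulfI n4); rewrite [LHS]mulrA mulfV // mul1r.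
have e : I * ((x + I * y) * (X + - I * Y)) = I * x * X - (I * I) * x * Y + (I * I) * y * X - (I * I) * I * y * Y by ring.
have e' : - I * ((x + - I * y) * (X + I * Y)) = - I * x * X - (I * I) * x * Y + (I * I) * y * X + (I * I) * I * y * Y by ring.
rewrite e e' i2; ring.
Qed.

Lemma polarization (x y : C) :
  4%:R^-1 * \sum_(k < 4) 'i ^+ k * (normc (x + 'i ^+ k * y) ^+ 2)%:C = x * conjc y.
Proof.
apply: polarization_root; apply/eqP; rewrite eq_complex /=.
  by apply/andP; split; apply/eqP; ring.
by rewrite oppr0 !eqxx.
Qed.

Lemma taylor_h2inner a b f g s : taylor a f -> taylor b g -> sqsum a -> sqsum b ->
  hasum (fun k => a k * conjc (b k)) s -> h2inner f g = s.
Proof.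
move=> af bg as_ bs; apply: hasum_unique.
have hk (k : 'I_4) : exists s, hasum (fun m => normc (a m + 'i ^+ k * b m) ^+ 2) s.
  exact/sqsum_hasum/sqsumD/sqsumZ.
pose s_ (k : 'I_4) := projT1 (cid (hk k)).
have hs (k : 'I_4) : hasum (fun m => normc (a m + 'i ^+ k * b m) ^+ 2) (s_ k).
  exact: projT2 (cid (hk k)).
have e (k : 'I_4) : fine (h2norm (fun z => f z + 'i ^+ k * g z)) ^+ 2 = s_ k.
  rewrite (taylor_h2norm (taylorD af (taylorZ ('i ^+ k) bg)) (hs k)) /= sqr_sqrtr //.
  by apply: le_trans (hasum_ge (fun=> sqr_ge0 _) (hs k) fset0); rewrite big_seq_fset0.
rewrite /h2inner; under eq_bigr do rewrite e.
have h (k : 'I_4) : true -> hasum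
    (fun m => 'i ^+ k * (normc (a m + 'i ^+ k * b m) ^+ 2)%:C) ('i ^+ k * (s_ k)%:C).
  by move=> _; apply: hasumZ; apply: hasum_real.
apply: eq_hasum (hasumZ (4%:R^-1 : C) (hasum_sum (index_enum 'I_4) h)) => m.
exact: polarization.
Qed.

End taylor.

(** * Multiplication by a function of one variable *)

Section one_variable_factor.
Variables (R : realType) (n : nat).
Local Notation C := R[i].
Local Notation normc := Normc.normc.
Local Notation K := {ffun 'I_n -> nat}.
Implicit Types (k p : K) (z w h : 'rV[C]_n) (a b u v : K -> C) (c : nat -> C).
Implicit Types (f g psi : 'rV[C]_n -> C) (l : 'I_n).

Lemma hasum_product (I J : choiceType) (u : I -> C) (v : J -> C) s t M N :
  hasum u s -> hasum v t -> bsum u M -> bsum v N ->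
  hasum (fun q : I * J => u q.1 * v q.2) (s * t).
Proof.
move=> us vt uM vN.
have N0 : 0 <= N by have := vN fset0; rewrite big_seq_fset0.
have [|x hx] := @bsum_hasum _ _ (fun q : I * J => u q.1 * v q.2) (M * N).
  apply: (bsum_pair (V := fun i => normc (u i) * N)) => [i A|A].
    under eq_bigr do rewrite Normc.normcM.
    by rewrite /= -mulr_sumr ler_wpM2l ?normc_ge0.
  by rewrite -mulr_suml ler_wpM2r.
suff <- : x = s * t by [].
apply: (@hasum_unique _ _ (fun i => t * u i)); last by rewrite mulrC; exact: hasumZ.
apply: (hasum_fiber (h := fst)) hx => i.
apply: (hasum_inj (g := fun j => (i, j))) => [j j' []//|[i' j] ij|].
  by case: eqP => //= ii; have := ij j; rewrite ii eqxx.
rewrite mulrC; apply: eq_hasum (hasumZ (u i) vt) => j /=.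
by rewrite eqxx.
Qed.

Definition setk k l (x : nat) : K := [ffun j => if j == l then x else k j].
Definition zerok : K := [ffun=> 0%N].

Lemma setk_same k l x : setk k l x l = x.
Proof. by rewrite ffunE eqxx. Qed.

Lemma setk_id k l : setk k l (k l) = k.
Proof. by apply/ffunP => j; rewrite ffunE; case: eqP => // ->. Qed.

Lemma setk_setk k l x y : setk (setk k l x) l y = setk k l y.
Proof. by apply/ffunP => j; rewrite !ffunE; case: eqP. Qed.

Lemma setk_other k l x j : j != l -> setk k l x j = k j.
Proof. by move=> /negPf jl; rewrite ffunE jl. Qed.

Lemma setkC k l l' x y : l != l' ->
  setk (setk k l x) l' y = setk (setk k l' y) l x.
Proof.
move=> ll; apply/ffunP => j; rewrite !ffunE.
by case: eqP => [->|//]; rewrite eq_sym (negPf ll).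
Qed.

Lemma mono_setk k l x z : mono (setk k l x) z =
  z ord0 l ^+ x * \prod_(j < n | j != l) z ord0 j ^+ k j.
Proof.
rewrite /mono (bigD1 l) //= setk_same; congr (_ * _).
by apply: eq_bigr => j jl; rewrite setk_other.
Qed.

Lemma mono_setkD k l x y z :
  mono (setk k l (x + y)) z = z ord0 l ^+ x * mono (setk k l y) z.
Proof. by rewrite !mono_setk exprD mulrA. Qed.

Lemma mono_axis l x z : mono (setk zerok l x) z = z ord0 l ^+ x.
Proof.
by rewrite mono_setk big1 ?mulr1 // => j _; rewrite ffunE expr0.
Qed.

(** The Cauchy product in the variable [z_l] alone. *)
Definition conv l c u k : C :=
  \sum_(m < (k l).+1) c (k l - m)%N * u (setk k l m).

(** The absolute bound is recorded because the Cauchy product of two series uses it. *)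
Definition one_var c l psi := forall z, polydisc z ->
  hasum (fun m => c m * z ord0 l ^+ m) (psi z) /\
  exists M, bsum (fun m => c m * z ord0 l ^+ m) M.

Lemma taylor_bsum a f z : taylor a f -> polydisc z ->
  exists M, bsum (fun k => a k * mono k z) M.
Proof.
move=> af zin; pose t := maxnorm z.
have t1 : t < 1 by exact: maxnorm_lt.
have t0 : 0 <= t by exact: maxnorm_ge0.
have [M aM] : exists M, coef_bound a ((1 + t) / 2) M.
  by apply: taylor_bound af _; apply/andP; split; lra.
exists (M * geo n (t / ((1 + t) / 2))).
apply: (coef_bound_bsum_mono aM _ _ (le_maxnorm z)); first by lra.
by rewrite -/t t0 /=; lra.
Qed.

Lemma setk_axis_inj l : injective (setk zerok l).
Proof. by move=> x y /ffunP /(_ l); rewrite !setk_same. Qed.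

Lemma taylor_one_var a l psi : taylor a psi -> depends_only_on l psi ->
  one_var (fun m => a (setk zerok l m)) l psi.
Proof.
move=> ap dp z zin.
have [M aM] := taylor_bsum ap zin.
split; last first.
  exists M; apply: le_bsum (bsum_inj (setk_axis_inj (l := l)) aM) => m /=.
  by rewrite mono_axis.
(* Setting the other coordinates to 0 does not change [psi] and leaves only the monomials in
   [z_l]. *)
pose w : 'rV[C]_n := \row_j (if j == l then z ord0 l else 0).
have win : polydisc w by move=> j; rewrite mxE; case: eqP => _ //; rewrite Normc.normc0.
have -> : psi z = psi w by apply: dp => //; rewrite mxE eqxx.
apply: (hasum_fiber (h := fun k : K => k l)) (ap w win) => m.
apply: eq_hasum (hasum1 (setk zerok l m) (a (setk zerok l m) * z ord0 l ^+ m)) => k.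
case: eqVneq => [->|kne].
  by rewrite setk_same eqxx mono_axis mxE eqxx.
case: eqVneq => // klm; have [j jl kj] : exists2 j, j != l & k j != 0%N.
  apply: contrapT => h; case/eqP: kne; apply/ffunP => j; rewrite !ffunE.
  case: eqVneq => [->//|jl]; apply/eqP; apply: contrapT => kj.
  by apply: h; exists j => //; exact/negP.
rewrite /mono (bigD1 j) //= mxE (negPf jl) expr0n (negPf kj) mul0r.
by rewrite mulr0.
Qed.

Lemma taylor_mul c l psi u f : one_var c l psi -> taylor u f ->
  taylor (conv l c u) (fun z => psi z * f z).
Proof.
move=> cp uf z zin; have [hc [M cM]] := cp z zin.
have [N uN] := taylor_bsum uf zin.
have := hasum_product hc (uf z zin) cM uN.
(* The exponent of z_l^m times the monomial of [k]; summing the product family over the fibres of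
   [h] produces [conv]. *)
pose h (q : nat * K) : K := setk q.2 l (q.1 + q.2 l).
apply: (hasum_fiber (h := h)) => k.
have -> : conv l c u k * mono k z = \sum_(m < (k l).+1 | true)
    (c (k l - m)%N * z ord0 l ^+ (k l - m)) * (u (setk k l m) * mono (setk k l m) z).
  rewrite /conv mulr_suml; apply: eq_bigr => m _.
  rewrite mulrACA; congr (_ * _); rewrite -mono_setkD subnK ?setk_id //.
  by rewrite -ltnS.
pose g (m : 'I_(k l).+1) : nat * K := ((k l - m)%N, setk k l m).
have hg m : h (g m) = k.
  by rewrite /h /g /= setk_same subnK ?setk_setk ?setk_id // -ltnS.
under eq_bigr => m _.
  have -> : c (k l - m)%N * z ord0 l ^+ (k l - m) * (u (setk k l m) * mono (setk k l m) z)
    = (fun q : nat * K => if h q == k then c q.1 * z ord0 l ^+ q.1 * (u q.2 * mono q.2 z) else 0) (g m).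
    by rewrite hg eqxx.
  over.
apply: hasum_finite => [x y _ _ [_ /ffunP /(_ l)]|[m p] hm].
  by rewrite !setk_same => /val_inj.
case: eqP => // hk; exfalso.
have kl : k l = (m + p l)%N by rewrite -hk /h /= setk_same.
have pl : (p l < (k l).+1)%N by rewrite kl ltnS leq_addl.
have /negP := hm (Ordinal pl) isT; apply; apply/eqP; rewrite /g /=.
rewrite {1}kl addnK -hk /h /= setk_setk.
by rewrite setk_id.
Qed.

Definition supported (A : {fset K}) u := forall k, k \notin A -> u k = 0.

Lemma hasum_supported (u : K -> C) (A : {fset K}) (G : K -> C) :
  supported A u -> hasum (fun k => u k * G k) (\sum_(k <- A) u k * G k).
Proof.
move=> uA e e0; exists A => B AB.
rewrite (big_fset_incl _ AB) ?subrr ?normr0 // => k _ kA.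
by rewrite uA // mul0r.
Qed.

(** Required on polynomials only, since these are bounded up to the boundary and radial limits
    apply; [conv_bound] and [density] extend it. *)
Definition isometric l c := forall (A : {fset K}) u, supported A u ->
  hasum (fun k => normc (conv l c u k) ^+ 2) (\sum_(k <- A) normc (u k) ^+ 2).

(** For a polynomial [f], the means of |psi f|^2 at radii [r_ N] tend to the mean of |f|^2 by
    dominated convergence, as |psi| has radial limit 1 almost everywhere. By Parseval they are also
    sums of |conv|^2 with weights tending to 1, and the two inequalities between the limits
    follow. *)
Lemma inner_isometric l c psi : one_var c l psi -> inner_function psi ->
  isometric l c.
Proof.
move=> cp [[M0 psiM0] apsi bpsi] A u uA.
pose M : R := `|M0|; have M00 : 0 <= M := normr_ge0 M0.
have psiM z : polydisc z -> normc (psi z) <= M.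
  by move=> /psiM0 h; apply: le_trans h (ler_norm _).
pose f z := \sum_(k <- A) u k * mono k z.
have uf : taylor u f by move=> z _; exact: hasum_supported.
have tf := taylor_mul cp uf.
set S := \sum_(k <- A) _.
(* A sequence of radii tending to 1 from the left, as dominated convergence is stated for
   sequences. *)
pose r_ N : R := 1 - (N.+1%:R)^-1.
have r01 N : 0 <= r_ N < 1.
  rewrite /r_ subr_ge0 invf_le1 ?ltr0n // ler1n /= ltrBlDr ltrDl.
  by rewrite invr_gt0 ltr0n.
have r_cvg : r_ N @[N --> \oo] --> (1 : R).
  rewrite -[X in _ --> X]subr0; apply: cvgB; first exact: cvg_cst.
  exact: cvg_harmonic.
have r_left : r_ N @[N --> \oo] --> (1 : R)^'-.
  move=> B [e /= e0 hB]; move/cvgrPdist_lt: (r_cvg) => /(_ e e0).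
  apply: filterS => N hN; apply: hB => //=.
  by case/andP: (r01 N).
pose P := \sum_(k <- A) normc (u k).
have P0 : 0 <= P by apply: sumr_ge0 => k _; exact: normc_ge0.
have fP z : (forall j, normc (z ord0 j) <= 1) -> normc (f z) <= P.
  move=> z1; apply: le_trans (normc_sum _ _ _) _; apply: ler_sum => k _.
  rewrite Normc.normcM ler_piMr ?normc_ge0 //.
  by apply: le_trans (le_normc_mono k z1) _; rewrite rmonoE expr1n.
pose F N t := normc (psi (torus_pt (r_ N) t) * f (torus_pt (r_ N) t)) ^+ 2.
pose F1 t := normc (f (torus_pt 1 t)) ^+ 2.
have bF N := taylor_parseval tf (r01 N).
have normP N (t : n.-tuple (measurableTypeR R)) j : normc (torus_pt (r_ N) t ord0 j) <= 1.
  by case/andP: (r01 N) => h0 /ltW h1; rewrite normc_torus_pt.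
have FM N t : `|F N t| <= (M * P) ^+ 2 + P ^+ 2.
  rewrite ger0_norm ?sqr_ge0 // ler_wpDr ?sqr_ge0 // lerXn2r ?nnegrE ?normc_ge0 //.
    by rewrite mulr_ge0.
  rewrite Normc.normcM ler_pM ?normc_ge0 // ?fP //.
  by apply: psiM; exact: polydisc_torus_pt.
have F1M t : `|F1 t| <= (M * P) ^+ 2 + P ^+ 2.
  rewrite ger0_norm ?sqr_ge0 // ler_wpDl ?sqr_ge0 // lerXn2r ?nnegrE ?normc_ge0 //.
  by apply: fP => j; rewrite normc_torus_pt.
have f_cvg t : normc (f (torus_pt (r_ N) t)) @[N --> \oo] --> normc (f (torus_pt 1 t)).
  pose G (r : R) : R := \sum_(k <- A) normc (u k) * (1 - rmono k r).
  have G0 : G (r_ N) @[N --> \oo] --> (0 : R).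
    have -> : (0 : R) = \sum_(k <- A) 0 by rewrite big1.
    rewrite /G; elim: (enum_fset A) => [|k s IH].
      by under eq_fun do rewrite big_nil; rewrite big_nil; exact: cvg_cst.
    under eq_fun do rewrite big_cons; rewrite big_cons; apply: cvgD IH.
    rewrite -[X in _ --> X](mulr0 (normc (u k))).
    apply: cvgM; first exact: cvg_cst.
    rewrite -(subrr (1 : R)); apply: cvgB; first exact: cvg_cst.
    under eq_fun do rewrite rmonoE.
    have h : r_ N ^+ (\sum_(j < n) k j) @[N --> \oo] --> (1 : R) ^+ (\sum_(j < n) k j).
      by apply: (cvg_comp _ (fun x : R => x ^+ _) r_cvg); exact: exprn_continuous.
    by rewrite expr1n in h; exact: h.
  apply/cvgrPdist_lt => e e0; move/cvgrPdist_lt: (G0) => /(_ e e0).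
  apply: filterS => N; rewrite sub0r normrN => /(le_lt_trans (ler_norm _)).
  apply: le_lt_trans; apply: le_trans (normc_dist _ _) _.
  rewrite /f -sumrB; apply: le_trans (normc_sum _ _ _) _; apply: ler_sum => k _.
  rewrite -mulrBr Normc.normcM ler_wpM2l ?normc_ge0 // !mono_torus_pt -mulrBl.
  rewrite Normc.normcM -rmorphB normc_real [X in _ * X](_ : _ = 1).
    rewrite mulr1 {1}rmonoE expr1n ger0_norm // subr_ge0 rmono_le1 //.
    by case/andP: (r01 N) => -> /ltW ->.
  rewrite normc_prod big1 // => j _; by rewrite normcX normc_cis expr1n.
have F_cvg : {ae torus_prob R n, forall t, F N t @[N --> \oo] --> F1 t}.
  apply: filterS bpsi => t [b [b1 pb]].
  have pb1 : normc (psi (torus_pt (r_ N) t)) @[N --> \oo] --> (1 : R).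
    rewrite -b1; apply/cvgrPdist_lt => e e0.
    have e0' : (0 : C) < e%:C by rewrite ltcR.
    have pb' := cvg_comp r_ (fun r => psi (torus_pt r t) : C^o) r_left pb.
    move/cvgrPdist_lt: pb' => /(_ _ e0').
    apply: filterS => N; rewrite normC_normc ltcR; apply: le_lt_trans.
    exact: normc_dist.
  rewrite /F1 -[normc _]mul1r.
  rewrite /F; under eq_fun do rewrite Normc.normcM.
  by apply: cvgM; apply: cvgM pb1 (f_cvg t).
have mF1 : bmeas F1 by apply: bmeas_normc_sqr; exact: cbmeas_poly.
have mS : mean (torus_prob R n) F1 = S.
  rewrite mean_poly; apply: eq_bigr => k _.
  by rewrite rmonoE !expr1n mulr1.
have cF : mean (torus_prob R n) (F N) @[N --> \oo] --> S.
  rewrite -mS; apply: mean_dominated FM F1M F_cvg; last by case: mF1.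
  by move=> N; case: (bF N) => [] [].
have v0 r k : 0 <= normc (conv l c u k) ^+ 2 * rmono k r ^+ 2.
  by rewrite mulr_ge0 ?sqr_ge0.
have cS (B : {fset K}) : \sum_(k <- B) normc (conv l c u k) ^+ 2 <= S.
  apply: sum_rmono_lim => r /andP[r0 r1].
  rewrite -(cvg_lim (@Rhausdorff R) cF); apply: limr_ge; first exact: cvgP cF.
  have : \forall N \near \oo, r < r_ N.
    by apply: (cvgr_gt _ r_cvg).
  apply: filterS => N rN.
  apply: le_trans (hasum_ge (v0 (r_ N)) (bF N).2 B).
  apply: ler_sum => k _; rewrite ler_wpM2l ?sqr_ge0 //.
  rewrite lerXn2r ?nnegrE ?rmono_ge0 ?le_rmono // ?(ltW rN) //.
  by case/andP: (r01 N).
have [s hs] := hasum_bounded (fun k => sqr_ge0 (normc (conv l c u k))) cS.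
suff -> : S = s by [].
apply/eqP; rewrite eq_le; apply/andP; split; last exact: hasum_le hs cS.
rewrite -(cvg_lim (@Rhausdorff R) cF); apply: limr_le; first exact: cvgP cF.
apply: nearW => N; apply: hasum_le (bF N).2 _ => B.
apply: le_trans (hasum_ge (fun=> sqr_ge0 _) hs B); apply: ler_sum => k _.
rewrite ler_piMr ?sqr_ge0 // expr_le1 ?rmono_le1 //.
  by case/andP: (r01 N) => -> /ltW ->.
by apply: rmono_ge0; case/andP: (r01 N).
Qed.

End one_variable_factor.

(** * The space of square summable coefficients *)

Section ell2.
Variables (R : realType) (n : nat).
Local Notation C := R[i].
Local Notation normc := Normc.normc.
Local Notation K := {ffun 'I_n -> nat}.

Definition ell2_pred : {pred K -> C^o} := fun u => `[< sqsum u >].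

Lemma ell2_submod_closed : submod_closed ell2_pred.
Proof.
split; first by apply/asboolP; exists 0 => A; rewrite big1 // => k _; rewrite Normc.normc0 expr0n.
move=> t u v /asboolP us /asboolP vs; apply/asboolP.
exact: sqsumD (sqsumZ t us) vs.
Qed.

HB.instance Definition _ :=
  GRing.isSubmodClosed.Build C (K -> C^o) ell2_pred ell2_submod_closed.

Record ell2 := Ell2 { ell2val :> K -> C^o; _ : ell2val \in ell2_pred }.

HB.instance Definition _ := [isSub for ell2val].
HB.instance Definition _ := [Choice of ell2 by <:].
HB.instance Definition _ := [SubChoice_isSubLmodule of ell2 by <:].

Implicit Types (k : K) (u v w : ell2) (t : C) (z : 'rV[C]_n).

Lemma ell2P u : sqsum u.
Proof. by case: u => u /= /asboolP. Qed.

Lemma ell2D u v k : (u + v) k = u k + v k. Proof. by []. Qed.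
Lemma ell2N u k : (- u) k = - u k. Proof. by []. Qed.
Lemma ell2Z t u k : (t *: u) k = t * u k. Proof. by []. Qed.
Lemma ell2_ext u v : (forall k, u k = v k) -> u = v.
Proof. by move=> uv; apply: val_inj; apply/funext. Qed.

Definition mkell2 (f : K -> C) (fs : sqsum f) : ell2 :=
  @Ell2 f (introT (asboolP _) fs).

Lemma hasum_conj (I : choiceType) (f : I -> C) s :
  hasum f s -> hasum (fun i => conjc (f i)) (conjc s).
Proof.
move=> /hasum_normcP h; apply/hasum_normcP => e e0; have [A hA] := h e e0.
exists A => B /hA; rewrite -(rmorph_sum (@conjc R)) -(rmorphB (@conjc R)).
by case: (_ - _) => x y /=; rewrite sqrrN.
Qed.

Lemma normc_conj (x : C) : normc (conjc x) = normc x.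
Proof. by case: x => x y /=; rewrite sqrrN. Qed.

Lemma conjc_add (x y : C) : conjc (x + y) = conjc x + conjc y.
Proof. exact: (rmorphD (@conjc R)). Qed.

Lemma conjc_opp (x : C) : conjc (- x) = - conjc x.
Proof. exact: (rmorphN (@conjc R)). Qed.

Lemma conjc_mul (x y : C) : conjc (x * y) = conjc x * conjc y.
Proof. exact: (rmorphM (@conjc R)). Qed.

(* The inner product, the evaluation of power series and the operators below
   are sealed: comparing two of their values by unfolding would not terminate
   in reasonable time. *)
Fact ip_seal : {f : ell2 -> ell2 -> C |
  forall u v, f u v = tsum (fun k => u k * conjc (v k))}.
Proof. by exists (fun u v => tsum (fun k => u k * conjc (v k))). Qed.

Definition ip : ell2 -> ell2 -> C := sval ip_seal.

Lemma ipE u v : ip u v = tsum (fun k => u k * conjc (v k)).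
Proof. exact: (svalP ip_seal). Qed.

Lemma hasum_ip u v s : hasum (fun k => u k * conjc (v k)) s -> ip u v = s.
Proof. by move=> h; rewrite ipE; exact: hasum_tsum. Qed.

Lemma ip_hasum u v : hasum (fun k => u k * conjc (v k)) (ip u v).
Proof.
have [M uM] := ell2P u; have [N vN] := ell2P v.
rewrite ipE; apply: (@tsumP _ _ _ (M + N)) => A.
apply: (@le_trans _ _ (\sum_(k <- A) (normc (u k) ^+ 2 + normc (v k) ^+ 2))).
  apply: ler_sum => k _; rewrite Normc.normcM normc_conj.
  set x := normc (u k); set y := normc (v k).
  by have := sqr_ge0 (x - y); have := sqr_ge0 (x + y); rewrite sqrrB sqrrD; lra.
by rewrite big_split lerD.
Qed.

Definition nrm2 u : R := complex.Re (ip u u).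

Lemma ip_self u : ip u u = (nrm2 u)%:C.
Proof.
have [s hs] := sqsum_hasum (ell2P u).
suff e : ip u u = s%:C by rewrite /nrm2 e.
apply: (hasum_unique (ip_hasum u u)).
by apply: eq_hasum (hasum_real hs) => k; rewrite normc_sqr.
Qed.

Lemma nrm2_hasum u : hasum (fun k => normc (u k) ^+ 2) (nrm2 u).
Proof.
have [s hs] := sqsum_hasum (ell2P u).
suff -> : nrm2 u = s by [].
suff e : ip u u = s%:C by rewrite /nrm2 e.
apply: (hasum_unique (ip_hasum u u)).
by apply: eq_hasum (hasum_real hs) => k; rewrite normc_sqr.
Qed.

Lemma nrm2_eq0 u : nrm2 u = 0 -> u = 0.
Proof.
move=> u0; apply: ell2_ext => k; apply: Normc.eq0_normc.
have := hasum_ge (fun=> sqr_ge0 _) (nrm2_hasum u) [fset k]%fset.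
rewrite u0 big_seq_fset1 => h; apply/eqP; rewrite -sqrf_eq0.
by rewrite eq_le h sqr_ge0.
Qed.

Lemma ipDl u v w : ip (u + v) w = ip u w + ip v w.
Proof.
apply: hasum_ip; apply: eq_hasum (hasumD (ip_hasum u w) (ip_hasum v w)) => k.
by rewrite ell2D mulrDl.
Qed.

Lemma ipZl t u w : ip (t *: u) w = t * ip u w.
Proof.
apply: hasum_ip; apply: eq_hasum (hasumZ t (ip_hasum u w)) => k.
by rewrite ell2Z mulrA.
Qed.

Lemma ipC u v : ip u v = conjc (ip v u).
Proof.
apply: hasum_ip; apply: eq_hasum (hasum_conj (ip_hasum v u)) => k.
by rewrite conjc_mul conjcK mulrC.
Qed.

Lemma ipDr u v w : ip u (v + w) = ip u v + ip u w.
Proof. by rewrite ipC ipDl conjc_add (ipC u v) (ipC u w). Qed.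

Lemma ipZr t u w : ip u (t *: w) = conjc t * ip u w.
Proof. by rewrite ipC ipZl conjc_mul -ipC. Qed.

Lemma ipNl u w : ip (- u) w = - ip u w.
Proof. by rewrite -scaleN1r ipZl mulN1r. Qed.

Lemma ipNr u w : ip u (- w) = - ip u w.
Proof. by rewrite ipC ipNl conjc_opp -ipC. Qed.

Lemma ip0l w : ip 0 w = 0.
Proof. by rewrite -(scale0r 0) ipZl mul0r. Qed.

(** From 2xy <= x^2 + y^2 termwise; this stands in for the Cauchy-Schwarz inequality in the operator
    bounds below. *)
Lemma ip_bound u v : 2 * normc (ip u v) <= nrm2 u + nrm2 v.
Proof.
rewrite -ler_pdivlMl // mulrC; apply: hasum_normc_le (ip_hasum u v) => A.
rewrite ler_pdivlMr // mulr_suml.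
apply: (@le_trans _ _ (\sum_(k <- A) (normc (u k) ^+ 2 + normc (v k) ^+ 2))).
  apply: ler_sum => k _; rewrite Normc.normcM normc_conj.
  set x := normc (u k); set y := normc (v k).
  by have := sqr_ge0 (x - y); rewrite sqrrB; lra.
rewrite big_split lerD //.
  exact: hasum_ge (fun=> sqr_ge0 _) (nrm2_hasum u) A.
exact: hasum_ge (fun=> sqr_ge0 _) (nrm2_hasum v) A.
Qed.

Lemma sqsum_delta k : sqsum (fun j => if j == k then 1 else 0 : C).
Proof.
exists 1 => A.
have h1 j : 0 <= (if j == k then 1 else 0) :> R by case: eqP.
apply: le_trans (hasum_ge h1 (hasum1 k (1 : R)) A); apply: ler_sum => j _; case: eqP => _;
  rewrite ?Normc.normc1 ?Normc.normc0 ?expr1n //.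
by rewrite expr0n.
Qed.

Definition delta k : ell2 := mkell2 (sqsum_delta k).

Lemma deltaE k j : delta k j = if j == k then 1 else 0.
Proof. by []. Qed.

Lemma ip_deltar u k : ip u (delta k) = u k.
Proof.
apply: hasum_ip; apply: eq_hasum (hasum1 k (u k)) => j; rewrite deltaE.
by case: eqP => [->|_]; rewrite ?(rmorph1 (@conjc R)) ?(rmorph0 (@conjc R)) ?mulr1 ?mulr0.
Qed.

Lemma ip_deltal u k : ip (delta k) u = conjc (u k).
Proof. by rewrite ipC ip_deltar. Qed.

Lemma ip_eqr u v : (forall w, ip w u = ip w v) -> u = v.
Proof.
move=> h; apply: ell2_ext => k; have := h (delta k).
by rewrite !ip_deltal => /(congr1 conjc); rewrite !conjcK.
Qed.

Definition restr (A : {fset K}) u : ell2 := \sum_(k <- A) (u k : C) *: delta k.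

Lemma sum_ell2 (I : Type) (r : seq I) (F : I -> ell2) k :
  (\sum_(i <- r) F i) k = \sum_(i <- r) F i k.
Proof. by elim: r => [|i r IH]; rewrite ?big_nil // !big_cons ell2D IH. Qed.

Lemma restrE A u k : restr A u k = if k \in A then u k else 0.
Proof.
rewrite /restr sum_ell2.
have e j : ((u j : C) *: delta j) k = if j == k then u k else 0.
  rewrite ell2Z deltaE eq_sym; case: eqP => [->|_]; first by rewrite mulr1.
  by rewrite mulr0.
under eq_bigr do rewrite e.
case: ifP => kA; last by apply: big1_seq => j /andP[_ jA]; case: eqP => // jk; rewrite -jk jA in kA.
rewrite (big_fsetD1 k) //= eqxx big1_fset ?addr0 // => j.
by rewrite !inE => /andP[/negPf ->].
Qed.

Lemma nrm2_restr_lt u (e : R) : 0 < e -> exists A, nrm2 (u - restr A u) < e.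
Proof.
move=> e0; have hs := nrm2_hasum u.
have e2 : 0 < e / 2 by rewrite divr_gt0.
have [A hA] := hs _ e2; exists A.
apply: le_lt_trans (_ : e / 2 < e); last by lra.
apply: hasum_le (nrm2_hasum _) _ => B.
have h1 := hA A (fsubset_refl A).
have h2 := hasum_ge (fun=> sqr_ge0 _) hs (A `|` B)%fset.
have hk k : normc ((u - restr A u) k) ^+ 2 +
    (if k \in A then normc (u k) ^+ 2 else 0) <= normc (u k) ^+ 2.
  rewrite ell2D ell2N restrE; case: ifP => kA.
    by rewrite subrr Normc.normc0 expr0n add0r.
  by rewrite subr0 addr0.
apply: (@le_trans _ _ (\sum_(k <- (A `|` B)%fset) normc (u k) ^+ 2 - \sum_(k <- A) normc (u k) ^+ 2)).
  rewrite lerBrDr.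
  have -> : \sum_(k <- A) normc (u k) ^+ 2 = \sum_(k <- (A `|` B)%fset) (if k \in A then normc (u k) ^+ 2 else 0).
    rewrite -(big_fset_incl _ (fsubsetUl A B)) => [|k _ /negPf -> //].
    by apply: eq_big_seq => k ->.
  apply: (@le_trans _ _ (\sum_(k <- (A `|` B)%fset) normc ((u - restr A u) k) ^+ 2 +
      \sum_(k <- (A `|` B)%fset) (if k \in A then normc (u k) ^+ 2 else 0))).
    rewrite lerD2r; apply: le_sum_fset; last exact: fsubsetUr.
    by move=> k; exact: sqr_ge0.
  by rewrite -big_split; apply: ler_sum => k _; exact: hk.
move: h1 h2; rewrite ltr_norml => /andP[h1 _] h2.
by have := h2; lra.
Qed.

(* Applied to a large multiple of a small tail of [u], the bound [nrm2 u + B]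
   makes [F u] as small as one likes. *)
Lemma density (F : ell2 -> C) (B : R) :
  (forall u v, F (u + v) = F u + F v) -> (forall t u, F (t *: u) = t * F u) ->
  (forall u, normc (F u) <= nrm2 u + B) -> (forall k, F (delta k) = 0) ->
  forall u, F u = 0.
Proof.
move=> FD FZ FB F0 u; apply: Normc.eq0_normc.
apply/eqP; rewrite eq_le normc_ge0 andbT; apply/ler_addgt0Pl => e e0; rewrite addr0.
have Fr A : F (restr A u) = 0.
  rewrite /restr; elim: (enum_fset A) => [|k s IH].
    by rewrite big_nil -(scale0r 0) FZ mul0r.
  by rewrite big_cons FD FZ F0 mulr0 IH addr0.
pose t : R := (`|B| + 1) / e; have t0 : 0 < t by rewrite divr_gt0 // ltr_wpDl.
have [A hA] : exists A, nrm2 (u - restr A u) < (t ^+ 2)^-1.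
  by apply: nrm2_restr_lt; rewrite invr_gt0 exprn_gt0.
have -> : F u = F (u - restr A u).
  by rewrite FD -scaleN1r FZ Fr mulr0 addr0.
set v := u - restr A u in hA *.
have h := FB (t%:C *: v); rewrite FZ Normc.normcM normc_real gtr0_norm // in h.
have nZ : nrm2 (t%:C *: v) = t ^+ 2 * nrm2 v.
  rewrite /nrm2 ipZl ipZr ip_self conjc_realE -!rmorphM /=.
  by rewrite mulrA -expr2.
have : t ^+ 2 * nrm2 v < 1.
  by rewrite mulrC -ltr_pdivlMr ?exprn_gt0 // mul1r.
move: h; rewrite nZ => h h1.
have : t * normc (F v) <= `|B| + 1.
  by apply: (le_trans h); rewrite addrC lerD ?ler_norm // ltW.
rewrite -ler_pdivlMl // mulrC /t invf_div mulrA mulrAC divff ?mul1r // gt_eqF // ltr_wpDl.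
Qed.

Lemma ip_polarization u v :
  ip u v = 4%:R^-1 * \sum_(k < 4) 'i ^+ k * (nrm2 (u + ('i ^+ k) *: v))%:C.
Proof.
apply: hasum_ip.
have h (k : 'I_4) : true -> hasum
    (fun m => 'i ^+ k * (normc ((u + ('i ^+ k) *: v) m) ^+ 2)%:C)
    ('i ^+ k * (nrm2 (u + ('i ^+ k) *: v))%:C).
  by move=> _; apply: hasumZ; apply: hasum_real; exact: nrm2_hasum.
apply: eq_hasum (hasumZ (4%:R^-1 : C) (hasum_sum (index_enum 'I_4) h)) => m.
exact: polarization.
Qed.

Fact ev_seal : {f : ell2 -> 'rV[C]_n -> C |
  forall u z, f u z = tsum (fun k => u k * mono k z)}.
Proof. by exists (fun u z => tsum (fun k => u k * mono k z)). Qed.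

Definition ev : ell2 -> 'rV[C]_n -> C := sval ev_seal.

Lemma evE u z : ev u z = tsum (fun k => u k * mono k z).
Proof. exact: (svalP ev_seal). Qed.

Lemma ev_taylor u : taylor u (ev u).
Proof.
by move=> z zin; have [M uM] := sqsum_bsum_mono (ell2P u) zin; rewrite evE; exact: tsumP uM.
Qed.

Lemma taylor_ev u f z : polydisc z -> taylor u f -> f z = ev u z.
Proof. by move=> zin uf; exact: hasum_unique (uf z zin) (ev_taylor u zin). Qed.

Lemma ev_inj u v : (forall z, polydisc z -> ev u z = ev v z) -> u = v.
Proof.
move=> uv; apply: ell2_ext => k.
by rewrite (taylor_unique uv (ev_taylor u) (ev_taylor v)).
Qed.

Lemma evD u v z : polydisc z -> ev (u + v) z = ev u z + ev v z.
Proof.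
move=> zin; rewrite evE; apply: hasum_tsum.
apply: eq_hasum (hasumD (ev_taylor u zin) (ev_taylor v zin)) => k.
by rewrite ell2D mulrDl.
Qed.

Lemma evZ t u z : polydisc z -> ev (t *: u) z = t * ev u z.
Proof.
move=> zin; rewrite evE; apply: hasum_tsum; apply: eq_hasum (hasumZ t (ev_taylor u zin)) => k.
by rewrite ell2Z mulrA.
Qed.

Lemma evB u v z : polydisc z -> ev (u - v) z = ev u z - ev v z.
Proof. by move=> zin; rewrite evD // -scaleN1r evZ // mulN1r. Qed.

Lemma ev_delta0 z : polydisc z -> ev (delta (zerok n)) z = 1.
Proof.
move=> zin; rewrite evE; apply: hasum_tsum.
apply: eq_hasum (hasum1 (zerok n) (1 : C)) => k; rewrite deltaE.
case: eqP => [->|_]; last by rewrite mul0r.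
by rewrite mul1r /mono big1 // => j _; rewrite ffunE expr0.
Qed.

Lemma H2_ev f : H2 f -> exists u, forall z, polydisc z -> f z = ev u z.
Proof.
move=> [/analytic_taylor[a af] fN].
exists (mkell2 (H2_sqsum af fN)) => z zin.
exact: (taylor_ev (u := mkell2 (H2_sqsum af fN))).
Qed.

Lemma ev_H2 u : H2 (ev u).
Proof. exact: taylor_H2 (ev_taylor u) (ell2P u). Qed.

Lemma h2inner_ev f g u v : (forall z, polydisc z -> f z = ev u z) ->
  (forall z, polydisc z -> g z = ev v z) -> h2inner f g = ip u v.
Proof.
move=> fu gv; apply: (taylor_h2inner (a := u) (b := v)).
- by move=> z zin; rewrite fu //; exact: ev_taylor.
- by move=> z zin; rewrite gv //; exact: ev_taylor.
- exact: ell2P.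
- exact: ell2P.
- exact: ip_hasum.
Qed.

End ell2.

(** * Multiplication operators and their adjoints *)

Section operators.
Variables (R : realType) (n : nat).
Local Notation C := R[i].
Local Notation normc := Normc.normc.
Local Notation K := {ffun 'I_n -> nat}.
Local Notation ell2 := (ell2 R n).
Implicit Types (k : K) (u v w : ell2) (t : C) (z : 'rV[C]_n).

(** One structure covers both [phi_l] and the coordinate [z_l] (see [shift]), so that A_l, B_l and
    M_l, N_l share all their lemmas. *)
Record iso (l : 'I_n) := Iso { iso_coef :> nat -> C; isoP : isometric l iso_coef }.

Section one_operator.
Variables (l : 'I_n) (c : iso l).

(** On [A] the coefficients of the product depend only on those of [u] in a finite box, so [u] may
    be truncated to a polynomial, where [isometric] applies. *)
Lemma conv_bound u (A : {fset K}) :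
  \sum_(k <- A) normc (conv l c u k) ^+ 2 <= nrm2 u.
Proof.
have [N [hN _]] := fset_box A (zerok n).
pose B : {fset K} := [fset box_index t | t in {: {ffun 'I_n -> 'I_N}}]%fset.
pose u' k : C := if k \in B then u k else 0.
have inB k : (forall j, (k j < N)%N) -> k \in B.
  by move=> /box_indexP[t <-]; apply/imfsetP; exists t.
have e k : k \in A -> conv l c u k = conv l c u' k.
  move=> kA; apply: eq_bigr => m _; congr (_ * _); rewrite /u' inB // => j.
  rewrite ffunE; case: eqP => _; last exact: hN.
  by apply: leq_ltn_trans (hN k kA l); rewrite -ltnS.
rewrite big_seq; under eq_bigr => k kA do rewrite (e k kA).
rewrite -big_seq; have su : supported B u' by move=> k /negPf kB; rewrite /u' kB.
apply: le_trans (hasum_ge (fun=> sqr_ge0 _) (isoP c su) A) _.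
apply: le_trans (hasum_ge (fun=> sqr_ge0 _) (nrm2_hasum u) B).
by apply: ler_sum => k _; rewrite /u'; case: ifP => // _; rewrite Normc.normc0 expr0n sqr_ge0.
Qed.

Fact Aop_seal : {f : ell2 -> ell2 | forall u k, f u k = conv l c u k}.
Proof.
by exists (fun u => mkell2 (ex_intro _ (nrm2 u) (conv_bound u) : sqsum (conv l c u))).
Qed.

Definition Aop : ell2 -> ell2 := sval Aop_seal.

Lemma AopE u k : Aop u k = conv l c u k.
Proof. exact: (svalP Aop_seal). Qed.

Lemma nrm2_Aop u : nrm2 (Aop u) <= nrm2 u.
Proof. apply: hasum_le (nrm2_hasum _) _ => A.
under eq_bigr do rewrite AopE; exact: conv_bound. Qed.

Fact Aop_linear : linear Aop.
Proof.
move=> t u v; apply: ell2_ext => k; rewrite ell2D ell2Z !AopE /conv mulr_sumr -big_split.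
by apply: eq_bigr => m _; rewrite ell2D ell2Z mulrDr mulrCA.
Qed.

HB.instance Definition _ := GRing.isLinear.Build C ell2 ell2 *:%R Aop Aop_linear.

Lemma Aop_delta k m : Aop (delta R k) (setk k l (k l + m)) = c m.
Proof.
have kl : (k l < (k l + m).+1)%N by rewrite ltnS leq_addr.
rewrite AopE /conv setk_same (bigD1 (Ordinal kl)) //= setk_setk setk_id.
rewrite /= eqxx mulr1 addKn big1 ?addr0 // => p pk.
rewrite setk_setk /=; case: eqP => [/ffunP /(_ l)|_]; last by rewrite mulr0.
by rewrite setk_same => e; case/eqP: pk; apply: val_inj.
Qed.

Lemma Aop_delta0 k k' : (forall m, k' <> setk k l (k l + m)) ->
  Aop (delta R k) k' = 0.
Proof.
move=> h; rewrite AopE /conv big1 // => m _; rewrite deltaE; case: eqP => [e|_]; last by rewrite mulr0.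
case: (h (k' l - k l)%N); rewrite -e setk_same subnKC; last by rewrite -ltnS.
by rewrite setk_setk setk_id.
Qed.

(** The value that the adjoint must take at [k], read off from its inner product with the basis
    vector. *)
Definition Bfun v k : C := ip v (Aop (delta R k)).

Lemma hasum_Bfun v k :
  hasum (fun m : nat => conjc (c m) * v (setk k l (k l + m))) (Bfun v k).
Proof.
apply: (hasum_fiber (h := fun k' : K => (k' l - k l)%N)) (ip_hasum v (Aop (delta R k))) => m.
apply: eq_hasum (hasum1 (setk k l (k l + m)) (conjc (c m) * v (setk k l (k l + m)))) => k'.
case: eqVneq => [->|ne]; first by rewrite setk_same addKn eqxx Aop_delta mulrC.
case: eqVneq => // km; rewrite Aop_delta0 ?conjc0 ?mulr0 // => m' e.
by case/eqP: ne; rewrite e; rewrite e setk_same addKn in km; rewrite km.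
Qed.

(** With [u] the truncation of [Bfun v] to [A], the inner product of [Aop u] and [v] is s = |u|^2.
    Then [ip_bound] gives 2s <= |Aop u|^2 + |v|^2 <= s + |v|^2. *)
Lemma Bfun_bound v (A : {fset K}) : \sum_(k <- A) normc (Bfun v k) ^+ 2 <= nrm2 v.
Proof.
pose s := \sum_(k <- A) normc (Bfun v k) ^+ 2; rewrite -/s.
pose u : ell2 := \sum_(k <- A) Bfun v k *: delta R k.
have uE k : u k = if k \in A then Bfun v k else 0.
  rewrite /u sum_ell2.
  have e j : (Bfun v j *: delta R j) k = if j == k then Bfun v k else 0.
    rewrite ell2Z deltaE eq_sym; case: eqP => [->|_]; first by rewrite mulr1.
    by rewrite mulr0.
  under eq_bigr do rewrite e.
  case: ifP => kA; last by apply: big1_seq => j /andP[_ jA]; case: eqP => // jk; rewrite -jk jA in kA.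
  rewrite (big_fsetD1 k) //= eqxx big1_fset ?addr0 // => j.
  by rewrite !inE => /andP[/negPf ->].
have us : nrm2 u = s.
  apply: (hasum_unique (nrm2_hasum u)).
  rewrite /s; under eq_big_seq => k kA.
    have -> : normc (Bfun v k) ^+ 2 = normc (u k) ^+ 2 by rewrite uE kA.
    over.
  move=> e e0; exists A => B AB; rewrite (big_fset_incl _ AB) ?subrr ?normr0 // => k _ kA.
  by rewrite uE (negPf kA) Normc.normc0 expr0n.
have ips : ip (Aop u) v = s%:C.
  rewrite /u linear_sum /s rmorph_sum /=.
  elim: (enum_fset A) => [|k r IH]; first by rewrite !big_nil ip0l.
  rewrite !big_cons ipDl IH linearZ ipZl; congr (_ + _).
  by rewrite normc_sqr ipC.
have := ip_bound (Aop u) v; rewrite ips normc_real ger0_norm; last first.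
  by rewrite sumr_ge0 // => k _; exact: sqr_ge0.
have := nrm2_Aop u; rewrite us; move: (nrm2 _) (nrm2 _) => x y; lra.
Qed.

Fact Bop_seal : {f : ell2 -> ell2 | forall v k, f v k = ip v (Aop (delta R k))}.
Proof.
by exists (fun v => mkell2 (ex_intro _ (nrm2 v) (Bfun_bound v) : sqsum (Bfun v))).
Qed.

Definition Bop : ell2 -> ell2 := sval Bop_seal.

Lemma BopE v k : Bop v k = ip v (Aop (delta R k)).
Proof. exact: (svalP Bop_seal). Qed.

Lemma hasum_Bop v k :
  hasum (fun m : nat => conjc (c m) * v (setk k l (k l + m))) (Bop v k).
Proof. by rewrite BopE; exact: hasum_Bfun. Qed.

Lemma nrm2_Bop v : nrm2 (Bop v) <= nrm2 v.
Proof. apply: hasum_le (nrm2_hasum _) _ => A.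
under eq_bigr do rewrite BopE; exact: Bfun_bound. Qed.

Fact Bop_linear : linear Bop.
Proof. by move=> t u v; apply: ell2_ext => k; rewrite ell2D ell2Z !BopE ipDl ipZl. Qed.

HB.instance Definition _ := GRing.isLinear.Build C ell2 ell2 *:%R Bop Bop_linear.

Lemma adjoint_op u v : ip (Aop u) v = ip u (Bop v).
Proof.
apply/eqP; rewrite -subr_eq0; apply/eqP.
apply: (density (F := fun u => ip (Aop u) v - ip u (Bop v)) (B := nrm2 v)).
- by move=> x y; rewrite linearD !ipDl opprD addrACA.
- by move=> t x; rewrite linearZ !ipZl mulrBr.
- move=> x; apply: le_trans (le_normcD _ _) _; rewrite normcN.
  have := ip_bound (Aop x) v; have := ip_bound x (Bop v).
  have := nrm2_Aop x; have := nrm2_Bop v.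
  move: (nrm2 _) (nrm2 _) (nrm2 _) (nrm2 _) (normc _) (normc _) => *; lra.
- by move=> k; rewrite ip_deltal BopE -ipC subrr.
Qed.

(** By polarization only norms of vectors supported on [k] and [k'] occur, and [isometric] covers
    these. *)
Lemma Aop_isometry_delta k k' :
  ip (Aop (delta R k)) (Aop (delta R k')) = ip (delta R k) (delta R k').
Proof.
rewrite !ip_polarization; congr *%R; apply: eq_bigr => p _; congr *%R; congr (real_complex R).
rewrite -linearZ -linearD; set u := _ + _.
have su : supported [fset k; k']%fset u.
  move=> j; rewrite !inE negb_or => /andP[/negPf jk /negPf jk'].
  by rewrite /u ell2D ell2Z !deltaE jk jk' mulr0 addr0.
transitivity (\sum_(j <- [fset k; k']%fset) normc (u j) ^+ 2).
  apply: (hasum_unique (nrm2_hasum (Aop u))); apply: eq_hasum (isoP c su) => j.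
  by rewrite AopE.
apply: (hasum_unique _ (nrm2_hasum u)).
move=> e e0; exists [fset k; k']%fset => B AB.
rewrite (big_fset_incl _ AB) ?subrr ?normr0 // => j _ /su ->.
by rewrite Normc.normc0 expr0n.
Qed.

Lemma AopK : cancel Aop Bop.
Proof.
move=> u; apply: ell2_ext => k; rewrite BopE -[RHS]ip_deltar.
apply/eqP; rewrite -subr_eq0; apply/eqP.
apply: (density (F := fun u => ip (Aop u) (Aop (delta R k)) - ip u (delta R k))
  (B := nrm2 (delta R k))).
- by move=> x y; rewrite linearD !ipDl opprD addrACA.
- by move=> t x; rewrite linearZ !ipZl mulrBr.
- move=> x; apply: le_trans (le_normcD _ _) _; rewrite normcN.
  have := ip_bound (Aop x) (Aop (delta R k)); have := ip_bound x (delta R k).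
  have := nrm2_Aop x; have := nrm2_Aop (delta R k).
  move: (nrm2 _) (nrm2 _) (nrm2 _) (nrm2 _) (normc _) (normc _) => *; lra.
- by move=> k'; rewrite Aop_isometry_delta subrr.
Qed.

Fact iso_fun_seal : {f : 'rV[C]_n -> C |
  forall z, f z = tsum (fun m : nat => c m * z ord0 l ^+ m)}.
Proof. by exists (fun z => tsum (fun m : nat => c m * z ord0 l ^+ m)). Qed.

Definition iso_fun : 'rV[C]_n -> C := sval iso_fun_seal.

Lemma iso_fun_tsum z : iso_fun z = tsum (fun m : nat => c m * z ord0 l ^+ m).
Proof. exact: (svalP iso_fun_seal). Qed.

Lemma hasum_iso_fun z s : hasum (fun m : nat => c m * z ord0 l ^+ m) s -> iso_fun z = s.
Proof. by move=> h; rewrite iso_fun_tsum; exact: hasum_tsum. Qed.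

(** The numbers [c m] are the coefficients of [Aop] applied to the constant 1, hence part of a
    square summable family. *)
Lemma iso_one_var : one_var c l iso_fun.
Proof.
move=> z zin; have [M uM] := sqsum_bsum_mono (ell2P (Aop (delta R (zerok n)))) zin.
have b : bsum (fun m : nat => c m * z ord0 l ^+ m) M.
  apply: le_bsum (bsum_inj (setk_axis_inj (l := l)) uM) => m.
  have -> : ((fun k => Aop (delta R (zerok n)) k * mono k z) \o setk (zerok n) l) m =
    Aop (delta R (zerok n)) (setk (zerok n) l (zerok n l + m)) * mono (setk (zerok n) l m) z.
    by rewrite [zerok n l]ffunE.
  by rewrite Aop_delta mono_axis.
by split; [rewrite iso_fun_tsum; exact: tsumP b | exists M].
Qed.

Lemma iso_funE psi z : one_var c l psi -> polydisc z -> iso_fun z = psi z.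
Proof. by move=> cp zin; apply: hasum_iso_fun; case: (cp z zin). Qed.

Lemma ev_Aop u z : polydisc z -> ev (Aop u) z = iso_fun z * ev u z.
Proof.
move=> zin; symmetry; apply: (taylor_ev (f := fun z => iso_fun z * ev u z)) => // w win.
apply: eq_hasum (taylor_mul iso_one_var (ev_taylor u) win) => k.
by rewrite AopE.
Qed.

Lemma one_var0 psi : one_var c l psi -> psi 0 = c 0%N.
Proof.
move=> cp; have [h _] := cp 0 (@polydisc0 R n); apply: (hasum_unique h).
apply: eq_hasum (hasum1 0%N (c 0%N)) => m; rewrite rv0E expr0n.
by case: eqP => [->|]; rewrite ?mulr1 ?mulr0.
Qed.

End one_operator.

Lemma Aop_comm l l' (c : iso l) (c' : iso l') u : Aop c (Aop c' u) = Aop c' (Aop c u).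
Proof.
apply: ev_inj => z zin.
rewrite (ev_Aop c _ zin) (ev_Aop c' _ zin).
rewrite (ev_Aop c' _ zin) (ev_Aop c _ zin).
exact: mulrCA.
Qed.

Lemma Bop_comm l l' (c : iso l) (c' : iso l') u : Bop c (Bop c' u) = Bop c' (Bop c u).
Proof. by apply: ip_eqr => w; rewrite -!adjoint_op Aop_comm. Qed.

(** [Aop] is a finite sum along coordinate [l] and [Bop] a series along coordinate [l']; for
    distinct coordinates the two index changes commute. *)
Lemma ABop_comm l l' (c : iso l) (c' : iso l') u : l != l' ->
  Aop c (Bop c' u) = Bop c' (Aop c u).
Proof.
move=> ll; apply: ell2_ext => k.
have h := hasum_sum (index_enum 'I_(k l).+1) (P := xpredT)
  (fun m _ => hasumZ (c (k l - m)%N) (hasum_Bop c' u (setk k l m))).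
rewrite AopE; apply: (hasum_unique h); apply: eq_hasum (hasum_Bop c' (Aop c u) k) => p.
rewrite AopE /conv mulr_sumr setk_other //; apply: eq_bigr => m _.
rewrite [setk k l m l']setk_other 1?eq_sym // mulrCA; congr (_ * (_ * u _)).
by rewrite setkC // eq_sym.
Qed.

Definition shift_coef (m : nat) : C := if m == 1%N then 1 else 0.

Lemma conv_shift l (u : K -> C) k :
  conv l shift_coef u k = if k l is x.+1 then u (setk k l x) else 0.
Proof.
rewrite /conv; case e : (k l) => [|x].
  by rewrite big_ord1 subn0 mul0r.
rewrite big_ord_recr /= subnn mul0r addr0 big_ord_recr /= subSnn mul1r big1 ?add0r // => m _.
rewrite /shift_coef subSn ?(ltnW (ltn_ord m)) // eqSS subn_eq0 leqNgt ltn_ord /=.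
by rewrite mul0r.
Qed.

Lemma shift_isometric (l : 'I_n) : isometric l shift_coef.
Proof.
move=> A u uA; pose g k : K := setk k l (k l).+1.
have gI : injective g.
  move=> k k' /ffunP e; apply/ffunP => j; have := e j; rewrite /g !ffunE.
  by case: eqP => // -> [].
apply: (hasum_inj gI) => [k kg|].
  rewrite conv_shift; case e : (k l) => [|x]; first by rewrite Normc.normc0 expr0n.
  by have /negP := kg (setk k l x); case; rewrite /g setk_same setk_setk -e setk_id.
move=> e e0; exists A => B AB.
have -> : \sum_(k <- B) ((fun k => normc (conv l shift_coef u k) ^+ 2) \o g) k = \sum_(k <- B) normc (u k) ^+ 2.
  by apply: eq_bigr => k _; rewrite /= conv_shift /g setk_same setk_setk setk_id.
rewrite (big_fset_incl _ AB) ?subrr ?normr0 // => k _ /uA ->.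
by rewrite Normc.normc0 expr0n.
Qed.

Definition shift l : iso l := Iso (@shift_isometric l).

Lemma iso_fun_shift l z : iso_fun (shift l) z = z ord0 l.
Proof.
apply: hasum_iso_fun; apply: eq_hasum (hasum1 1%N (z ord0 l)) => m /=.
by rewrite /shift_coef; case: eqP => [->|_]; rewrite ?mul1r ?expr1 ?mul0r.
Qed.

Lemma Bop_shift l u k : Bop (shift l) u k = u (setk k l (k l).+1).
Proof.
apply: (hasum_unique (hasum_Bop (shift l) u k)).
apply: eq_hasum (hasum1 1%N (u (setk k l (k l).+1))) => m /=.
rewrite /shift_coef; case: eqP => [->|_]; last by rewrite conjc0 mul0r.
by rewrite conjc1 mul1r addn1.
Qed.

(** By [EopE], the projection onto functions free of [z_l], that is the substitution z_l = 0. *)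
Definition Eop (l : 'I_n) u : ell2 := u - Aop (shift l) (Bop (shift l) u).

Fact Eop_linear l : linear (Eop l).
Proof. by move=> t u v; rewrite /Eop 2!linearP opprD addrACA scalerBr. Qed.

HB.instance Definition _ l := GRing.isLinear.Build C ell2 ell2 *:%R (Eop l) (@Eop_linear l).

Lemma EopE l u k : Eop l u k = if k l == 0%N then u k else 0.
Proof.
rewrite /Eop ell2D ell2N AopE conv_shift; case e : (k l) => [|x]; first by rewrite eqxx subr0.
by rewrite Bop_shift setk_same setk_setk (_ : setk k l x.+1 = k) ?subrr // -e setk_id.
Qed.

Lemma ip_Eop l u v : ip (Eop l u) v = ip u (Eop l v).
Proof.
rewrite /Eop ipDl ipNl ipDr ipNr adjoint_op; congr (_ - _).
by rewrite [RHS]ipC adjoint_op -ipC.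
Qed.

(** Setting z_l = 0 in the product replaces the factor by its value there. *)
Lemma Eop_Aop l (c : iso l) u : Eop l (Aop c u) = c 0%N *: Eop l u.
Proof.
apply: ell2_ext => k; rewrite ell2Z !EopE; case: eqP => [k0|_]; last by rewrite mulr0.
have e : setk k l 0 = k by apply/ffunP => j; rewrite ffunE; case: eqP => // ->.
by rewrite AopE /conv k0 big_ord1 subn0 e.
Qed.

Lemma Bop_Eop l (c : iso l) u : Bop c (Eop l u) = conjc (c 0%N) *: Eop l u.
Proof.
apply: ip_eqr => w; rewrite -adjoint_op -ip_Eop Eop_Aop ipZl ipZr ip_Eop.
by rewrite conjcK.
Qed.

Lemma Eop_comm l l' u : Eop l (Eop l' u) = Eop l' (Eop l u).
Proof. by apply: ell2_ext => k; rewrite !EopE; case: ifP => //; case: ifP. Qed.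

Lemma Eop_AopC l l' (c : iso l') u : l != l' -> Eop l (Aop c u) = Aop c (Eop l u).
Proof.
by move=> ll; rewrite /Eop linearB -ABop_comm 1?eq_sym // Aop_comm.
Qed.

Lemma Eop_BopC l l' (c : iso l') u : l != l' -> Eop l (Bop c u) = Bop c (Eop l u).
Proof.
by move=> ll; rewrite /Eop linearB Bop_comm ABop_comm.
Qed.

End operators.

(** * The commutator of the defect operators *)

Section commutator_algebra.
Variables (R : realType) (n : nat).
Local Notation C := R[i].
Local Notation normc := Normc.normc.
Local Notation K := {ffun 'I_n -> nat}.
Local Notation ell2 := (ell2 R n).
Variable c : forall l : 'I_n, iso R l.
Implicit Types (u v w x y : ell2) (t : C) (z : 'rV[C]_n) (l m i j : 'I_n) (s r : seq 'I_n).
Implicit Types (X : {linear ell2 -> ell2}).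

Local Notation A l := (Aop (c l)).
Local Notation B l := (Bop (c l)).
Local Notation M l := (Aop (shift R l)).
Local Notation N l := (Bop (shift R l)).
Local Notation E l := (Eop l).
Local Notation one := (delta R (zerok n)).

Definition Qop l u : ell2 := u - A l (B l u).

Fact Qop_linear l : linear (Qop l).
Proof. by move=> t u v; rewrite /Qop 2!linearP opprD addrACA scalerBr. Qed.

HB.instance Definition _ l :=
  GRing.isLinear.Build C ell2 ell2 *:%R (Qop l) (@Qop_linear l).

Lemma Qop_Aop l u : Qop l (A l u) = 0.
Proof. by rewrite /Qop AopK subrr. Qed.

Lemma Qop_eq0 l u : Qop l u = 0 -> A l (B l u) = u.
Proof. by move=> /eqP; rewrite /Qop subr_eq0 => /eqP. Qed.

Lemma Qop_commute X l u : (forall x, X (A l x) = A l (X x)) ->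
  (forall x, X (B l x) = B l (X x)) -> X (Qop l u) = Qop l (X u).
Proof. by move=> XA XB; rewrite /Qop linearB XA XB. Qed.

Lemma Qop_AopC l m (d : iso R m) u : m != l -> Aop d (Qop l u) = Qop l (Aop d u).
Proof. by move=> ml; apply: Qop_commute => x; [exact: Aop_comm|exact: ABop_comm]. Qed.

Lemma Qop_BopC l m (d : iso R m) u : m != l -> Bop d (Qop l u) = Qop l (Bop d u).
Proof.
move=> ml; apply: Qop_commute => x; last exact: Bop_comm.
by rewrite ABop_comm // eq_sym.
Qed.

Lemma Qop_comm l m u : Qop l (Qop m u) = Qop m (Qop l u).
Proof.
have [->//|lm] := eqVneq l m.
by apply: Qop_commute => x; rewrite ?Qop_AopC ?Qop_BopC // eq_sym.
Qed.

Lemma ip_Qop l u v : ip (Qop l u) v = ip u (Qop l v).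
Proof.
rewrite /Qop ipDl ipNl ipDr ipNr adjoint_op; congr (_ - _).
by rewrite [RHS]ipC adjoint_op -ipC.
Qed.

(** A list lets [i] and [j] stand in front; [Qop_comm] makes their order immaterial. *)
Definition defect_proj s u : ell2 := foldr Qop u s.

Fact defect_proj_linear s : linear (defect_proj s).
Proof. by move=> t u v; elim: s => //= l s ->; rewrite linearP. Qed.

HB.instance Definition _ s :=
  GRing.isLinear.Build C ell2 ell2 *:%R (defect_proj s) (@defect_proj_linear s).

Lemma defect_proj_commute X s u : (forall l x, l \in s -> X (Qop l x) = Qop l (X x)) ->
  X (defect_proj s u) = defect_proj s (X u).
Proof.
elim: s => //= l s IH h; rewrite h ?mem_head // IH // => m x ms.
by apply: h; rewrite in_cons ms orbT.
Qed.

Lemma defect_proj_Aop m (d : iso R m) s u : m \notin s ->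
  Aop d (defect_proj s u) = defect_proj s (Aop d u).
Proof.
move=> ms; apply: defect_proj_commute => l x ls; apply: Qop_AopC.
by apply: contraNneq ms => ->.
Qed.

Lemma defect_proj_Bop m (d : iso R m) s u : m \notin s ->
  Bop d (defect_proj s u) = defect_proj s (Bop d u).
Proof.
move=> ms; apply: defect_proj_commute => l x ls; apply: Qop_BopC.
by apply: contraNneq ms => ->.
Qed.

Lemma defect_proj_Qop m s u : Qop m (defect_proj s u) = defect_proj s (Qop m u).
Proof. by apply: defect_proj_commute => l x _; exact: Qop_comm. Qed.

Lemma defect_proj_Eop m s u : m \notin s -> E m (defect_proj s u) = defect_proj s (E m u).
Proof.
by move=> ms; rewrite /Eop linearB defect_proj_Bop // defect_proj_Aop.
Qed.

Lemma ip_Ws s u v : ip (defect_proj s u) v = ip u (defect_proj s v).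
Proof.
elim: s u v => //= l s IH u v.
by rewrite ip_Qop IH -defect_proj_Qop.
Qed.

Lemma defect_proj_mem s l u : uniq s -> l \in s -> defect_proj s (A l u) = 0.
Proof.
elim: s => //= m s IH /andP[ms us]; rewrite in_cons => /orP[/eqP ->|ls].
  by rewrite -defect_proj_Aop // Qop_Aop.
by rewrite IH // linear0.
Qed.

(** Telescoping: u - Q_l P u = (u - P u) + A_l B_l P u, with P the product for the tail. With
    [defect_proj_sum0], the kernel of the projection is exactly the algebraic sum of the ranges,
    without taking a closure. *)
Lemma defect_proj_decomp s u : uniq s ->
  exists g : 'I_n -> ell2, u - defect_proj s u = \sum_(l <- s) A l (g l).
Proof.
elim: s => [_|l s IH /= /andP[ls /IH[g e]]].
  by exists (fun=> 0); rewrite big_nil /= subrr.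
exists (fun m => if m == l then B l (defect_proj s u) else g m).
rewrite big_cons eqxx (eq_big_seq (fun m => A m (g m))) => [|m ms]; last first.
  by case: eqP => // ml; rewrite -ml ms in ls.
by rewrite -e /Qop opprB addrCA addrC.
Qed.

Lemma defect_proj_ker_decomp s u : uniq s -> defect_proj s u = 0 ->
  exists g : 'I_n -> ell2, u = \sum_(l <- s) A l (g l).
Proof. by move=> us u0; have [g] := defect_proj_decomp u us; rewrite u0 subr0; exists g. Qed.

Lemma defect_proj_sum0 s (g : 'I_n -> ell2) : uniq s -> defect_proj s (\sum_(l <- s) A l (g l)) = 0.
Proof.
move=> us; rewrite linear_sum big_seq big1 // => l ls; exact: defect_proj_mem.
Qed.

Lemma defect_proj_idem s u : uniq s -> defect_proj s (u - defect_proj s u) = 0.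
Proof. by move=> us; have [g ->] := defect_proj_decomp u us; exact: defect_proj_sum0. Qed.

Lemma defect_proj_ker_shift s i u : uniq s -> defect_proj s u = 0 -> defect_proj s (M i u) = 0.
Proof.
move=> us /(defect_proj_ker_decomp us)[g ->]; rewrite linear_sum /=.
under eq_bigr do rewrite Aop_comm.
exact: (@defect_proj_sum0 s (fun l => M i (g l))).
Qed.

(* [Dop s i] is the defect operator on coefficients, [defect_proj s] being the
   projection onto the orthogonal complement of the submodule. *)
Definition Dop s i u : ell2 := u - M i (N i u - defect_proj s (N i u)).

Lemma Dop_ker s i u : uniq s -> defect_proj s u = 0 -> defect_proj s (Dop s i u) = 0.
Proof.
move=> us u0; rewrite /Dop linearB /= u0 defect_proj_ker_shift ?subrr //.
exact: defect_proj_idem.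
Qed.

Definition Fop i x : ell2 := A i (E i (B i x)).

(** As M_i N_i = 1 - E_i and A_i B_i x = x, the difference M_i N_i x - A_i M_i N_i B_i x loses its
    two copies of x. *)
Lemma shift_Qop_shift i x : Qop i x = 0 -> M i (Qop i (N i x)) = Fop i x - E i x.
Proof.
move=> /Qop_eq0 xE; rewrite /Qop linearB /= Aop_comm Bop_comm.
rewrite -[M i (N i x)](subKr x) -/(E i x) -[M i (N i (B i x))](subKr (B i x)) -/(E i (B i x)).
by rewrite [A i (_ - _)]linearB /= xE -/(Fop i x) [- (x - Fop i x)]opprB addrC addrA subrK.
Qed.

Section two_indices.
Variables (i j : 'I_n) (r : seq 'I_n).
Hypotheses (ij : i != j) (ir : i \notin r) (jr : j \notin r).
Local Notation W := (defect_proj r).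
Local Notation s := (i :: j :: r).

(** The hypothesis says that [Qop j (W u)] lies in the kernel of [Qop i], where [shift_Qop_shift]
    applies. *)
Lemma DopE u : defect_proj s u = 0 ->
  Dop s i u = E i u + (Fop i (Qop j (W u)) - E i (Qop j (W u))).
Proof.
move=> /= u0; rewrite /Dop linearB /= opprB addrCA addrC; congr (_ + _).
rewrite -shift_Qop_shift // -!defect_proj_Bop // -Qop_BopC //.
Qed.

End two_indices.

Lemma Dop_swap i j r l u : Dop (j :: i :: r) l u = Dop (i :: j :: r) l u.
Proof. by rewrite /Dop /= Qop_comm. Qed.

Lemma defect_proj_swap i j r u : defect_proj (i :: j :: r) u = defect_proj (j :: i :: r) u.
Proof. by rewrite /= Qop_comm. Qed.

Lemma Fop_EopC i j x : i != j -> E j (Fop i x) = Fop i (E j x).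
Proof.
by move=> ij; rewrite /Fop Eop_AopC 1?eq_sym // Eop_comm Eop_BopC 1?eq_sym.
Qed.

Lemma Fop_Ws i r x : i \notin r -> Fop i (defect_proj r x) = defect_proj r (Fop i x).
Proof. by move=> ir; rewrite /Fop defect_proj_Bop // defect_proj_Eop // defect_proj_Aop. Qed.

(** A vector in the kernel of [Qop i] is in the range of A_i, and E_i A_i = 0 when [c i 0 = 0], so
    the last term of [DopE] drops out. *)
Lemma Dop_vanishing i j r u : i != j -> i \notin r -> j \notin r ->
  c i 0%N = 0 -> defect_proj (i :: j :: r) u = 0 ->
  Dop (i :: j :: r) i u = E i u + Fop i (Qop j (defect_proj r u)).
Proof.
move=> ij ir jr ci0 u0; rewrite DopE //.
have /Qop_eq0 <- : Qop i (Qop j (defect_proj r u)) = 0 by [].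
by rewrite [in X in _ - X]Eop_Aop ci0 scale0r subr0.
Qed.

(** The outcome is symmetric in [i] and [j], so computing the other order by the same lemma proves
    commutation. *)
Lemma Dop_comm_vanishing_half i j r u : i != j -> i \notin r -> j \notin r ->
  uniq r -> c i 0%N = 0 -> c j 0%N = 0 -> defect_proj (i :: j :: r) u = 0 ->
  Dop (i :: j :: r) i (Dop (i :: j :: r) j u) =
  E i (E j u) + (Fop j (E i (defect_proj r u)) + Fop i (E j (defect_proj r u))).
Proof.
move=> ij ir jr ur ci0 cj0 u0.
have us : uniq (i :: j :: r) by rewrite /= in_cons negb_or ij ir jr.
have ji : j != i by rewrite eq_sym.
have u0' : defect_proj (j :: i :: r) u = 0 by rewrite defect_proj_swap.
rewrite Dop_vanishing //; last exact: Dop_ker.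
rewrite -(Dop_swap i j) Dop_vanishing // linearD /= -addrA; congr (_ + _).
rewrite Fop_EopC //.
have -> : E i (Qop i (defect_proj r u)) = E i (defect_proj r u).
  by rewrite /Qop linearB /= Eop_Aop ci0 scale0r subr0.
(* Q_j kills the range of [Fop j], which lies in that of A_j, and fixes the range of E_j because B_j
   E_j = 0. *)
congr (_ + _); rewrite linearD /= [Qop j _]linearD /= -[defect_proj r (Fop j _)]Fop_Ws //.
rewrite [Qop j (Fop j _)]Qop_Aop addr0 -defect_proj_Eop //.
by rewrite /Qop Bop_Eop cj0 conjc0 scale0r linear0 subr0.
Qed.

Lemma Dop_comm_vanishing i j r u : i != j -> i \notin r -> j \notin r ->
  uniq r -> c i 0%N = 0 -> c j 0%N = 0 -> defect_proj (i :: j :: r) u = 0 ->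
  Dop (i :: j :: r) i (Dop (i :: j :: r) j u) =
  Dop (i :: j :: r) j (Dop (i :: j :: r) i u).
Proof.
move=> ij ir jr ur ci0 cj0 u0; rewrite Dop_comm_vanishing_half //.
have u0' : defect_proj (j :: i :: r) u = 0 by rewrite defect_proj_swap.
rewrite -(Dop_swap i j r j) -(Dop_swap i j r i) Dop_comm_vanishing_half //.
  by rewrite Eop_comm; congr (_ + _); rewrite addrC.
by rewrite eq_sym.
Qed.

Lemma Eop_one l : E l one = one.
Proof.
apply: ell2_ext => k; rewrite EopE; case: eqP => // kl.
by rewrite deltaE; case: eqP => // k0; case: kl; rewrite k0 ffunE.
Qed.

Lemma Bop_one l : B l one = conjc (c l 0%N) *: one.
Proof. by rewrite -{1}(Eop_one l) Bop_Eop Eop_one. Qed.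

Lemma Eop_Aop_one l : E l (A l one) = c l 0%N *: one.
Proof. by rewrite Eop_Aop Eop_one. Qed.

Lemma ev_defect_proj_one r z : polydisc z -> uniq r ->
  ev (defect_proj r one) z = \prod_(l <- r) (1 - conjc (c l 0%N) * iso_fun (c l) z).
Proof.
move=> zin; elim: r => [_|l r IH /= /andP[lr /IH e]].
  by rewrite big_nil ev_delta0.
rewrite big_cons -e /Qop defect_proj_Bop // Bop_one linearZ /= linearZ /=.
by rewrite evB // evZ // ev_Aop // mulrBl mul1r mulrA.
Qed.

Lemma Qop_one l : Qop l one = one - conjc (c l 0%N) *: A l one.
Proof. by rewrite /Qop Bop_one linearZ. Qed.

(** Q_i annihilates the test vector, so the inner operator acts as E_j and returns [c j 0] times A_i
    1; only the outer operator needs the full formula of [DopE]. *)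
Lemma Dop_test i j r : i != j -> i \notin r -> j \notin r -> uniq r ->
  Dop (i :: j :: r) i (Dop (i :: j :: r) j (A i (A j one))) =
  (c i 0%N * c j 0%N) *: one +
  c j 0%N *: (A i (defect_proj r (Qop j one)) - c i 0%N *: defect_proj r (Qop j one)).
Proof.
move=> ij ir jr ur.
have us : uniq (i :: j :: r) by rewrite /= in_cons negb_or ij ir jr.
have ji : j != i by rewrite eq_sym.
have u0 : defect_proj (i :: j :: r) (A i (A j one)) = 0.
  by apply: defect_proj_mem => //; rewrite mem_head.
have e1 : Dop (i :: j :: r) j (A i (A j one)) = c j 0%N *: A i one.
  rewrite -(Dop_swap i j r j) DopE //; last by rewrite -(defect_proj_swap i j).
  have q0 : Qop i (defect_proj r (A i (A j one))) = 0 by rewrite -defect_proj_Aop // Qop_Aop.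
  have f0 : Fop j 0 = 0 by rewrite /Fop 3!linear0.
  rewrite q0 f0 linear0 subrr addr0.
  by rewrite Eop_AopC // Eop_Aop_one linearZ.
have k1 : defect_proj (i :: j :: r) (c j 0%N *: A i one) = 0.
  by rewrite linearZ /= -defect_proj_Aop // -Qop_AopC // Qop_Aop scaler0.
rewrite e1 DopE // linearZ /= Eop_Aop_one scalerA mulrC; congr (_ + _).
rewrite linearZ /= linearZ /= /Fop 4!linearZ /= -scalerBr; congr (_ *: _).
rewrite -defect_proj_Aop // -Qop_AopC // -defect_proj_Qop.
have eQ : E i (Qop j (defect_proj r one)) = Qop j (defect_proj r one).
  have -> : E i (Qop j (defect_proj r one)) = Qop j (E i (defect_proj r one)).
    by apply: Qop_commute => y; [exact: Eop_AopC|exact: Eop_BopC].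
  by rewrite defect_proj_Eop // Eop_one.
by rewrite AopK Eop_Aop eQ.
Qed.

(** With t = [c l 0], the squared norm of A_l 1 - t is 1 - |t|^2; were it 0, the function would be
    the constant t. *)
Lemma iso_coef0_lt1 l : (exists2 z, polydisc z & iso_fun (c l) z != c l 0%N) ->
  1 - conjc (c l 0%N) * c l 0%N != 0.
Proof.
move=> [z zin]; apply: contraNneq => /eqP; rewrite subr_eq0 => /eqP h.
pose t := c l 0%N; pose x := A l one - t *: one.
suff /nrm2_eq0 : nrm2 x = 0.
  move=> /eqP; rewrite /x subr_eq0 => /eqP e.
  have := ev_Aop (c l) one zin; rewrite e evZ // ev_delta0 // !mulr1 => <-.
  by [].
have xt : ip (A l one) one = t.
  rewrite ip_deltar; have := Aop_delta (c l) (zerok n) 0.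
  by rewrite addn0 setk_id.
have oo : ip one one = 1 by rewrite ip_deltar deltaE eqxx.
have xx : ip (A l one) (A l one) = 1 by rewrite adjoint_op AopK.
have : ip x x = 0.
  rewrite /x ipDl !ipDr !ipNl !ipNr !ipZl !ipZr xx oo xt (ipC one) xt.
  by rewrite mulr1 [t * conjc t]mulrC -h; ring.
by rewrite ip_self => /(congr1 (@complex.Re R)).
Qed.

End commutator_algebra.

(** * The submodule and its defect operators *)

Lemma inner_iso (R : realType) (n : nat) (l : 'I_n) (psi : 'rV[R[i]]_n -> R[i]) :
  inner_function psi -> depends_only_on l psi ->
  exists c : iso R l, one_var c l psi.
Proof.
move=> ip dp; have [_ /analytic_taylor[a ap] _] := ip.
have cp := taylor_one_var ap dp.
by exists (Iso (inner_isometric cp ip)).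
Qed.

Section submodule.
Variables (R : realType) (n : nat) (L : {set 'I_n}).
Variables (phi : 'I_n -> 'rV[R[i]]_n -> R[i]) (c : forall l : 'I_n, iso R l).
Variable s : seq 'I_n.
Hypotheses (cphi : forall l, l \in L -> one_var (c l) l (phi l))
  (us : uniq s) (sL : forall l, (l \in s) = (l \in L)).
Local Notation C := R[i].
Local Notation ell2 := (ell2 R n).
Local Notation S := (sum_phiH2 L phi).
Implicit Types (u v : ell2) (f g : 'rV[C]_n -> C).

Lemma ev_sum (I : Type) (r : seq I) (F : I -> ell2) z : polydisc z ->
  ev (\sum_(k <- r) F k) z = \sum_(k <- r) ev (F k) z.
Proof.
move=> zin; elim: r => [|k r IH].
  by rewrite !big_nil -(scale0r 0) evZ // mul0r.
by rewrite !big_cons evD // IH.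
Qed.

Lemma sum_in_L (F : 'I_n -> C) : \sum_(l in L) F l = \sum_(l <- s) F l.
Proof. by rewrite big_uniq //; apply: eq_bigl => l; rewrite sL. Qed.

Lemma S_coef f : S f -> exists2 u, defect_proj c s u = 0 & forall z, polydisc z -> f z = ev u z.
Proof.
move=> [g [gH fg]].
have hv l : exists v, l \in L -> forall z, polydisc z -> g l z = ev v z.
  have [lL|_] := boolP (l \in L); last by exists 0.
  by have [v gv] := H2_ev (gH l lL); exists v.
pose v l := projT1 (cid (hv l)).
have gv l : l \in L -> forall z, polydisc z -> g l z = ev (v l) z.
  exact: projT2 (cid (hv l)).
exists (\sum_(l <- s) Aop (c l) (v l)); first exact: defect_proj_sum0.
move=> z zin; rewrite fg // ev_sum // sum_in_L; apply: eq_big_seq => l.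
by rewrite sL => lL; rewrite ev_Aop // gv // (iso_funE (cphi lL)).
Qed.

Lemma coef_S f u : defect_proj c s u = 0 -> (forall z, polydisc z -> f z = ev u z) -> S f.
Proof.
move=> /(defect_proj_ker_decomp us)[g ug] fu; exists (fun l => ev (g l)).
split=> [l _|z zin]; first exact: ev_H2.
rewrite fu // ug ev_sum // sum_in_L; apply: eq_big_seq => l.
by rewrite sL => lL; rewrite ev_Aop // (iso_funE (cphi lL)).
Qed.

Lemma mulz_ev i f u : (forall z, polydisc z -> f z = ev u z) ->
  forall z, polydisc z -> mulz i f z = ev (Aop (shift R i) u) z.
Proof. by move=> fu z zin; rewrite /mulz fu // ev_Aop // iso_fun_shift. Qed.

(** [adjoint] picks some witness. The projection of N_i u onto S is one, and any other agrees with
    it on the polydisc, since their difference lies in S and is orthogonal to itself. *)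
Lemma adjoint_ev i g u : (forall z, polydisc z -> g z = ev u z) ->
  forall z, polydisc z ->
  adjoint S (mulz i) g z = ev (Bop (shift R i) u - defect_proj c s (Bop (shift R i) u)) z.
Proof.
move=> gu; set y := Bop _ u; set x := y - defect_proj c s y.
have ipx v : defect_proj c s v = 0 -> ip v x = ip v y.
  by move=> v0; rewrite /x ipDr ipNr -ip_Ws v0 ip0l subr0.
have x0 : defect_proj c s x = 0 by exact: defect_proj_idem.
have mem : [set h | S h /\ forall f, S f ->
    h2inner (mulz i f) g = h2inner f h] (ev x).
  split; first exact: (coef_S x0).
  move=> f /S_coef[v v0 fv].
  rewrite (h2inner_ev (mulz_ev i fv) gu) (h2inner_ev (v := x) fv) //.
  by rewrite ipx // adjoint_op.
have [] := xgetPex (fun=> 0) (ex_intro _ _ mem); rewrite -/(adjoint S (mulz i) g).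
move: (adjoint S (mulz i) g) => h Sh hh z zin.
have [w w0 hw] := S_coef Sh; rewrite hw //; congr (ev _ z).
have e v : defect_proj c s v = 0 -> ip v w = ip v x.
  move=> v0; rewrite ipx // -adjoint_op.
  have Sv : S (ev v) by exact: (coef_S v0).
  rewrite -(h2inner_ev (mulz_ev i (fun z _ => erefl (ev v z))) gu) hh //.
  by rewrite (h2inner_ev (u := v) (v := w)).
apply/eqP; rewrite -subr_eq0; apply/eqP/nrm2_eq0.
have d0 : defect_proj c s (w - x) = 0 by rewrite linearB /= w0 x0 subrr.
have : ip (w - x) (w - x) = 0 by rewrite ipDr ipNr e // subrr.
by rewrite ip_self => /(congr1 (@complex.Re R)).
Qed.

Lemma defect_ev i g u : (forall z, polydisc z -> g z = ev u z) ->
  forall z, polydisc z -> defect S i g z = ev (Dop c s i u) z.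
Proof.
move=> gu z zin.
rewrite /Dop evB // ev_Aop // iso_fun_shift /defect /= /mulz.
by rewrite (adjoint_ev i gu zin) gu.
Qed.

Lemma commutator_defect_ev i j f u : (forall z, polydisc z -> f z = ev u z) ->
  forall z, polydisc z ->
  commutator (defect S i) (defect S j) f z =
  ev (Dop c s i (Dop c s j u) - Dop c s j (Dop c s i u)) z.
Proof.
move=> fu z zin; rewrite /commutator /= evB //; congr (_ - _).
  by rewrite (defect_ev i (defect_ev j fu)).
by rewrite (defect_ev j (defect_ev i fu)).
Qed.

Lemma commutator_defect_eq0 i j :
  (forall f, S f -> forall z, polydisc z ->
     commutator (defect S i) (defect S j) f z = 0) <->
  (forall u, defect_proj c s u = 0 -> Dop c s i (Dop c s j u) = Dop c s j (Dop c s i u)).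
Proof.
split=> [h u u0|h f /S_coef[u u0 fu] z zin].
  apply: ev_inj => z zin; apply/eqP; rewrite -subr_eq0 -evB //; apply/eqP.
  rewrite -(commutator_defect_ev i j (fun z _ => erefl (ev u z)) zin).
  by apply: h => //; exact: (coef_S u0).
rewrite (commutator_defect_ev i j fu zin) h // subrr.
by rewrite -(scale0r 0) evZ // mul0r.
Qed.

End submodule.

Lemma commutator_coef0 (R : realType) (n : nat) (c : forall l : 'I_n, iso R l)
    (i j : 'I_n) (r : seq 'I_n) :
  i != j -> i \notin r -> j \notin r -> uniq r ->
  (forall l, l \in i :: j :: r ->
     exists2 z, polydisc z & iso_fun (c l) z != c l 0%N) ->
  (forall u, defect_proj c (i :: j :: r) u = 0 ->
     Dop c (i :: j :: r) i (Dop c (i :: j :: r) j u) =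
     Dop c (i :: j :: r) j (Dop c (i :: j :: r) i u)) ->
  c i 0%N = 0.
Proof.
move=> ij ir jr ur nc h.
have ji : j != i by rewrite eq_sym.
pose one := delta R (zerok n).
have us : uniq (i :: j :: r) by rewrite /= in_cons negb_or ij ir jr.
have u0 : defect_proj c (i :: j :: r) (Aop (c i) (Aop (c j) one)) = 0.
  by apply: defect_proj_mem => //; rewrite mem_head.
have := h _ u0; rewrite Dop_test // -(Dop_swap c i j r j) -(Dop_swap c i j r i).
rewrite (Aop_comm (c i) (c j)) Dop_test // [c j 0%N * _]mulrC => /addrI e.
have nj : j \in i :: j :: r by rewrite !in_cons eqxx orbT.
have [w win wj] := nc j nj.
(* At this point every factor with l <> j takes its value at 0, so W1 becomes the product of the 1 -
   |c_l(0)|^2, while [phi_j] still differs from [c j 0]. *)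
pose z : 'rV[R[i]]_n := \row_k (if k == j then w ord0 j else 0).
have zin : polydisc z by move=> k; rewrite mxE; case: ifP => _ //; rewrite Normc.normc0.
have iso_axis l (x y : 'rV[R[i]]_n) : polydisc x -> polydisc y -> x ord0 l = y ord0 l ->
    iso_fun (c l) x = iso_fun (c l) y.
  by move=> _ _ xy; rewrite !iso_fun_tsum xy.
have zj : iso_fun (c j) z != c j 0%N.
  by rewrite (iso_axis j z w) // mxE eqxx.
have z0 l : l != j -> iso_fun (c l) z = c l 0%N.
  move=> lj; rewrite (iso_axis l z 0) // ?rv0E; last by rewrite mxE (negPf lj).
    by apply: (one_var0 (iso_one_var (c l))).
  exact: polydisc0.
pose om := \prod_(l <- r) (1 - conjc (c l 0%N) * iso_fun (c l) z).
have omE : ev (defect_proj c r one) z = om by rewrite ev_defect_proj_one.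
have om0 : om != 0.
  rewrite /om prodf_seq_neq0; apply/allP => l lr /=.
  rewrite z0; last by apply: contraNneq jr => <-.
  by apply: iso_coef0_lt1; apply: nc; rewrite !in_cons lr !orbT.
have evW l : l \notin r -> ev (defect_proj c r (Qop c l one)) z =
    (1 - conjc (c l 0%N) * iso_fun (c l) z) * om.
  move=> lr; rewrite Qop_one linearB linearZ /= -defect_proj_Aop // evB // evZ // ev_Aop // omE.
  by rewrite mulrBl mul1r mulrA.
have := evW i ir; have := evW j jr; rewrite -/one in e *.
move: (defect_proj c r (Qop c i one)) (defect_proj c r (Qop c j one)) e => x y e ey ex.
have := congr1 (fun u => ev u z) e; rewrite /=.
rewrite !evZ // !evB // !evZ // !ev_Aop // ex ey (z0 i ij) subrr mulr0.
(* One side vanishes because [phi_i] equals a at [z]; the other is a (phi_j - b) (1 - |a|^2) W1, all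
   of whose factors but a are nonzero. *)
move=> /esym/eqP; rewrite -mulrBl !mulf_eq0 (negPf om0) orbF subr_eq0 (negPf zj) /=.
have /iso_coef0_lt1/negPf -> : exists2 z, polydisc z & iso_fun (c i) z != c i 0%N.
  by apply: nc; rewrite mem_head.
by rewrite orbF => /eqP.
Qed.

Theorem theorem1p5 (R : realType) (n : nat) (hn : (2 <= n)%N)
    (L : {set 'I_n}) (phi : 'I_n -> 'rV[R[i]]_n -> R[i])
    (phi_inner : forall l, l \in L -> inner_function (phi l))
    (phi_nonconst : forall l, l \in L -> nonconstant (phi l))
    (phi_var : forall l, l \in L -> depends_only_on l (phi l))
    (i j : 'I_n) (hi : i \in L) (hj : j \in L) (hij : i != j) :
  let S := sum_phiH2 L phi in
  (forall f, S f -> forall z, polydisc z ->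
     commutator (defect S i) (defect S j) f z = 0)
  <-> (phi i 0 = 0 /\ phi j 0 = 0).
Proof.
move=> S.
have hc l : exists c : iso R l, l \in L -> one_var c l (phi l).
  (* The choice [shift] outside [L] is a filler that makes the family total. *)
  have [lL|_] := boolP (l \in L); last by exists (shift R l).
  by have [c cp] := inner_iso (phi_inner l lL) (phi_var l lL); exists c.
pose c l := projT1 (cid (hc l)).
have cphi l : l \in L -> one_var (c l) l (phi l) by exact: projT2 (cid (hc l)).
have c0 l : l \in L -> phi l 0 = c l 0%N by move=> /cphi /one_var0.
have nc l : l \in L -> exists2 z, polydisc z & iso_fun (c l) z != c l 0%N.
  move=> lL; have [z [w [zin win zw]]] := phi_nonconst l lL.
  have e x : polydisc x -> iso_fun (c l) x = phi l x by exact: iso_funE (cphi l lL).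
  (* Of two distinct values of [phi l], at least one differs from its value at 0. *)
  have [ez|nez] := eqVneq (phi l z) (c l 0%N); last by exists z; rewrite ?e.
  by exists w; rewrite ?e // -ez; apply/eqP => wz; apply: zw.
pose r := [seq l <- enum L | (l != i) && (l != j)].
have ir : i \notin r by rewrite mem_filter eqxx.
have jr : j \notin r by rewrite mem_filter eqxx andbF.
have ur : uniq r by rewrite filter_uniq ?enum_uniq.
have us : uniq (i :: j :: r) by rewrite /= in_cons negb_or hij ir jr.
have sL l : (l \in i :: j :: r) = (l \in L).
  rewrite !in_cons mem_filter mem_enum.
  by case: eqVneq => [->|_] /=; [rewrite hi|case: eqVneq => [->|_] //=; rewrite hj].
have ji : j != i by rewrite eq_sym.
rewrite (commutator_defect_eq0 cphi us sL) !c0 //; split=> [h|[ci0 cj0] u u0].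
  split; first by apply: (commutator_coef0 hij ir jr ur _ h) => l; rewrite sL => /nc.
  (* The hypothesis is symmetric in [i] and [j] up to the order of the list, so the same lemma
     serves the second index. *)
  apply: (@commutator_coef0 _ _ c j i r) => // [l|u u0].
    by rewrite !in_cons orbCA -!in_cons sL => /nc.
  by rewrite !(Dop_swap c i j) h // (defect_proj_swap c i j).
exact: Dop_comm_vanishing.
Qed.
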